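(* Let $\sigma\ge 1$ be a given real number. Let $u_0\in H^2(\mathbb{T};\mathbb{C})$. There exists $T>0$ and a unique $u\in C(0,T;H^2)$ satisfying $$u=e^{i\partial_x^2t}u_0-\int_0^te^{i\partial_x^2(t-s)}|u|^{2\sigma}u_x\,ds .$$ Furthermore, the solution depends continuously upon the initial conditions in the $H^s$ norm for all $0\le s<2$.
   Context: $\mathbb{T}=[0,2\pi)$ is the one-dimensional torus (spatially periodic setting), and $H^s=H^s(\mathbb{T};\mathbb{C})$ is the $L^2$-based Sobolev space of complex-valued periodic functions. $e^{i\partial_x^2t}$ is the free Schrödinger group, i.e. the Fourier multiplier with symbol $e^{-ik^2t}$. $C(0,T;H^2)$ denotes the functions of time on $[0,T]$ that are continuous with values in $H^2$. In the integral, $|u|^{2\sigma}u_x$ is evaluated at time $s$. The displayed integral equation is the mild (Duhamel) form of the generalized derivative nonlinear Schrödinger equation $iu_t+i|u|^{2\sigma}u_x+u_{xx}=0$ with initial condition $u(\cdot,0)=u_0$. *)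

(* Defs.v *)
From HB Require Import structures.
From mathcomp Require Import all_boot all_order all_algebra.
From mathcomp Require Import all_classical all_reals all_analysis.
From mathcomp Require Import complex.

Set Implicit Arguments.
Unset Strict Implicit.
Unset Printing Implicit Defensive.

Import Order.TTheory GRing.Theory Num.Theory.
Import numFieldNormedType.Exports.
Import ComplexField.Normc.

Local Open Scope classical_set_scope.
Local Open Scope ring_scope.
Local Open Scope complex_scope.

(* A function on the torus [0, 2pi) is a function [R -> R[i]] of which only the
   values on [torus] matter; two such functions are the same element of L^2 or
   H^s when they agree almost everywhere on [torus].  Periodicity is carried by
   the Fourier coefficients, through which H^s is defined. *)
Definition torus {R : realType} : set R := `[0, 2 * pi[.

Definition torus_eq {R : realType} (f g : R -> R[i]) : Prop :=
  f = g %[ae (@lebesgue_measure R) in torus].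

Definition expi {R : realType} (x : R) : R[i] := cos x +i* sin x.

Definition Cintegral {R : realType} (D : set R) (f : R -> R[i]) : R[i] :=
  Rintegral lebesgue_measure D (fun x => complex.Re (f x)) +i*
  Rintegral lebesgue_measure D (fun x => complex.Im (f x)).

Definition L2norm {R : realType} (f : R -> R[i]) : \bar R :=
  sqrte (\int[lebesgue_measure]_(x in torus) (normc (f x) ^+ 2)%:E)%E.

Definition L2 {R : realType} (f : R -> R[i]) : Prop :=
  [/\ measurable_fun torus (fun x => complex.Re (f x)),
      measurable_fun torus (fun x => complex.Im (f x)) &
      (L2norm f < +oo)%E].

Definition fourier {R : realType} (f : R -> R[i]) (k : int) : R[i] :=
  ((2 * pi)^-1)%:C * Cintegral torus (fun x => f x * expi (- (k%:~R * x))).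

Definition Hnorm {R : realType} (s : R) (f : R -> R[i]) : \bar R :=
  sqrte (\esum_(k in [set: int])
           ((1 + k%:~R ^+ 2) `^ s * normc (fourier f k) ^+ 2)%:E)%E.

(* The spaces with s >= 0, realised inside L^2. *)
Definition Sobolev {R : realType} (s : R) (f : R -> R[i]) : Prop :=
  L2 f /\ (Hnorm s f < +oo)%E.

(* An L^2 function with Fourier coefficients [m k * fourier f k]; it is unique
   up to [torus_eq], and the value is 0 when there is none. *)
Definition multiplier {R : realType} (m : int -> R[i]) (f : R -> R[i]) :
    R -> R[i] :=
  xget (fun=> 0) [set g | L2 g /\ forall k, fourier g k = m k * fourier f k].

Definition dx {R : realType} : (R -> R[i]) -> R -> R[i] :=
  multiplier (fun k => 0 +i* k%:~R).

Definition schrodinger {R : realType} (t : R) : (R -> R[i]) -> R -> R[i] :=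
  multiplier (fun k => expi (- (k%:~R ^+ 2 * t))).

Definition nonlinearity {R : realType} (sigma : R) (f : R -> R[i]) :
    R -> R[i] :=
  fun x => (normc (f x) `^ (2 * sigma))%:C * dx f x.

(* [w] is the Riemann integral over [a, b], a <= b, of the L^2-valued function
   [F]: the tagged Riemann sums converge to [w] in L^2 as the mesh tends to 0.
   For continuous [F] this is the Bochner integral. *)
Definition is_L2integral {R : realType} (F : R -> R -> R[i]) (a b : R)
    (w : R -> R[i]) : Prop :=
  L2 w /\
  forall eps : R, 0 < eps -> exists2 delta : R, 0 < delta &
    forall (n : nat) (p tag : nat -> R),
      p 0%N = a -> p n = b ->
      (forall i, (i < n)%N ->
         [/\ p i <= tag i, tag i <= p i.+1 & p i.+1 - p i < delta]) ->
      (L2norm (fun x => (\sum_(i < n) (p i.+1 - p i)%:C * F (tag i) x) - w x)%R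
         < eps%:E)%E.

Definition in_CH2 {R : realType} (T : R) (u : R -> R -> R[i]) : Prop :=
  (forall t : R, t \in `[0, T] -> Sobolev 2 (u t)) /\
  (forall t : R, t \in `[0, T] ->
     Hnorm 2 (u t' \- u t) @[t' --> within `[0, T] (nbhs t)] --> 0%E).

Definition mild_solution {R : realType} (sigma T : R) (u0 : R -> R[i])
    (u : R -> R -> R[i]) : Prop :=
  forall t : R, t \in `[0, T] ->
  exists2 w : R -> R[i],
    is_L2integral
      (fun s => schrodinger (t - s) (nonlinearity sigma (u s))) 0 t w &
    torus_eq (u t) (schrodinger t u0 \- w).

Definition CH2_solution {R : realType} (sigma T : R) (u0 : R -> R[i])
    (u : R -> R -> R[i]) : Prop :=
  in_CH2 T u /\ mild_solution sigma T u0 u.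

Definition has_unique_CH2_solution {R : realType} (sigma T : R)
    (u0 : R -> R[i]) : Prop :=
  exists2 u, CH2_solution sigma T u0 u &
    forall v, CH2_solution sigma T u0 v ->
      forall t : R, t \in `[0, T] -> torus_eq (v t) (u t).

(* Continuity of the solution map on the set [B] of initial data, from the H^s
   norm to the norm of C([0, T]; H^s). *)
Definition continuous_dependence {R : realType} (sigma T s : R)
    (B : set (R -> R[i])) : Prop :=
  forall u0, B u0 -> forall eps : R, 0 < eps ->
  exists2 delta : R, 0 < delta &
    forall v0, B v0 -> (Hnorm s (v0 \- u0)%R < delta%:E)%E ->
    forall u v, CH2_solution sigma T u0 u -> CH2_solution sigma T v0 v ->
    forall t : R, t \in `[0, T] -> (Hnorm s (v t \- u t)%R < eps%:E)%E.

Definition H2ball {R : realType} (u0 : R -> R[i]) (r : R) : set (R -> R[i]) :=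
  [set v0 | Sobolev 2 v0 /\ (Hnorm 2 (v0 \- u0)%R < r%:E)%E].

(* Main.v *)
(* In Fourier coefficients put u(t) = S(t) V(t) with S(t) the free group, so that
   V' = - S(-t) N(S(t) V) with N(u) = |u|^(2 sigma) u_x. On bounded sets of h^2
   the map N takes values in h^1 and is Lipschitz from h^1 to l^2. Integrating
   the transport term by parts gives, for both signs of th,
     |u - v + th (N u - N v)|^2 <= (1 + K |th|) |u - v|^2 + K th^2 |u - v|_1^2,
   so two approximate solutions bounded in h^2 satisfy a Gronwall estimate in
   l^2, forwards and backwards in time. This is applied
   - to the frequency-truncated explicit Euler scheme and its time shift: the
     discrete time derivative stays bounded in l^2, hence, through the equation,
     u_xx does, which bounds the scheme in h^2 on a time depending only on the
     h^2 norm of the data; the schemes are then Cauchy in l^2;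
   - to a solution and its time shifts, in both directions: the l^2 norm of u_t is
     continuous in time, which with weak continuity makes u_t continuous in l^2
     and, through the equation, u continuous in h^2;
   - to two solutions: this gives uniqueness and Lipschitz dependence in l^2,
     and interpolation with the h^2 bound gives continuity in h^s for s < 2.
   A mild solution is turned into such a V by comparing the Riemann sums over
   [0, a] and over [0, b]. *)
Require Import Defs.
From mathcomp Require Import all_boot all_order all_algebra.
From mathcomp Require Import all_classical all_reals all_analysis.
From mathcomp Require Import complex.
From mathcomp Require Import measurable_realfun.
From mathcomp Require Import ring lra zify.
Set Implicit Arguments.
Unset Strict Implicit.
Unset Printing Implicit Defensive.
Import Order.TTheory GRing.Theory Num.Theory.
Import numFieldNormedType.Exports.
Import ComplexField.Normc.
Local Open Scope classical_set_scope.
Local Open Scope ring_scope.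
Local Open Scope complex_scope.

(** * Weighted l^2 spaces of Fourier coefficients and the free group *)

Section Sequences.
Context {R : realType}.
Implicit Types (a b c : int -> R[i]) (z : R[i]).

(** [N] loses one derivative and the group gives none back, so Duhamel's formula cannot be solved in
    h^2 by a plain fixed point. What survives is the skewness of the transport term, and it is used
    only in l^2, where it asks no more than that [s ^ sigma] be Lipschitz on bounded sets of
    [s = |u|^2]: this is the role of [sigma >= 1]. The h^2 norm is never estimated by
    differentiating the nonlinearity twice in space. Two iterates, or a solution and its time shift,
    are compared in l^2 instead. The h^1 term of the accretivity estimate carries a factor [th^2].
    Between sequences bounded in h^2 its total over steps of size h is O(h) and disappears. Between
    consecutive iterates of the scheme that is not enough; there the truncation, under
    [h * (1 + N^2) * K <= 1], turns it into an l^2 term of first order. Norms occur only as bounds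
    on finite partial sums. Such bounds pass to limits one frequency at a time, so each estimate is
    proved for trigonometric polynomials or truncated schemes first. *)

Definition sq z : R := complex.Re z ^+ 2 + complex.Im z ^+ 2.

Lemma sqE z : normc z ^+ 2 = sq z.
Proof. by case: z => x y; rewrite /normc /sq /= sqr_sqrtr // addr_ge0 ?sqr_ge0. Qed.

Lemma sq_ge0 z : 0 <= sq z.
Proof. by rewrite /sq addr_ge0 ?sqr_ge0. Qed.

Lemma sqM (z w : R[i]) : sq (z * w) = sq z * sq w.
Proof. by rewrite -!sqE normcM exprMn. Qed.

Lemma sqN z : sq (- z) = sq z.
Proof. by case: z => x y; rewrite /sq /= !sqrrN. Qed.

Lemma sqC (x : R) : sq x%:C = x ^+ 2.
Proof. by rewrite /sq /= expr0n addr0. Qed.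

Lemma sq_expi (x : R) : sq (expi x) = 1.
Proof. by rewrite /sq /= cos2Dsin2. Qed.

Lemma sq0 : sq 0 = 0.
Proof. by rewrite /sq /= expr0n addr0. Qed.

(** The two sides differ by [t^-1 * sq (t * z - w)]. The factor [1 + t] on the main term, instead of
    2, is what allows Gronwall steps to be iterated. *)
Lemma sqD_le (t : R) (z w : R[i]) : 0 < t ->
  sq (z + w) <= (1 + t) * sq z + (1 + t^-1) * sq w.
Proof.
move=> t0; case: z => x y; case: w => p q; rewrite /sq /=.
have tn0 : t != 0 by rewrite gt_eqF.
have -> : (1 + t) * (x ^+ 2 + y ^+ 2) + (1 + t^-1) * (p ^+ 2 + q ^+ 2) =
  (x + p) ^+ 2 + (y + q) ^+ 2 + t^-1 * ((t * x - p) ^+ 2 + (t * y - q) ^+ 2).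
  by field.
by rewrite lerDl mulr_ge0 ?invr_ge0 ?(ltW t0) // addr_ge0 ?sqr_ge0.
Qed.

Lemma sqD2 (z w : R[i]) : sq (z + w) <= 2 * sq z + 2 * sq w.
Proof.
by apply: (le_trans (@sqD_le 1 z w ltr01)); rewrite invr1.
Qed.

Lemma sqB2 (z w : R[i]) : sq (z - w) <= 2 * sq z + 2 * sq w.
Proof. by rewrite -(sqN w) sqD2. Qed.

Lemma sqD3 (x y z : R[i]) : sq (x + y + z) <= 3 * (sq x + sq y + sq z).
Proof.
case: x => x x'; case: y => y y'; case: z => z z'; rewrite /sq /=.
have H (u v w : R) : (u + v + w) ^+ 2 <= 3 * (u ^+ 2 + v ^+ 2 + w ^+ 2).
  have := sqr_ge0 (u - v); have := sqr_ge0 (v - w); have := sqr_ge0 (u - w); nra.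
have := H x y z; have := H x' y' z'; lra.
Qed.

Lemma expiD (x y : R) : expi (x + y) = expi x * expi y.
Proof. by rewrite /expi cosD sinD; simpc; congr (_ +i* _); ring. Qed.

Lemma expi0 : expi 0 = 1 :> R[i].
Proof. by rewrite /expi cos0 sin0. Qed.

Definition zs (n : nat) : seq int := [seq (i%:Z - n%:Z)%R | i <- iota 0 n.*2.+1].

Lemma zs_uniq n : uniq (zs n).
Proof. by rewrite map_inj_uniq ?iota_uniq // => i j; lia. Qed.

Lemma mem_zs n (k : int) : (k \in zs n) = (`|k| <= n)%N.
Proof.
apply/mapP/idP => [[j]|kn]; first by rewrite mem_iota => ? ->; lia.
by exists (absz (k + n%:Z)); [rewrite mem_iota; lia | lia].
Qed.

Lemma perm_zs n m : (n <= m)%N ->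
  perm_eq (zs n) [seq k <- zs m | (`|k| <= n)%N].
Proof.
move=> nm; apply: uniq_perm; rewrite ?filter_uniq ?zs_uniq // => k.
by rewrite mem_filter !mem_zs; apply/idP/andP; [split=> //; lia | by case].
Qed.

Lemma zs_split (V : nmodType) n m (f : int -> V) : (n <= m)%N ->
  \sum_(k <- zs m) f k =
  \sum_(k <- zs n) f k + \sum_(k <- zs m | (n < `|k|)%N) f k.
Proof.
move=> nm; rewrite (bigID (fun k : int => (`|k| <= n)%N)) /=; congr (_ + _).
  by rewrite (perm_big _ (perm_zs nm)) big_filter.
by apply: eq_bigl => k; rewrite ltnNge.
Qed.

Lemma zs_sum_le n m (f : int -> R) : (n <= m)%N -> (forall k, 0 <= f k) ->
  \sum_(k <- zs n) f k <= \sum_(k <- zs m) f k.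
Proof. by move=> nm f0; rewrite (zs_split _ nm) lerDl sumr_ge0. Qed.

Lemma zs_term_le (f : int -> R) (k : int) : (forall k, 0 <= f k) ->
  f k <= \sum_(j <- zs `|k|) f j.
Proof.
move=> f0; rewrite (perm_big _ (perm_to_rem (_ : k \in zs `|k|))) ?mem_zs //.
by rewrite big_cons lerDl sumr_ge0.
Qed.

(* [hq s c X] says that the square of the h^s norm of [c] is at most [X]. *)
Definition wn (s : nat) (k : int) : R := (1 + k%:~R ^+ 2) ^+ s.

Definition hq (s : nat) c (X : R) : Prop :=
  forall n, \sum_(k <- zs n) wn s k * sq (c k) <= X.

Lemma wnS s k : wn s.+1 k = wn s k * (1 + k%:~R ^+ 2).
Proof. by rewrite /wn exprSr. Qed.

Lemma wn_ge1 s k : 1 <= wn s k.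
Proof. by rewrite /wn exprn_ege1 // lerDl sqr_ge0. Qed.

Lemma wn_ge0 s k : 0 <= wn s k.
Proof. exact: le_trans ler01 (wn_ge1 s k). Qed.

Lemma wn0 k : wn 0 k = 1. Proof. by rewrite /wn expr0. Qed.

Lemma wn_mono s s' k : (s <= s')%N -> wn s k <= wn s' k.
Proof. by move=> ss; rewrite /wn ler_weXn2l // lerDl sqr_ge0. Qed.

Lemma wsq_ge0 s k z : 0 <= wn s k * sq z.
Proof. by rewrite mulr_ge0 ?wn_ge0 ?sq_ge0. Qed.

Lemma hq_ge0 s c X : hq s c X -> 0 <= X.
Proof. by move=> /(_ 0%N); apply: le_trans; rewrite sumr_ge0 // => k _; exact: wsq_ge0. Qed.

Lemma hq_le s c X Y : X <= Y -> hq s c X -> hq s c Y.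
Proof. by move=> XY h n; exact: le_trans (h n) XY. Qed.

Lemma hq_term s c X k : hq s c X -> wn s k * sq (c k) <= X.
Proof. by move=> h; apply: le_trans (h `|k|%N); apply: (@zs_term_le (fun k => wn s k * sq (c k))) => j; exact: wsq_ge0. Qed.

Lemma hq_dom s s1 c a (x A : R) : 0 <= x -> hq s1 a A ->
  (forall k, wn s k * sq (c k) <= x * (wn s1 k * sq (a k))) -> hq s c (x * A).
Proof.
move=> x0 ha H n; apply: (@le_trans _ _ (x * \sum_(k <- zs n) wn s1 k * sq (a k))).
  by rewrite mulr_sumr ler_sum.
by rewrite ler_wpM2l.
Qed.

Lemma hq_dom2 s s1 s2 c a b (x y A B : R) : 0 <= x -> 0 <= y ->
  hq s1 a A -> hq s2 b B ->
  (forall k, wn s k * sq (c k) <=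
     x * (wn s1 k * sq (a k)) + y * (wn s2 k * sq (b k))) ->
  hq s c (x * A + y * B).
Proof.
move=> x0 y0 ha hb H n.
apply: (@le_trans _ _ (x * (\sum_(k <- zs n) wn s1 k * sq (a k)) +
                       y * \sum_(k <- zs n) wn s2 k * sq (b k))).
  by rewrite !mulr_sumr -big_split ler_sum.
by rewrite lerD // ler_wpM2l.
Qed.

Lemma hq_sqle s c a (x A : R) : 0 <= x -> hq s a A ->
  (forall k, sq (c k) <= x * sq (a k)) -> hq s c (x * A).
Proof.
move=> x0 ha H; apply: hq_dom ha _ => // k.
by rewrite mulrCA ler_wpM2l ?wn_ge0.
Qed.

Lemma hq_sqle2 s c a b (x y A B : R) : 0 <= x -> 0 <= y ->
  hq s a A -> hq s b B ->
  (forall k, sq (c k) <= x * sq (a k) + y * sq (b k)) ->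
  hq s c (x * A + y * B).
Proof.
move=> x0 y0 ha hb H; apply: hq_dom2 ha hb _ => // k.
by rewrite !(mulrCA _ (wn s k)) -mulrDr ler_wpM2l ?wn_ge0.
Qed.

Lemma hq_eqsq s c a A : (forall k, sq (c k) = sq (a k)) -> hq s a A -> hq s c A.
Proof. by move=> H h n; under eq_bigr do rewrite H; exact: h. Qed.

Lemma hqD s a b A B : hq s a A -> hq s b B ->
  hq s (fun k => a k + b k) (2 * A + 2 * B).
Proof. by move=> ha hb; apply: hq_sqle2 ha hb _ => // k; exact: sqD2. Qed.

Lemma hqB s a b A B : hq s a A -> hq s b B ->
  hq s (fun k => a k - b k) (2 * A + 2 * B).
Proof. by move=> ha hb; apply: hq_sqle2 ha hb _ => // k; exact: sqB2. Qed.

Lemma hqDt s a b (t A B : R) : 0 < t -> hq s a A -> hq s b B ->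
  hq s (fun k => a k + b k) ((1 + t) * A + (1 + t^-1) * B).
Proof.
move=> t0 ha hb; apply: hq_sqle2 ha hb _ => [||k]; last exact: sqD_le.
  by rewrite addr_ge0 // ltW.
by rewrite addr_ge0 // invr_ge0 ltW.
Qed.

Lemma hqD3 s a b c A B C : hq s a A -> hq s b B -> hq s c C ->
  hq s (fun k => a k + b k + c k) (3 * (A + B + C)).
Proof.
move=> ha hb hc n.
apply: (@le_trans _ _ (3 * ((\sum_(k <- zs n) wn s k * sq (a k)) +
  (\sum_(k <- zs n) wn s k * sq (b k)) + \sum_(k <- zs n) wn s k * sq (c k)))).
  rewrite -!big_split mulr_sumr ler_sum //= => k _; rewrite -!mulrDr mulrCA.
  by rewrite ler_wpM2l ?wn_ge0 ?sqD3.
by rewrite ler_wpM2l // !lerD.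
Qed.

Lemma hqN s a A : hq s a A -> hq s (fun k => - a k) A.
Proof. by apply: hq_eqsq => k; rewrite sqN. Qed.

Lemma hqZ s a (x A : R) : hq s a A -> hq s (fun k => x%:C * a k) (x ^+ 2 * A).
Proof. by move=> ha; apply: hq_sqle ha _ => [|k]; rewrite ?sqr_ge0 // sqM sqC. Qed.

Lemma hq_swap s a b A : hq s (fun k => a k - b k) A -> hq s (fun k => b k - a k) A.
Proof. by apply: hq_eqsq => k; rewrite -sqN opprB. Qed.

Lemma hq_mono s s' a A : (s <= s')%N -> hq s' a A -> hq s a A.
Proof.
move=> ss h; rewrite -[A]mul1r; apply: hq_dom h _ => // k.
by rewrite mul1r ler_wpM2r ?sq_ge0 ?wn_mono.
Qed.

Lemma hq_zero s A : 0 <= A -> hq s (fun=> 0) A.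
Proof. by move=> A0 n; rewrite big1 // => k _; rewrite sq0 mulr0. Qed.

Lemma hq_eps s c X : (forall e, 0 < e -> hq s c (X + e)) -> hq s c X.
Proof. by move=> H n; apply/ler_addgt0Pr => e e0; exact: (H e e0 n). Qed.

(** At each frequency this is [y <= x^-1 + x * y^2] for [y = 1 + k^2], a completed square. Taking
    for [x] a small l^2 distance makes differences of h^2-bounded sequences small in h^1. *)
Lemma hq_interp a (x A B : R) : 0 < x -> hq 0 a A -> hq 2 a B ->
  hq 1 a (x^-1 * A + x * B).
Proof.
move=> x0 ha hb; apply: hq_dom2 ha hb _ => [||k]; rewrite ?invr_ge0 ?(ltW x0) //.
rewrite !mulrA -mulrDl ler_wpM2r ?sq_ge0 // /wn expr0 expr1 mulr1.
set y := 1 + _; have y0 : 0 <= y by rewrite addr_ge0 ?sqr_ge0.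
have xn0 : x != 0 by rewrite gt_eqF.
rewrite -subr_ge0; have -> : x^-1 + x * y * y - y =
  x^-1 * ((x * y - 1 / 2) ^+ 2 + 3 / 4) by field.
by rewrite mulr_ge0 ?invr_ge0 ?(ltW x0) // addr_ge0 ?sqr_ge0 // divr_ge0.
Qed.

(** The triangle inequality, written for squares. Young's inequality with weight [y / x] gives
    exactly [(x + y)^2]; the slack [d] keeps both lengths positive and is removed at the end. *)
Lemma hq_addM s a b (x y X : R) : 0 <= x -> 0 <= y -> 0 <= X ->
  hq s a (x ^+ 2 * X) -> hq s b (y ^+ 2 * X) ->
  hq s (fun k => a k + b k) ((x + y) ^+ 2 * X).
Proof.
move=> x0 y0 X0 ha hb; apply: hq_eps => e e0.
have [d d0 Hd] : exists2 d : R, 0 < d & (x + y + 2 * d) ^+ 2 * X <= (x + y) ^+ 2 * X + e.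
  pose Q := 4 * (x + y + 1) * X + 1.
  have Q0 : 0 < Q by rewrite ltr_wpDl // !mulr_ge0 // !addr_ge0.
  pose d := Num.min 1 (e / Q).
  have d0 : 0 < d by rewrite lt_min ltr01 divr_gt0.
  have d1 : d <= 1 by rewrite ge_min lexx.
  have dQ : d * Q <= e by rewrite -ler_pdivlMr // ge_min lexx orbT.
  exists d => //.
  have : d * (d * X) <= 1 * (d * X) by rewrite ler_wpM2r // mulr_ge0 // ltW.
  have : 0 <= d * X by rewrite mulr_ge0 // ltW.
  move: dQ; rewrite /Q; nra.
have xd : 0 < x + d by rewrite ltr_wpDl.
have yd : 0 < y + d by rewrite ltr_wpDl.
have ha' : hq s a ((x + d) ^+ 2 * X).
  apply: hq_le ha; rewrite ler_wpM2r // ler_sqr ?nnegrE ?(ltW xd) //.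
  by rewrite lerDl ltW.
have hb' : hq s b ((y + d) ^+ 2 * X).
  apply: hq_le hb; rewrite ler_wpM2r // ler_sqr ?nnegrE ?(ltW yd) //.
  by rewrite lerDl ltW.
have t0 : 0 < (y + d) / (x + d) by rewrite divr_gt0.
apply: hq_le (hqDt t0 ha' hb'); apply: le_trans Hd.
rewrite le_eqVlt; apply/orP; left; apply/eqP; field.
by rewrite !gt_eqF.
Qed.

Lemma hq_sumM s (a : nat -> int -> R[i]) (x : nat -> R) (X : R) n : 0 <= X ->
  (forall i, (i < n)%N -> 0 <= x i) ->
  (forall i, (i < n)%N -> hq s (a i) (x i ^+ 2 * X)) ->
  hq s (fun k => \sum_(i < n) a i k) ((\sum_(i < n) x i) ^+ 2 * X).
Proof.
move=> X0; elim: n => [|n IH] x0 ha.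
  move=> m; rewrite big_ord0 expr0n /= mul0r big1 // => k _.
  by rewrite big_ord0 sq0 mulr0.
have -> : (fun k => \sum_(i < n.+1) a i k) =
          (fun k => (\sum_(i < n) a i k) + a n k).
  by apply/funext => k; rewrite big_ord_recr.
rewrite big_ord_recr /=; apply: hq_addM => //.
- by rewrite sumr_ge0 // => i _; apply: x0; rewrite ltnS ltnW.
- exact: x0.
- by apply: IH => i ni; [apply: x0|apply: ha]; rewrite ltnS ltnW.
- exact: ha.
Qed.

Lemma cvg_sq (c : nat -> R[i]) z :
  (fun n => complex.Re (c n)) @ \oo --> complex.Re z ->
  (fun n => complex.Im (c n)) @ \oo --> complex.Im z ->
  (fun n => sq (c n)) @ \oo --> sq z.
Proof.
move=> hr hi; apply: cvgD.
  by rewrite expr2; apply: cvgM.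
by rewrite expr2; apply: cvgM.
Qed.

Definition ccvg (c : nat -> int -> R[i]) (z : int -> R[i]) : Prop :=
  forall k, (fun n => complex.Re (c n k)) @ \oo --> complex.Re (z k) /\
            (fun n => complex.Im (c n k)) @ \oo --> complex.Im (z k).

Lemma cvg_seqsum (I : Type) (r : seq I) (f : I -> nat -> R) (l : I -> R) :
  (forall i, f i @ \oo --> l i) ->
  (fun n => \sum_(i <- r) f i n) @ \oo --> \sum_(i <- r) l i.
Proof.
move=> H; elim: r => [|i r IH].
  rewrite big_nil [X in X @ _ --> _](_ : _ = fun=> 0); first exact: cvg_cst.
  by apply/funext => n; rewrite big_nil.
rewrite big_cons [X in X @ _ --> _](_ : _ = f i \+ (fun n => \sum_(i <- r) f i n)).
  exact: cvgD.
by apply/funext => n; rewrite big_cons.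
Qed.

(** Fatou's lemma in this setting: each partial sum involves finitely many frequencies, hence
    converges. *)
Lemma hq_lim s (c : nat -> int -> R[i]) (z : int -> R[i]) X : ccvg c z ->
  (\forall n \near \oo, hq s (c n) X) -> hq s z X.
Proof.
move=> cz H n.
have Hc : (fun m => \sum_(k <- zs n) wn s k * sq (c m k)) @ \oo -->
   \sum_(k <- zs n) wn s k * sq (z k).
  apply: (@cvg_seqsum _ _ (fun k m => wn s k * sq (c m k))) => k.
  have [h1 h2] := cz k; apply: cvgM; first exact: cvg_cst.
  exact: cvg_sq.
rewrite -(cvg_lim _ Hc) //; apply: limr_le; first by apply/cvg_ex; eexists; exact: Hc.
by near=> m; near: m; apply: filterS H => m; apply.
Unshelve. all: by end_near. Qed.

Lemma hq_near_ccvg (c : nat -> int -> R[i]) (z : int -> R[i]) (e : nat -> R) :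
  e @ \oo --> 0 -> (forall n, hq 0 (fun k => c n k - z k) (e n)) -> ccvg c z.
Proof.
move=> e0 H k.
have He n : sq (c n k - z k) <= e n by have := hq_term k (H n); rewrite wn0 mul1r.
have G (f : nat -> R) l : (forall n, (f n - l) ^+ 2 <= e n) -> f @ \oo --> l.
  move=> Hf; apply/cvgrPdist_lt => eps eps0.
  near=> n; have : e n < eps ^+ 2.
    by near: n; apply: (cvgr_lt (0 : R)); [exact: e0 | rewrite exprn_gt0].
  move=> en; rewrite -ltr_sqr ?nnegrE ?normr_ge0 ?(ltW eps0) // real_normK ?num_real //.
  by apply: le_lt_trans en; rewrite -sqrrN opprB.
split; apply: G => n; apply: le_trans (He n); rewrite /sq.
  by rewrite raddfB lerDl sqr_ge0.
by rewrite !raddfB lerDr sqr_ge0.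
Unshelve. all: by end_near. Qed.

Definition Pn (N : nat) c : int -> R[i] := fun k => if (`|k| <= N)%N then c k else 0.

Lemma sq_Pn N c k : sq (Pn N c k) <= sq (c k).
Proof. by rewrite /Pn; case: ifP => // _; rewrite sq0 sq_ge0. Qed.

Lemma hq_Pn N s c X : hq s c X -> hq s (Pn N c) X.
Proof.
by move=> h; rewrite -[X]mul1r; apply: hq_sqle h _ => // k; rewrite mul1r sq_Pn.
Qed.

Lemma intr_sqr_abs (k : int) : k%:~R ^+ 2 = (`|k|%N)%:R ^+ 2 :> R.
Proof. by rewrite natr_absz intr_norm real_normK ?num_real. Qed.

Lemma intr_sqr_le (k : int) N : (k%:~R ^+ 2 <= N%:R ^+ 2 :> R) = (`|k| <= N)%N.
Proof. by rewrite intr_sqr_abs ler_sqr ?nnegrE // ler_nat. Qed.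

Lemma wn_le_trunc s N (k : int) : (`|k| <= N)%N -> wn s k <= (1 + N%:R ^+ 2) ^+ s.
Proof.
move=> kN; have H : k%:~R ^+ 2 <= N%:R ^+ 2 :> R.
  by rewrite intr_sqr_le.
by rewrite /wn lerXn2r ?nnegrE ?addr_ge0 ?sqr_ge0 // lerD2l.
Qed.

(** Bernstein's inequality: derivatives of a truncated sequence are paid for with powers of
    [1 + N^2]. *)
Lemma hq_Pn_raise N s s' c X : hq s c X ->
  hq (s' + s) (Pn N c) ((1 + N%:R ^+ 2) ^+ s' * X).
Proof.
move=> h; apply: hq_dom h _ => [|k]; first by rewrite exprn_ge0 // addr_ge0 ?sqr_ge0.
rewrite /Pn; case: ifP => kN; last by rewrite sq0 mulr0 !mulr_ge0 ?wn_ge0 ?sq_ge0 ?exprn_ge0 // addr_ge0 ?sqr_ge0.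
by rewrite mulrA ler_wpM2r ?sq_ge0 // /wn exprD ler_wpM2r ?wn_le_trunc // -/(wn s k) wn_ge0.
Qed.

(** The converse trade: beyond frequency [N] a spare derivative is worth a factor [(1 + N^2)^-1]. *)
Lemma hq_Qn N s c X : hq s.+1 c X ->
  hq s (fun k => c k - Pn N c k) ((1 + N%:R ^+ 2)^-1 * X).
Proof.
have N0 : 0 < 1 + N%:R ^+ 2 :> R by rewrite ltr_wpDr ?sqr_ge0.
move=> h; apply: hq_dom h _ => [|k]; first by rewrite invr_ge0 ltW.
rewrite /Pn; case: ifPn => kN.
  by rewrite subrr sq0 mulr0 mulr_ge0 ?wsq_ge0 // invr_ge0 ltW.
rewrite subr0 mulrA ler_wpM2r ?sq_ge0 // mulrC ler_pdivlMr // wnS.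
rewrite ler_wpM2l ?wn_ge0 // lerD2l.
by rewrite intr_sqr_abs ler_sqr ?nnegrE // ler_nat ltnW // ltnNge.
Qed.

(* The group e^{it d_x^2} on Fourier coefficients. *)
Definition Sg (t : R) c : int -> R[i] := fun k => expi (- (k%:~R ^+ 2 * t)) * c k.

Lemma sq_Sg t c k : sq (Sg t c k) = sq (c k).
Proof. by rewrite /Sg sqM sq_expi mul1r. Qed.

Lemma hq_Sg s t c X : hq s c X -> hq s (Sg t c) X.
Proof. by apply: hq_eqsq => k; rewrite sq_Sg. Qed.

Lemma hq_SgK s t c X : hq s (Sg t c) X -> hq s c X.
Proof. by apply: hq_eqsq => k; rewrite sq_Sg. Qed.

Lemma SgD t t' c : Sg (t + t') c = Sg t (Sg t' c).
Proof. by apply/funext => k; rewrite /Sg mulrA -expiD; congr (expi _ * _); ring. Qed.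

Lemma Sg0 c : Sg 0 c = c.
Proof. by apply/funext => k; rewrite /Sg mulr0 oppr0 expi0 mul1r. Qed.

Lemma SgK t c : Sg (- t) (Sg t c) = c.
Proof. by rewrite -SgD addNr Sg0. Qed.

Lemma SgNK t c : Sg t (Sg (- t) c) = c.
Proof. by rewrite -SgD subrr Sg0. Qed.

Lemma SgB t a b : Sg t (fun k => a k - b k) = fun k => Sg t a k - Sg t b k.
Proof. by apply/funext => k; rewrite /Sg mulrBr. Qed.

Lemma Sg_add t a b : Sg t (fun k => a k + b k) = fun k => Sg t a k + Sg t b k.
Proof. by apply/funext => k; rewrite /Sg mulrDr. Qed.

Lemma SgZ t z a : Sg t (fun k => z * a k) = fun k => z * Sg t a k.
Proof. by apply/funext => k; rewrite /Sg mulrCA. Qed.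

Lemma Sg_Pn t N c : Sg t (Pn N c) = Pn N (Sg t c).
Proof. by apply/funext => k; rewrite /Sg /Pn; case: ifP; rewrite ?mulr0. Qed.

Lemma abs_sin_le (x : R) : `|sin x| <= `|x|.
Proof.
wlog x0 : x / 0 <= x => [H|].
  have [/H//|/ltW x0] := leP 0 x.
  by have := H (- x); rewrite oppr_ge0 sinN !normrN; apply.
have C : {within `[0, x], continuous (@sin R)}.
  by apply: continuous_subspaceT => y; exact: continuous_sin.
have [y + ] := MVT_segment x0 (fun y _ => is_derive_sin y) C; move=> _; rewrite sin0 !subr0 => ->; rewrite normrM ler_piMl // ler_norml.
by rewrite cos_geN1 cos_le1.
Qed.

Lemma sqr_sin_le (x : R) : sin x ^+ 2 <= x ^+ 2.
Proof.
have := abs_sin_le x; rewrite -ler_sqr ?nnegrE ?normr_ge0 //.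
by rewrite !real_normK ?num_real.
Qed.

Lemma sin_half_ge (x : R) : 0 <= x -> x <= 1 / 2 -> x / 2 <= sin x.
Proof.
move=> x0 x1.
have C : {within `[0, x], continuous (@sin R)}.
  by apply: continuous_subspaceT => y; exact: continuous_sin.
have [y + ] := MVT_segment x0 (fun y _ => is_derive_sin y) C; rewrite in_itv /= => /andP[y0 yx]; rewrite sin0 !subr0 => ->.
rewrite mulrC ler_wpM2r //.
have -> : y = y / 2 + y / 2 by lra.
rewrite cosD -!expr2.
have := cos2Dsin2 (y / 2); have := sqr_sin_le (y / 2); nra.
Qed.

Lemma sq_expi_sub1 (x : R) : sq (expi x - 1) = 4 * sin (x / 2) ^+ 2.
Proof.
rewrite /sq /expi /= subr0; have := cos2Dsin2 (x / 2).
have -> : cos x = cos (x / 2) * cos (x / 2) - sin (x / 2) * sin (x / 2).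
  by rewrite -cosD -splitr.
have -> : sin x = sin (x / 2) * cos (x / 2) + cos (x / 2) * sin (x / 2).
  by rewrite -sinD -splitr.
move: (cos _) (sin _) => c s H.
have -> : c * c = 1 - s ^+ 2 by rewrite -H; ring.
by rewrite (_ : (s * c + c * s) ^+ 2 = 4 * s ^+ 2 * c ^+ 2);
  [rewrite -[c ^+ 2](addrK (s ^+ 2)) H; ring | ring].
Qed.

Lemma sq_expi_sub1_le (x : R) : sq (expi x - 1) <= x ^+ 2.
Proof.
rewrite sq_expi_sub1; have := sqr_sin_le (x / 2); nra.
Qed.

Lemma sq_expi_sub1_le4 (x : R) : sq (expi x - 1) <= 4.
Proof. by rewrite sq_expi_sub1; have := cos2Dsin2 (x / 2); nra. Qed.

(** Used with [x = - k^2 h]: as long as [k^2 h <= 1], the quotient [(Sg h u - u) / h] controls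
    [k^2 u]. The scheme recovers [u_xx] in this way. *)
Lemma sq_expi_sub1_ge (x : R) : `|x| <= 1 -> x ^+ 2 / 4 <= sq (expi x - 1).
Proof.
move=> x1; rewrite sq_expi_sub1.
have /= H := @sin_half_ge (`|x| / 2).
have {}H : `|x| / 2 / 2 <= sin (`|x| / 2) by apply: H; [rewrite divr_ge0 | lra].
have Hs : sin (`|x| / 2) ^+ 2 = sin (x / 2) ^+ 2.
  by have [x0|x0] := leP 0 x; [rewrite ger0_norm | rewrite ltr0_norm // mulNr sinN sqrrN].
rewrite -Hs -(real_normK (num_real x)); have := normr_ge0 x; nra.
Qed.

Lemma sq_Sg_sub t c k : sq (Sg t c k - c k) = sq (expi (- (k%:~R ^+ 2 * t)) - 1) * sq (c k).
Proof. by rewrite -sqM /Sg; congr sq; ring. Qed.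

(* Holder-1/2 continuity in time, at the cost of one derivative *)
Lemma hq_Sg_sub s (t : R) c X : 0 <= t -> hq s.+1 c X ->
  hq s (fun k => Sg t c k - c k) (4 * t * X).
Proof.
move=> t0 h; apply: hq_dom h _ => [|k]; first by rewrite mulr_ge0.
rewrite sq_Sg_sub !mulrA ler_wpM2r ?sq_ge0 // wnS mulrCA.
rewrite ler_wpM2l ?wn_ge0 //.
set y := k%:~R ^+ 2; have y0 : 0 <= y by exact: sqr_ge0.
have := sq_expi_sub1_le (- (y * t)); have := sq_expi_sub1_le4 (- (y * t)).
set z := sq _; rewrite sqrrN => h4 h2.
have yt0 : 0 <= y * t by rewrite mulr_ge0.
have [yt|yt] := leP 1 (y * t); first by nra.
apply: le_trans h2 _; nra.
Qed.

(** Two derivatives buy Lipschitz continuity in time, from [|e^(ix) - 1| <= |x|]. *)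
Lemma hq_Sg_sub2 s (t : R) c X : hq s.+2 c X ->
  hq s (fun k => Sg t c k - c k) (t ^+ 2 * X).
Proof.
move=> h; apply: hq_dom h _ => [|k]; first by rewrite sqr_ge0.
rewrite sq_Sg_sub (wnS s.+1) (wnS s).
have := sq_expi_sub1_le (- (k%:~R ^+ 2 * t)); rewrite sqrrN.
have : 0 <= k%:~R ^+ 2 :> R by exact: sqr_ge0.
move: (sq (expi _ - 1)) => z; move: (wn_ge0 s k) (sq_ge0 (c k)); move: (k%:~R ^+ 2 : R) => y.
move: (wn s k) (sq (c k)) => w q w0 q0 y0 h.
have -> : t ^+ 2 * (w * (1 + y) * (1 + y) * q) = w * ((t ^+ 2 * ((1 + y) * (1 + y))) * q).
  by ring.
rewrite ler_wpM2l // ler_wpM2r // (le_trans h) // exprMn mulrC ler_wpM2l ?sqr_ge0 //.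
nra.
Qed.

End Sequences.

(** * Stability of approximate solutions *)

Section Evolution.
Context {R : realType}.
Implicit Types (u v w c : int -> R[i]) (V W : R -> int -> R[i]).

(* The properties of the nonlinearity, in Fourier coefficients, on which the
   evolution relies: it maps h^2 to h^1, is Lipschitz from h^1 to l^2, and is
   accretive in l^2 up to a zeroth order term, in both time directions. *)
Definition good_nl (Nh : (int -> R[i]) -> int -> R[i]) : Prop :=
  forall M : R, exists K : R, [/\ 1 <= K,
    forall u, hq 2 u M -> hq 1 (Nh u) K,
    forall u v (d : R), hq 2 u M -> hq 2 v M -> hq 1 (fun k => u k - v k) d ->
      hq 0 (fun k => Nh u k - Nh v k) (K * d) &
    forall u v (d d1 th : R), hq 2 u M -> hq 2 v M ->
      hq 0 (fun k => u k - v k) d -> hq 1 (fun k => u k - v k) d1 ->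
      hq 0 (fun k => u k - v k + th%:C * (Nh u k - Nh v k))
        ((1 + K * `|th|) * d + K * th ^+ 2 * d1)].

Variable Nh : (int -> R[i]) -> int -> R[i].

(* In the interaction picture V t = S(-t) u(t) the equation reads
   V' = - Ff t V. *)
Definition Ff (t : R) v : int -> R[i] := Sg (- t) (Nh (Sg t v)).

(** The counterpart of [good_nl] for the time-dependent [Ff]. As bounds are on squares, the term
    [|t - s|] means Holder-1/2 dependence on time: [Nh] takes values in h^1, and one derivative buys
    half a power of time. *)
Definition goodF (M K : R) : Prop := [/\ 1 <= K,
    forall t v, hq 2 v M -> hq 1 (Ff t v) K,
    forall t s v w (d : R), hq 2 v M -> hq 2 w M -> hq 1 (fun k => v k - w k) d ->
      hq 0 (fun k => Ff t v k - Ff s w k) (K * (d + `|t - s|)) &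
    forall t v w (d d1 th : R), hq 2 v M -> hq 2 w M ->
      hq 0 (fun k => v k - w k) d -> hq 1 (fun k => v k - w k) d1 ->
      hq 0 (fun k => v k - w k + th%:C * (Ff t v k - Ff t w k))
        ((1 + K * `|th|) * d + K * th ^+ 2 * d1)].

Lemma hq_Sg_subN s (t : R) c X : hq s.+1 c X ->
  hq s (fun k => Sg t c k - c k) (4 * `|t| * X).
Proof.
move=> h; have [t0|t0] := leP 0 t; first by rewrite ger0_norm //; exact: hq_Sg_sub.
rewrite ltr0_norm //; apply: (hq_SgK (t := - t)).
rewrite SgB SgK; apply: hq_swap; apply: hq_Sg_sub h; lra.
Qed.

Lemma goodF_ex : good_nl Nh -> forall M, exists K, goodF M K.
Proof.
move=> H M; have [K [K1 N3 N1 N2]] := H M.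
have M0 v : hq 2 v M -> 0 <= M by exact: hq_ge0.
(* Large enough for [2 * K * (2 * d + 8 * |t - s| * M)], from moving the argument of [Nh], plus
   [8 * |t - s| * K], from moving the outer group. The absolute value covers a negative [M], for
   which the bounds on the arguments are contradictory. *)
exists (16 * K * `|M| + 12 * K).
have KM : 0 <= K * `|M| by rewrite mulr_ge0 // (le_trans ler01).
split; first by lra.
- by move=> t v hv; apply: hq_Sg; apply: hq_le (N3 _ (hq_Sg t hv)); lra.
- move=> t s v w d hv hw hd.
  have MM : `|M| = M by rewrite ger0_norm // (M0 _ hv).
  have e1 : hq 1 (fun k => Sg t v k - Sg s w k) (2 * d + 2 * (4 * `|t - s| * M)).
    have -> : (fun k => Sg t v k - Sg s w k) =
       (fun k => Sg t (fun k => v k - w k) k + (Sg (t - s) (Sg s w) k - Sg s w k)).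
      by apply/funext => k; rewrite -SgD subrK SgB; ring.
    by apply: hqD; [exact: hq_Sg | apply: hq_Sg_subN; exact: hq_Sg].
  have e2 := N1 _ _ _ (hq_Sg t hv) (hq_Sg s hw) e1.
  have e3 : hq 0 (fun k => Sg (s - t) (Ff s w) k - Ff s w k) (4 * `|s - t| * K).
    by apply: hq_Sg_subN; apply: hq_Sg; apply: N3; exact: hq_Sg.
  have -> : (fun k => Ff t v k - Ff s w k) =
     (fun k => Sg (- t) (fun k => Nh (Sg t v) k - Nh (Sg s w) k) k +
               (Sg (s - t) (Ff s w) k - Ff s w k)).
    apply/funext => k; rewrite SgB {2}/Ff -SgD.
    by rewrite (_ : s - t - s = - t); [rewrite /Ff; ring | ring].
  apply: hq_le (hqD (hq_Sg (- t) e2) e3).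
  rewrite (distrC s t) MM; set x := `|t - s|.
  have x0 : 0 <= x by exact: normr_ge0.
  have d0 := hq_ge0 hd.
  have M1 := M0 _ hv.
  have -> : (16 * K * M + 12 * K) * (d + x) =
     2 * (K * (2 * d + 2 * (4 * x * M))) + 2 * (4 * x * K) +
     ((16 * K * M + 8 * K) * d + 4 * K * x) by ring.
  rewrite lerDl addr_ge0 // !mulr_ge0 ?addr_ge0 ?mulr_ge0 //; lra.
- move=> t v w d d1 th hv hw hd hd1.
  have hd' : hq 0 (fun k => Sg t v k - Sg t w k) d by rewrite -SgB; exact: hq_Sg.
  have hd1' : hq 1 (fun k => Sg t v k - Sg t w k) d1 by rewrite -SgB; exact: hq_Sg.
  have := N2 _ _ _ _ th (hq_Sg t hv) (hq_Sg t hw) hd' hd1'.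
  move=> /(hq_Sg (- t)); rewrite Sg_add SgB !SgK SgZ SgB => h.
  apply: hq_le h.
  have d0 := hq_ge0 hd; have d10 := hq_ge0 hd1.
  have KK : K <= 16 * K * `|M| + 12 * K by lra.
  apply: lerD; rewrite ler_wpM2r //.
    by rewrite lerD2l ler_wpM2r.
  by rewrite ler_wpM2r ?sqr_ge0.
Qed.

(* [V] solves V' = - Ff t V on [0, T] up to a defect [e] (in the square of the
   l^2 norm); the term in [C] allows for Holder-1/2 continuity of [Ff t (V t)]. *)
Definition asol (C e T : R) V : Prop :=
  forall a tau b, 0 <= a -> a <= tau -> tau <= b -> b <= T ->
  hq 0 (fun k => V b k - V a k + (b - a)%:C * Ff tau (V tau) k)
     ((b - a) ^+ 2 * (C * (b - a) + e)).

Definition bdd2 (M T : R) V : Prop := forall t, 0 <= t -> t <= T -> hq 2 (V t) M.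

(** Both solutions are expanded to first order about [s], and accretivity is applied at [s]. Since
    [asol] allows its velocity to be taken at either end of the interval, this works also for
    [s' < s]. Young's weight is the step [h] itself: the main factor stays [1 + O(h)], while the
    squared defects, of size [h^2], cost a factor [1 / h]. *)
Lemma gronwall_step (M K C e1 e2 T : R) V W (s s' X : R) : goodF M K -> 0 <= C ->
  0 <= e1 -> 0 <= e2 -> bdd2 M T V -> bdd2 M T W -> asol C e1 T V -> asol C e2 T W ->
  0 <= s -> s <= T -> 0 <= s' -> s' <= T -> s != s' -> `|s' - s| <= 1 ->
  hq 0 (fun k => V s k - W s k) X ->
  hq 0 (fun k => V s' k - W s' k)
    ((1 + (2 * K + 1) * `|s' - s|) * X +
     `|s' - s| * ((8 * K * M + 8 * C) * `|s' - s| + 4 * (e1 + e2))).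
Proof.
move=> [K1 _ _ F2] C0 e10 e20 bV bW aV aW s0 sT s'0 s'T ss' h1 hX.
pose h : R := `|s' - s|; rewrite -/h in h1 *; have hp : 0 < h by rewrite normr_gt0 subr_eq0 eq_sym.
(* The sign is that of [V' = - Ff]: to first order [V s'] is [V s + th * Ff s (V s)]. A forward step
   has [th < 0], a backward step [th > 0]. *)
pose th := s - s'.
have thh : `|th| = h by rewrite /th distrC.
have hV := bV _ s0 sT; have hW := bW _ s0 sT.
have M0 := hq_ge0 hV; have X0 := hq_ge0 hX.
have e12 : 0 <= e1 + e2 by rewrite addr_ge0.
have hd1 := hq_mono (isT : (1 <= 2)%N) (hqB hV hW).
have main := F2 s _ _ _ _ th hV hW hX hd1.
have err : hq 0 (fun k => (V s' k - V s k - th%:C * Ff s (V s) k) -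
                          (W s' k - W s k - th%:C * Ff s (W s) k))
            (2 * (h ^+ 2 * (C * h + e1)) + 2 * (h ^+ 2 * (C * h + e2))).
  apply: hqB.
  - have [ls|ls] := leP s s'.
      have -> : h = s' - s by rewrite /h ger0_norm // subr_ge0.
      have := aV _ _ _ s0 (lexx s) ls s'T; apply: hq_eqsq => k; congr sq.
      by rewrite /th -mulNr -rmorphN opprB.
    have -> : h = s - s' by rewrite /h ltr0_norm ?opprB // subr_lt0.
    have := aV _ _ _ s'0 (ltW ls) (lexx s) sT; apply: hq_eqsq => k.
    by rewrite -sqN; congr sq; rewrite /th; ring.
  - have [ls|ls] := leP s s'.
      have -> : h = s' - s by rewrite /h ger0_norm // subr_ge0.
      have := aW _ _ _ s0 (lexx s) ls s'T; apply: hq_eqsq => k; congr sq.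
      by rewrite /th -mulNr -rmorphN opprB.
    have -> : h = s - s' by rewrite /h ltr0_norm ?opprB // subr_lt0.
    have := aW _ _ _ s'0 (ltW ls) (lexx s) sT; apply: hq_eqsq => k.
    by rewrite -sqN; congr sq; rewrite /th; ring.
have := hqDt hp main err.
have -> : (fun k => V s k - W s k + th%:C * (Ff s (V s) k - Ff s (W s) k) +
  (V s' k - V s k - th%:C * Ff s (V s) k - (W s' k - W s k - th%:C * Ff s (W s) k)))
  = (fun k => V s' k - W s' k) by apply/funext => k; ring.
apply: hq_le; rewrite thh -(real_normK (num_real th)) thh.
have hn0 : h != 0 by rewrite gt_eqF.
have -> : (1 + h^-1) * (2 * (h ^+ 2 * (C * h + e1)) + 2 * (h ^+ 2 * (C * h + e2)))
  = (1 + h) * h * (4 * C * h + 2 * (e1 + e2)) by field.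
have h0 := ltW hp.
have E1 : (1 + h) * (1 + K * h) * X <= (1 + (2 * K + 1) * h) * X.
  rewrite ler_wpM2r //; have : h * (K * h) <= 1 * (K * h).
    by rewrite ler_wpM2r // mulr_ge0 //; lra.
  lra.
have E2 : (1 + h) * (K * h ^+ 2 * (4 * M)) <= 2 * (K * h ^+ 2 * (4 * M)).
  rewrite ler_wpM2r ?mulr_ge0 ?sqr_ge0 //; lra.
have E3 : (1 + h) * (h * (4 * C * h + 2 * (e1 + e2))) <=
  2 * (h * (4 * C * h + 2 * (e1 + e2))).
  rewrite ler_wpM2r ?mulr_ge0 ?addr_ge0 ?mulr_ge0 //; lra.
have -> : 2 * M + 2 * M = 4 * M by ring.
have -> : (1 + h) * ((1 + K * h) * X + K * h ^+ 2 * (4 * M)) +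
  (1 + h) * h * (4 * C * h + 2 * (e1 + e2)) =
  (1 + h) * (1 + K * h) * X + (1 + h) * (K * h ^+ 2 * (4 * M)) +
  (1 + h) * (h * (4 * C * h + 2 * (e1 + e2))) by ring.
apply: le_trans (lerD (lerD E1 E2) E3) _.
rewrite le_eqVlt; apply/orP; left; apply/eqP; ring.
Qed.

Lemma gronwall_iter (w : nat -> int -> R[i]) (a b X : R) (m : nat) : 0 <= a -> 0 <= b ->
  0 <= X -> hq 0 (w 0%N) X ->
  (forall n Y, (n < m)%N -> hq 0 (w n) Y -> hq 0 (w n.+1) ((1 + a) * Y + b)) ->
  hq 0 (w m) (expR (a * m%:R) * (X + m%:R * b)).
Proof.
move=> a0 b0 X0 h0 hs.
have H n : (n <= m)%N -> hq 0 (w n) (expR (a * n%:R) * (X + n%:R * b)).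
  elim: n => [_|n IH nm]; first by rewrite mulr0 expR0 mul1r mul0r addr0.
  apply: hq_le (hs _ _ nm (IH (ltnW nm))).
  rewrite -natr1 (mulrDr a) expRD mulr1 (mulrDl n%:R) mul1r addrA.
  set P := expR (a * n%:R); set Q := X + n%:R * b.
  have P1 : 1 <= P by rewrite -expR0 ler_expR mulr_ge0.
  have E1 : 1 + a <= expR a := expR_ge1Dx a.
  have Q0 : 0 <= Q by rewrite addr_ge0 // mulr_ge0.
  rewrite (mulrDr (P * expR a)); apply: lerD.
    rewrite mulrA ler_wpM2r // mulrC ler_wpM2l //; lra.
  rewrite -[leLHS]mul1r ler_wpM2r // -[leLHS]mul1r ler_pM //; lra.
exact: H.
Qed.

(** The interval is cut into [m] equal steps. The errors quadratic in the step add up to O(1/m), so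
    the h^2 bound [M] and the constant [C] leave the final estimate; only the defects [e1] and [e2]
    remain. *)
Lemma gronwall (M K C e1 e2 T : R) V W (t0 t1 X : R) : goodF M K -> 0 <= C ->
  0 <= e1 -> 0 <= e2 -> bdd2 M T V -> bdd2 M T W -> asol C e1 T V -> asol C e2 T W ->
  0 <= t0 -> t0 <= T -> 0 <= t1 -> t1 <= T ->
  hq 0 (fun k => V t0 k - W t0 k) X ->
  hq 0 (fun k => V t1 k - W t1 k)
    (expR ((2 * K + 1) * `|t1 - t0|) * (X + 4 * `|t1 - t0| * (e1 + e2))).
Proof.
move=> gF C0 e10 e20 bV bW aV aW t00 t0T t10 t1T hX.
have [<-|t01] := eqVneq t0 t1.
  by rewrite subrr normr0 mulr0 expR0 mul1r mulr0 mul0r addr0.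
pose d : R := `|t1 - t0|; rewrite -/d; have dp : 0 < d by rewrite normr_gt0 subr_eq0 eq_sym.
have K1 : 1 <= K by case: gF.
have X0 := hq_ge0 hX.
have M0 := hq_ge0 (bV _ t00 t0T).
have e12 : 0 <= e1 + e2 by rewrite addr_ge0.
pose B := 8 * K * M + 8 * C.
have B0 : 0 <= B by rewrite addr_ge0 // !mulr_ge0 //; lra.
pose G := expR ((2 * K + 1) * d).
have G0 : 0 < G := expR_gt0 _.
apply: hq_eps => eps eps0.
(* The summand [d] makes the step at most 1; the other one makes the accumulated quadratic error at
   most [eps]. *)
pose m := (Num.truncn (d + G * d ^+ 2 * B / eps)).+1.
have mb : d + G * d ^+ 2 * B / eps < m%:R by exact: truncnS_gt.
have Q0 : 0 <= G * d ^+ 2 * B / eps.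
  by rewrite !mulr_ge0 ?invr_ge0 ?sqr_ge0 // ltW.
have mp : 0 < m%:R :> R by rewrite ltr0n.
pose h := d / m%:R.
have hp : 0 < h by rewrite divr_gt0.
have h1 : h <= 1 by rewrite ler_pdivrMr // mul1r; lra.
pose s n := t0 + (t1 - t0) * (n%:R / m%:R).
have sm : s m = t1 by rewrite /s divff ?gt_eqF // mulr1 addrC subrK.
have s0 : s 0%N = t0 by rewrite /s mul0r mulr0 addr0.
have sb n : (n <= m)%N -> 0 <= s n <= T.
  move=> nm; have r0 : 0 <= n%:R / m%:R :> R by rewrite divr_ge0.
  have r1 : n%:R / m%:R <= 1 :> R by rewrite ler_pdivrMr // mul1r ler_nat.
  have -> : s n = (1 - n%:R / m%:R) * t0 + n%:R / m%:R * t1 by rewrite /s; ring.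
  move: r0 r1; set r := _ / _ => r0 r1; apply/andP; split; first by nra.
  have : (1 - r) * t0 <= (1 - r) * T by rewrite ler_wpM2l // subr_ge0.
  have : r * t1 <= r * T by rewrite ler_wpM2l.
  lra.
have sd n : s n.+1 - s n = (t1 - t0) / m%:R.
  by rewrite /s -natr1; field; rewrite gt_eqF.
have sh n : `|s n.+1 - s n| = h.
  by rewrite sd normrM normfV (ger0_norm (ltW mp)).
have step n Y : (n < m)%N -> hq 0 (fun k => V (s n) k - W (s n) k) Y ->
   hq 0 (fun k => V (s n.+1) k - W (s n.+1) k)
     ((1 + (2 * K + 1) * h) * Y + h * (B * h + 4 * (e1 + e2))).
  move=> nm hY; have /andP[a1 a2] := sb _ (ltnW nm); have /andP[b1 b2] := sb _ nm.
  rewrite -(sh n); apply: (gronwall_step gF C0 e10 e20 bV bW aV aW) => //.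
    by rewrite eq_sym -subr_eq0 -normr_gt0 sh.
  by rewrite sh.
have a0 : 0 <= (2 * K + 1) * h by rewrite mulr_ge0 ?(ltW hp) //; lra.
have b0 : 0 <= h * (B * h + 4 * (e1 + e2)).
  by rewrite mulr_ge0 ?(ltW hp) // addr_ge0 // mulr_ge0 // ltW.
have hX' : hq 0 (fun k => V (s 0%N) k - W (s 0%N) k) X by rewrite s0.
have := gronwall_iter (w := fun n k => V (s n) k - W (s n) k) a0 b0 X0 hX' step.
rewrite sm; apply: hq_le.
have mh : m%:R * h = d by rewrite /h mulrC divfK ?gt_eqF.
rewrite -mulrA (mulrC h) mh -/G mulrA mh.
have -> : G * (X + d * (B * h + 4 * (e1 + e2))) =
  G * (X + 4 * d * (e1 + e2)) + (G * d ^+ 2 * B) / m%:R.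
  by rewrite /h; field; rewrite gt_eqF.
rewrite lerD2l ler_pdivrMr // (mulrC eps) -ler_pdivrMr //; lra.
Qed.

End Evolution.

(** * Uniform h^2 bounds for the Euler scheme *)

Section Scheme.
Context {R : realType}.
Implicit Types (u v w c phi : int -> R[i]) (V W : R -> int -> R[i]).
Variable Nh : (int -> R[i]) -> int -> R[i].
Local Notation Ff := (Ff Nh).

(* Explicit Euler scheme for the interaction picture, truncated to |k| <= N. *)
Fixpoint Vn (N : nat) (h : R) phi (n : nat) : int -> R[i] :=
  if n is n'.+1 then
    fun k => Vn N h phi n' k - h%:C * Pn N (Ff (n'%:R * h) (Vn N h phi n')) k
  else Pn N phi.

Definition un N h phi n := Sg (n%:R * h) (Vn N h phi n).

(** Back in the original variable the scheme is a splitting: an Euler step for the truncated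
    nonlinearity, then the exact free flow. This form is autonomous, so consecutive iterates can be
    compared. *)
Lemma un_rec N h phi n : un N h phi n.+1 =
  Sg h (fun k => un N h phi n k - h%:C * Pn N (Nh (un N h phi n)) k).
Proof.
have E (x : R) : h + n%:R * h - n%:R * h = h by ring.
rewrite /un -natr1 mulrDl mul1r addrC SgD /=.
rewrite SgB SgZ SgB SgZ -/(un N h phi n) Sg_Pn /Ff -/(un N h phi n).
by rewrite -/Ff -SgD subrr Sg0 SgB SgZ.
Qed.

Lemma Vn_supp N h phi n (k : int) : (N < `|k|)%N -> Vn N h phi n k = 0.
Proof.
move=> Nk; have Hk : (`|k| <= N)%N = false by rewrite leqNgt Nk.
elim: n => [|n IH] /=; first by rewrite /Pn Hk.
by rewrite IH /Pn Hk mulr0 subr0.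
Qed.

Lemma PnK N c : (forall k : int, (N < `|k|)%N -> c k = 0) -> Pn N c = c.
Proof.
by move=> H; apply/funext => k; rewrite /Pn; case: leqP => // /H ->.
Qed.

Lemma un_supp N h phi n (k : int) : (N < `|k|)%N -> un N h phi n k = 0.
Proof. by move=> Nk; rewrite /un /Sg Vn_supp // mulr0. Qed.

(** Truncation is an orthogonal projection fixing [u] and [v], so accretivity survives it. *)
Lemma N2_trunc N (d th : R) u v :
  (forall k : int, (N < `|k|)%N -> u k = 0) ->
  (forall k : int, (N < `|k|)%N -> v k = 0) ->
  hq 0 (fun k => u k - v k + th%:C * (Nh u k - Nh v k)) d ->
  hq 0 (fun k => u k - v k + th%:C * (Pn N (Nh u) k - Pn N (Nh v) k)) d.
Proof.
move=> hu hv /(hq_Pn N); apply: hq_eqsq => k; congr sq; rewrite /Pn.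
by case: leqP => // kN; rewrite hu // hv // !subrr mulr0 addr0.
Qed.

Section Bound.
Variables (N : nat) (h M K r0 K0 T : R) (phi : int -> R[i]).
Hypotheses (h0 : 0 < h) (K1 : 1 <= K) (r00 : 0 <= r0) (K00 : 1 <= K0).
Hypothesis hphi : hq 2 phi r0.
Hypothesis H0 : forall u, hq 2 u r0 -> hq 1 (Nh u) K0.
Hypothesis N3 : forall u, hq 2 u M -> hq 1 (Nh u) K.
Hypothesis N1 : forall u v (d : R), hq 2 u M -> hq 2 v M ->
  hq 1 (fun k => u k - v k) d -> hq 0 (fun k => Nh u k - Nh v k) (K * d).
Hypothesis N2 : forall u v (d d1 th : R), hq 2 u M -> hq 2 v M ->
  hq 0 (fun k => u k - v k) d -> hq 1 (fun k => u k - v k) d1 ->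
  hq 0 (fun k => u k - v k + th%:C * (Nh u k - Nh v k))
    ((1 + K * `|th|) * d + K * th ^+ 2 * d1).
(** Chain of bounds on squares: [2 * A] for the first difference quotient in time, [4 * A] for all
    of them; then, through the equation, [B] for [(Sg h u - u) / h]; then [M1] for the h^2 norm.
    [A], [B] and [M1] depend on the data only. [M] leaves room for one crude step beyond [M1], and
    [hN] is the restriction linking step and frequency cutoff. *)
Variables (A B M1 : R).
Hypotheses (AE : A = r0 + K0) (BE : B = 8 * A + 4 + 4 * K0).
Hypothesis M1E : M1 = 2 * (2 * r0 + 2) + 8 * B.
Hypothesis ME : M = 2 * M1 + 2.
Hypothesis hN : h * (1 + N%:R ^+ 2) * K <= 1.
Hypothesis T0 : 0 < T.
Hypothesis T1 : T * (4 * K * (A + M)) <= 1.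
Local Notation u := (un N h phi).

Ltac base_hyps := have := K1; have := K00; have := r00; move=> ? ? ?.
Let A1 : 1 <= A. Proof. by rewrite AE -[1]add0r lerD. Qed.
Let B12 : 12 <= B. Proof. by base_hyps; have := A1; rewrite BE; lra. Qed.
Let Mge : r0 <= M. Proof. by base_hyps; have := B12; rewrite ME M1E; lra. Qed.
Let Mge1 : 1 <= M. Proof. by base_hyps; have := B12; rewrite ME M1E; lra. Qed.
Let NN : 1 <= 1 + N%:R ^+ 2 :> R. Proof. by rewrite lerDl sqr_ge0. Qed.
Let hK : h * K <= 1.
Proof.
apply: le_trans hN; rewrite -mulrA ler_wpM2l ?(ltW h0) //.
by rewrite -[leLHS]mul1r ler_wpM2r // (le_trans ler01).
Qed.
Let hNN : h * (1 + N%:R ^+ 2) <= 1.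
Proof.
apply: le_trans hN; rewrite -[leLHS]mulr1 ler_wpM2l // mulr_ge0 ?(ltW h0) //.
Qed.
Let h1 : h <= 1.
Proof. by apply: le_trans hNN; rewrite -[leLHS]mulr1 ler_wpM2l // ltW. Qed.

Ltac all_hyps := base_hyps; have := h0; have := T0; move=> ? ?; have := A1; have := B12; have := Mge1; have := NN; have := h1; move=> ? ? ? ? ?.

Lemma scheme_init : hq 2 (u 0) r0.
Proof. by rewrite /un; apply: hq_Sg; exact: hq_Pn. Qed.

Lemma scheme_d0 : hq 0 (fun k => u 1%N k - u 0%N k) (2 * h ^+ 2 * A).
Proof.
all_hyps.
have -> : (fun k => u 1%N k - u 0%N k) =
    (fun k => (Sg h (u 0%N) k - u 0%N k) - h%:C * Sg h (Pn N (Nh (u 0%N))) k).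
  by apply/funext => k; rewrite un_rec SgB SgZ; ring.
have e1 := hq_Sg_sub2 h scheme_init.
have e2 : hq 0 (Sg h (Pn N (Nh (u 0%N)))) K0.
  by apply: hq_Sg; apply: hq_Pn; apply: hq_mono (H0 scheme_init).
apply: hq_le (hqB e1 (hqZ h e2)).
by rewrite le_eqVlt AE; apply/orP; left; apply/eqP; ring.
Qed.

(** Accretivity with [th = - h], applied to two consecutive iterates. By Bernstein and [hN] the h^1
    term is at most [K * h] times the l^2 term, so one step multiplies by at most [1 + 2 * K * h].
    The linear growth [1 + 4 * K * n * h] is stable under this because [4 * K * n * h <= 1] up to
    time [T]. *)
Lemma scheme_d (n : nat) : (forall i, (i <= n)%N -> hq 2 (u i) M) -> n%:R * h <= T ->
  hq 0 (fun k => u n.+1 k - u n k) ((1 + 4 * K * (n%:R * h)) * (2 * h ^+ 2 * A)).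
Proof.
all_hyps.
have Khh : 0 <= K * h by rewrite mulr_ge0 ?(ltW h0) //; lra.
elim: n => [|n IH] Hn nT; first by rewrite mul0r mulr0 addr0 mul1r; exact: scheme_d0.
have nT' : n%:R * h <= T.
  by apply: le_trans nT; rewrite ler_wpM2r ?(ltW h0) // ler_nat.
have {}IH := IH (fun i ni => Hn i (leqW ni)) nT'.
have hu1 := Hn n.+1 (leqnn _); have hu := Hn n (leqnSn _).
set D := (1 + _) * _ in IH.
have D0 := hq_ge0 IH.
have S n' := @un_supp N h phi n'.
have IH1 : hq 1 (fun k => u n.+1 k - u n k) ((1 + N%:R ^+ 2) * D).
  have := hq_Pn_raise N 1 IH; rewrite expr1 PnK // => k Nk.
  by rewrite !S // subrr.
have := N2_trunc (S _) (S _) (N2 (- h) hu1 hu IH IH1).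
move=> /(hq_Sg h); rewrite Sg_add SgB SgZ SgB => G.
have -> : (fun k => u n.+2 k - u n.+1 k) = (fun k => Sg h (u n.+1) k - Sg h (u n) k +
   (- h)%:C * (Sg h (Pn N (Nh (u n.+1))) k - Sg h (Pn N (Nh (u n))) k)).
  apply/funext => k.
  have E m : u m.+1 k = Sg h (u m) k - h%:C * Sg h (Pn N (Nh (u m))) k.
    by rewrite un_rec SgB SgZ.
  by rewrite (E n.+1) [in LHS](E n) rmorphN /=; ring.
apply: hq_le G; rewrite normrN (gtr0_norm h0) sqrrN.
apply: (@le_trans _ _ ((1 + 2 * K * h) * D)).
  have : K * h ^+ 2 * ((1 + N%:R ^+ 2) * D) <= K * h * D.
    have -> : K * h ^+ 2 * ((1 + N%:R ^+ 2) * D) = (K * h * D) * (h * (1 + N%:R ^+ 2)).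
      by ring.
    by rewrite -[leRHS]mulr1 ler_wpM2l // mulr_ge0.
  lra.
have DD : 0 <= 2 * h ^+ 2 * A by apply: mulr_ge0; [rewrite mulr_ge0 ?sqr_ge0 | lra].
rewrite /D mulrA ler_wpM2r //.
have x0 : 0 <= n%:R * h by rewrite mulr_ge0 // ltW.
rewrite -(natr1 n) (mulrDl n%:R) mul1r.
set x := n%:R * h in x0 nT' *.
have : 4 * K * x <= 1.
  apply: le_trans T1; rewrite (mulrC T); apply: (@le_trans _ _ (4 * K * T)).
    by rewrite ler_wpM2l // mulr_ge0 //; lra.
  rewrite ler_wpM2r ?(ltW T0) // -[leLHS]mulr1 ler_wpM2l ?mulr_ge0 //; lra.
move=> xK; have : K * h * (4 * K * x) <= K * h * 1 by rewrite ler_wpM2l.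
lra.
Qed.

Lemma scheme_d' (n : nat) : (forall i, (i <= n)%N -> hq 2 (u i) M) -> n%:R * h <= T ->
  hq 0 (fun k => u n.+1 k - u n k) (h ^+ 2 * (4 * A)).
Proof.
all_hyps.
move=> Hn nT; apply: hq_le (scheme_d Hn nT).
have -> : h ^+ 2 * (4 * A) = 2 * (2 * h ^+ 2 * A) by ring.
rewrite ler_wpM2r //; first by apply: mulr_ge0; [rewrite mulr_ge0 ?sqr_ge0 | lra].
have : 4 * K * (n%:R * h) <= 1.
  apply: le_trans T1; rewrite (mulrC T); apply: (@le_trans _ _ (4 * K * T)).
    by rewrite ler_wpM2l // mulr_ge0 //; lra.
  rewrite ler_wpM2r ?(ltW T0) // -[leLHS]mulr1 ler_wpM2l ?mulr_ge0 //; lra.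
lra.
Qed.

Lemma scheme_u0 (n : nat) : (forall i, (i <= n)%N -> hq 2 (u i) M) -> n%:R * h <= T ->
  hq 0 (fun k => u n k - u 0%N k) (T ^+ 2 * (4 * A)).
Proof.
all_hyps.
move=> Hn nT.
have -> : (fun k => u n k - u 0%N k) = (fun k => \sum_(i < n) (u i.+1 k - u i k)).
  apply/funext => k; elim: (n) => [|m IH]; first by rewrite big_ord0 subrr.
  by rewrite big_ord_recr /= -IH; ring.
have A0 : 0 <= 4 * A by lra.
have := @hq_sumM R 0 (fun i k => u i.+1 k - u i k) (fun=> h) (4 * A) n A0.
move=> /(_ (fun i _ => ltW h0)) H.
apply: hq_le (H _) => [|i ni].
  rewrite sumr_const card_ord -[h *+ n]mulr_natl ler_wpM2r // ler_sqr ?nnegrE ?(ltW T0) //.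
  by rewrite mulr_ge0 // ltW.
apply: scheme_d' => [j ji|]; first by apply: Hn; rewrite (leq_trans ji) // ltnW.
by apply: le_trans nT; rewrite ler_wpM2r ?(ltW h0) // ler_nat ltnW.
Qed.

(** The gain of the bootstrap: from the bound [M] on the past to the smaller [M1]. The equation
    expresses [Sg h (u n) - u n] by the time difference and the nonlinearity, both O(h) in l^2, and
    below frequency [N] this difference is comparable to [h * k^2 * u n]. *)
Lemma scheme_bound_step (n : nat) : (forall i, (i <= n)%N -> hq 2 (u i) M) ->
  n%:R * h <= T -> hq 2 (u n) M1.
Proof.
all_hyps.
move=> Hn nT.
have S := @un_supp N h phi n.
have e0 := scheme_u0 Hn nT.
have hu := Hn n (leqnn _); have i0 := scheme_init.
have hu0 : hq 2 (u 0%N) M := hq_le Mge i0.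
have e1 : hq 1 (fun k => u n k - u 0%N k) (T * (4 * (A + M))).
  apply: hq_le (hq_interp T0 e0 (hqB hu hu0)).
  rewrite le_eqVlt; apply/orP; left; apply/eqP; field.
  by rewrite gt_eqF.
(* Going through [u 0] keeps the bound on [Nh (u n)] in terms of [K0]. Bounding it by [K] would be
   circular, as [K] depends on [M]. *)
have e2 : hq 0 (fun k => Nh (u n) k - Nh (u 0%N) k) 1.
  apply: hq_le (N1 hu hu0 e1); apply: le_trans T1.
  by rewrite le_eqVlt; apply/orP; left; apply/eqP; ring.
have e3 : hq 0 (Nh (u n)) (2 + 2 * K0).
  have := hqD e2 (hq_mono (isT : (0 <= 1)%N) (H0 i0)).
  rewrite mulr1; congr hq; apply/funext => k; ring.
have e4 : hq 0 (fun k => Sg h (u n) k - u n k) (h ^+ 2 * B).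
  have := hqD (scheme_d' Hn nT) (hqZ h (hq_Sg h (hq_Pn N e3))).
  have -> : (fun k => u n.+1 k - u n k + h%:C * Sg h (Pn N (Nh (u n))) k) =
            (fun k => Sg h (u n) k - u n k).
    by apply/funext => k; rewrite un_rec SgB SgZ; ring.
  by apply: hq_le; rewrite le_eqVlt BE; apply/orP; left; apply/eqP; ring.
have e5 : hq 0 (u n) (2 * r0 + 2).
  have := hqD e0 (hq_mono (isT : (0 <= 2)%N) i0).
  have -> : (fun k => u n k - u 0%N k + u 0%N k) = u n by apply/funext => k; ring.
  apply: hq_le; have T01 : T <= 1.
    apply: le_trans T1; rewrite -[leLHS]mulr1 ler_wpM2l ?(ltW T0) //.
    have : 1 * 1 <= K * (A + M) by apply: ler_pM => //; lra.
    lra.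
  have TA : T * (4 * A) <= 1.
    apply: le_trans T1; rewrite ler_wpM2l ?(ltW T0) // -!mulrA ler_wpM2l //.
    have : 1 * A <= K * (A + M) by apply: ler_pM => //; lra.
    lra.
  have : T * (T * (4 * A)) <= 1 * 1 by apply: ler_pM => //; rewrite ?mulr_ge0 ?(ltW T0) //; lra.
  by rewrite mulrA -expr2; lra.
have hm0 : 0 < h ^+ 2 by rewrite exprn_gt0.
have -> : M1 = 2 * (2 * r0 + 2) + 8 / h ^+ 2 * (h ^+ 2 * B).
  by rewrite M1E; field; rewrite gt_eqF.
apply: hq_dom2 e5 e4 _ => // [|k]; first by rewrite divr_ge0 // ltW.
rewrite wn0 !mul1r; have [Nk|Nk] := ltnP N `|k|%N.
  by rewrite S // sq0 !mulr0 add0r mulr_ge0 ?divr_ge0 ?sq_ge0 // ltW.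
rewrite sq_Sg_sub mulrA -mulrDl ler_wpM2r ?sq_ge0 //.
have kN : k%:~R ^+ 2 <= N%:R ^+ 2 :> R by rewrite intr_sqr_le.
set y := k%:~R ^+ 2 in kN *; have y0 : 0 <= y by exact: sqr_ge0.
have yh0 : 0 <= y * h by rewrite mulr_ge0 // ltW.
have yh : `|- (y * h)| <= 1.
  rewrite normrN ger0_norm //; apply: le_trans hNN; rewrite mulrC ler_wpM2l ?(ltW h0) //.
  lra.
have := sq_expi_sub1_ge yh; rewrite sqrrN => E.
(* The weight satisfies [(1 + y)^2 <= 2 + 2 * y^2]; the factor [8 / h^2] undoes the loss of 4 in
   [sq_expi_sub1_ge]. *)
rewrite /wn -/y; apply: (@le_trans _ _ (2 + 8 / h ^+ 2 * ((y * h) ^+ 2 / 4))).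
  have -> : 8 / h ^+ 2 * ((y * h) ^+ 2 / 4) = 2 * y ^+ 2 by field; rewrite gt_eqF.
  by have := sqr_ge0 (1 - y); lra.
by rewrite lerD2l ler_wpM2l // divr_ge0 // ltW.
Qed.

(** Discrete continuation: all earlier iterates satisfy [M], so the last of them satisfies [M1]; one
    step adds at most 1 in squared h^2 norm before the factor 2 of the sum, which gives [M]
    again. *)
Lemma scheme_bound (n : nat) : n%:R * h <= T -> hq 2 (u n) M.
Proof.
all_hyps.
suff H : n%:R * h <= T -> forall i, (i <= n)%N -> hq 2 (u i) M by move=> /H; apply.
elim: n => [|n IH] nT i; first by rewrite leqn0 => /eqP ->; exact: hq_le scheme_init.
have nT' : n%:R * h <= T.
  by apply: le_trans nT; rewrite ler_wpM2r ?(ltW h0) // ler_nat.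
have {}IH := IH nT'.
rewrite leq_eqVlt => /orP[/eqP->|]; last exact: IH.
have b1 := scheme_bound_step IH nT'.
have b2 := hq_Pn_raise N 1 (N3 (IH n (leqnn _))).
rewrite un_rec; apply: hq_Sg; rewrite ME; apply: hq_le (hqB b1 (hqZ h b2)).
have : h ^+ 2 * ((1 + N%:R ^+ 2) ^+ 1 * K) <= 1.
  have -> : h ^+ 2 * ((1 + N%:R ^+ 2) ^+ 1 * K) = h * (h * (1 + N%:R ^+ 2) * K) by ring.
  by rewrite -[leRHS]mulr1; apply: ler_pM => //; rewrite ?mulr_ge0 ?(ltW h0) //; lra.
by lra.
Qed.

End Bound.
End Scheme.

(** * Passage to the limit *)

Section Limit.
Context {R : realType}.

Lemma real_cauchy_cvg (f rho : nat -> R) : rho @ \oo --> 0 ->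
  (forall i j, (f i - f j) ^+ 2 <= rho i + rho j) -> cvg (f @ \oo).
Proof.
move=> r0 H; apply: cauchy_cvg; apply: cauchy_exP => e e0.
have e2 : 0 < e ^+ 2 / 2 by rewrite divr_gt0 // exprn_gt0.
have Hn : \forall n \near \oo, rho n < e ^+ 2 / 2 by exact: cvgr_lt r0 _ e2.
have [m _ Hm] := Hn; exists (f m); exists m => // n /= mn; rewrite /ball /=.
have x1 := Hm _ mn; have x2 := Hm _ (leqnn m).
rewrite -ltr_sqr ?nnegrE ?normr_ge0 ?(ltW e0) // real_normK ?num_real //.
by apply: le_lt_trans (H _ _) _; move: x1 x2 => /=; lra.
Qed.

Lemma ccvg_cauchy (c : nat -> int -> R[i]) (rho : nat -> R) : rho @ \oo --> 0 ->
  (forall i j, hq 0 (fun k => c i k - c j k) (rho i + rho j)) ->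
  exists2 z, ccvg c z & forall j, hq 0 (fun k => c j k - z k) (rho j).
Proof.
move=> r0 H.
have Hre k : cvg ((fun n => complex.Re (c n k)) @ \oo).
  apply: real_cauchy_cvg r0 _ => i j; have := hq_term k (H i j).
  by rewrite wn0 mul1r; apply: le_trans; rewrite /sq !raddfB lerDl sqr_ge0.
have Him k : cvg ((fun n => complex.Im (c n k)) @ \oo).
  apply: real_cauchy_cvg r0 _ => i j; have := hq_term k (H i j).
  by rewrite wn0 mul1r; apply: le_trans; rewrite /sq !raddfB lerDr sqr_ge0.
pose z k := limn (fun n => complex.Re (c n k)) +i* limn (fun n => complex.Im (c n k)).
have cz : ccvg c z by [].
exists z => // j; apply: hq_eps => e e0.
apply: (@hq_lim _ 0 (fun n k => c j k - c n k)).
  move=> k; split.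
    rewrite raddfB /= [X in X @ _ --> _](_ : _ = fun n => complex.Re (c j k) - complex.Re (c n k)).
      by apply: cvgB; [exact: cvg_cst | exact: Hre].
    by apply/funext => n; rewrite raddfB.
  rewrite raddfB /= [X in X @ _ --> _](_ : _ = fun n => complex.Im (c j k) - complex.Im (c n k)).
    by apply: cvgB; [exact: cvg_cst | exact: Him].
  by apply/funext => n; rewrite raddfB.
have Hn : \forall n \near \oo, rho n < e by exact: cvgr_lt r0 _ e0.
by apply: filterS Hn => n /ltW ne; apply: hq_le (H j n); rewrite lerD2l.
Qed.

Lemma ccvgD (a b : nat -> int -> R[i]) x y : ccvg a x -> ccvg b y ->
  ccvg (fun n k => a n k + b n k) (fun k => x k + y k).
Proof.
move=> ha hb k; have [a1 a2] := ha k; have [b1 b2] := hb k; split.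
  rewrite raddfD [X in X @ _ --> _](_ : _ = (fun n => complex.Re (a n k)) \+ (fun n => complex.Re (b n k))).
    exact: cvgD.
  by apply/funext => n; rewrite raddfD.
rewrite raddfD [X in X @ _ --> _](_ : _ = (fun n => complex.Im (a n k)) \+ (fun n => complex.Im (b n k))).
  exact: cvgD.
by apply/funext => n; rewrite raddfD.
Qed.

Lemma ccvgN (a : nat -> int -> R[i]) x : ccvg a x ->
  ccvg (fun n k => - a n k) (fun k => - x k).
Proof.
move=> ha k; have [a1 a2] := ha k; split.
  rewrite raddfN [X in X @ _ --> _](_ : _ = (fun n => - complex.Re (a n k))).
    exact: cvgN.
  by apply/funext => n; rewrite raddfN.
rewrite raddfN [X in X @ _ --> _](_ : _ = (fun n => - complex.Im (a n k))).
  exact: cvgN.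
by apply/funext => n; rewrite raddfN.
Qed.

Lemma ccvgZ (a : nat -> int -> R[i]) x (r : R) : ccvg a x ->
  ccvg (fun n k => r%:C * a n k) (fun k => r%:C * x k).
Proof.
have E (w : R[i]) : complex.Re (r%:C * w) = r * complex.Re w /\ complex.Im (r%:C * w) = r * complex.Im w.
  by case: w => p q /=; rewrite !mul0r subr0 addr0.
move=> ha k; have [a1 a2] := ha k; split.
  rewrite (E _).1 [X in X @ _ --> _](_ : _ = fun n => r * complex.Re (a n k)).
    by apply: cvgM => //; exact: cvg_cst.
  by apply/funext => n; rewrite (E _).1.
rewrite (E _).2 [X in X @ _ --> _](_ : _ = fun n => r * complex.Im (a n k)).
  by apply: cvgM => //; exact: cvg_cst.
by apply/funext => n; rewrite (E _).2.
Qed.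

Lemma sq_le0 (z : R[i]) : sq z <= 0 -> z = 0.
Proof. by rewrite -sqE => h; apply: eq0_normc; have := normr_ge0 (normc z); nra. Qed.

Lemma cvg_inv_sqr : (fun n : nat => (1 + n%:R ^+ 2)^-1 : R) @ \oo --> (0 : R).
Proof.
apply: (squeeze_cvgr _ (cvg_cst 0) (@cvg_harmonic R)).
apply: nearW => n; rewrite invr_ge0 addr_ge0 ?sqr_ge0 //= lef_pV2 ?posrE ?ltr_wpDr ?sqr_ge0 //.
rewrite -natr1 addrC lerD2l -natrX ler_nat; case: n => // n; exact: leq_pmulr.
Qed.

End Limit.

(** * Interpolation of the scheme in time *)

Section Existence.
Context {R : realType}.
Implicit Types (u v w c phi : int -> R[i]) (V W : R -> int -> R[i]).
Variable Nh : (int -> R[i]) -> int -> R[i].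
Local Notation Ff := (Ff Nh).
Local Notation Vn := (Vn Nh).

Lemma cell_ex (h t : R) : 0 < h -> 0 <= t ->
  exists n : nat, n%:R * h <= t /\ t <= n.+1%:R * h.
Proof.
move=> h0 t0; exists (Num.truncn (t / h)).
have th0 : 0 <= t / h by rewrite divr_ge0 // ltW.
have := truncn_itv th0; rewrite ler_pdivlMr // ltr_pdivrMr // => /andP[-> /ltW ->].
by [].
Qed.

(** For a fixed velocity [z] the expansions on adjacent intervals add up, and by [hq_addM] so do the
    lengths in their error bounds. It is enough to stay inside one cell of the grid. *)
Lemma cell_chain V (z : int -> R[i]) (h a b X : R) : 0 < h -> 0 <= a -> a <= b -> 0 <= X ->
  (forall (n : nat) (p q : R), a <= p -> p <= q -> q <= b -> n%:R * h <= p -> q <= n.+1%:R * h ->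
     hq 0 (fun k => V q k - V p k + (q - p)%:C * z k) ((q - p) ^+ 2 * X)) ->
  hq 0 (fun k => V b k - V a k + (b - a)%:C * z k) ((b - a) ^+ 2 * X).
Proof.
move=> h0 a0 ab X0 H.
have [na [na1 na2]] := cell_ex h0 a0.
have claim m q : a <= q -> q <= b -> q <= (na + m).+1%:R * h ->
  hq 0 (fun k => V q k - V a k + (q - a)%:C * z k) ((q - a) ^+ 2 * X).
  elim: m q => [|m IH] q aq qb qm; first by apply: (H na) => //; rewrite addn0 in qm.
  have [qm'|qm'] := leP q ((na + m).+1%:R * h); first exact: IH.
  set p := (na + m).+1%:R * h in qm' *.
  have ap : a <= p by apply: le_trans na2 _; rewrite ler_wpM2r ?(ltW h0) // ler_nat ltnS leq_addr.
  have pq : p <= q by exact: ltW.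
  have pb : p <= b by exact: le_trans pq qb.
  have e1 := IH p ap pb (lexx _).
  have e2 : hq 0 (fun k => V q k - V p k + (q - p)%:C * z k) ((q - p) ^+ 2 * X).
    by apply: (H (na + m).+1) => //; rewrite -addnS.
  have := hq_addM _ _ X0 e1 e2; rewrite !subr_ge0 => /(_ ap pq).
  have -> : p - a + (q - p) = q - a by ring.
  congr hq; apply/funext => k; rewrite !rmorphB /=; ring.
have [m [m1 m2]] := cell_ex h0 (le_trans a0 ab).
apply: (claim m) => //; apply: le_trans m2 _.
by rewrite ler_wpM2r ?(ltW h0) // ler_nat ltnS leq_addl.
Qed.

Section Interpolant.
Variables (N : nat) (h M K T : R) (phi : int -> R[i]).
Let M' := 2 * M + 2.
Local Notation g n := (Pn N (Ff (n%:R * h) (Vn N h phi n))).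

Definition Vi (t : R) : int -> R[i] := let n := Num.truncn (t / h) in
  fun k => Vn N h phi n k - (t - n%:R * h)%:C * g n k.

(** At the right end of the cell [truncn] already selects [n + 1], but the formula of cell [n] gives
    the next iterate there, so the interpolant is continuous. *)
Lemma Vi_cell (n : nat) (t : R) : 0 < h -> n%:R * h <= t -> t <= n.+1%:R * h ->
  Vi t = fun k => Vn N h phi n k - (t - n%:R * h)%:C * g n k.
Proof.
move=> h0 nt; rewrite le_eqVlt => /orP[/eqP -> {nt}|tn]; last first.
  rewrite /Vi; have -> // : Num.truncn (t / h) = n.
  apply/eqP; rewrite truncn_eq ?ler_pdivlMr // ?ltr_pdivrMr ?nt ?tn //.
  by rewrite mul0r (le_trans _ nt) // mulr_ge0 // ltW.
rewrite /Vi mulfK ?gt_eqF // natrK; apply/funext => k.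
by rewrite subrr mul0r subr0 -mulrBl -natrB // subSnn mul1r.
Qed.

(** Two sources of defect. The velocity of the interpolant is frozen at a node, which can lie up to
    [h] before [a], hence [C * h]; and it is truncated, which by [hq_Qn] costs [(1 + N^2)^-1]
    because [Ff] is bounded in h^1. *)
Lemma Vi_asol : 0 < h -> h <= 1 -> 0 <= M -> goodF Nh M' K ->
  h * (1 + N%:R ^+ 2) * K <= 1 ->
  (forall n, n%:R * h <= T -> hq 2 (Vn N h phi n) M) ->
  [/\ Vi 0 = Pn N phi, bdd2 M' T Vi &
      let C := 2 * K * (K + 4 * M' + 1) in
      asol Nh C (C * h + 2 * K / (1 + N%:R ^+ 2)) T Vi].
Proof.
move=> h0 h1 M0 [K1 F3 F1 _] hN hV.
have MM' : M <= M' by rewrite /M'; lra.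
have M'0 : 0 <= M' by exact: le_trans MM'.
have KK0 : 0 <= K by lra.
have N0 : 0 < 1 + N%:R ^+ 2 :> R by rewrite ltr_wpDr ?sqr_ge0.
have hV' n : n%:R * h <= T -> hq 2 (Vn N h phi n) M' by move=> /hV; exact: hq_le.
have hg n : n%:R * h <= T -> hq 1 (g n) K.
  by move=> nT; apply: hq_Pn; apply: F3; exact: hV'.
have Vin n : Vi (n%:R * h) = Vn N h phi n.
  rewrite (@Vi_cell n) //; last by rewrite ler_wpM2r ?(ltW h0) // ler_nat.
  by apply/funext => k; rewrite subrr mul0r subr0.
have B : bdd2 M' T Vi.
  move=> t t0 tT; have [n [n1 n2]] := cell_ex h0 t0.
  have nT := le_trans n1 tT.
  rewrite (Vi_cell h0 n1 n2).
  have e2 := hq_Pn_raise N 1 (hg _ nT).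
  rewrite /Pn in e2; have {}e2 : hq 2 (g n) ((1 + N%:R ^+ 2) ^+ 1 * K).
    by apply: hq_eqsq e2 => k; rewrite /Pn; case: ifP.
  apply: hq_le (hqB (hV _ nT) (hqZ (t - n%:R * h) e2)).
  rewrite /M' lerD2l -[leRHS]mulr1 ler_wpM2l // expr1.
  apply: (@le_trans _ _ (h * 1 * ((1 + N%:R ^+ 2) * K))); last by rewrite mulr1 mulrA.
  rewrite ler_wpM2r ?mulr_ge0 ?(ltW N0) //.
  have d0 : 0 <= t - n%:R * h by rewrite subr_ge0.
  have dh : t - n%:R * h <= h by move: n2; rewrite -natr1 mulrDl; lra.
  by rewrite expr2; apply: ler_pM => //; lra.
have L (a b : R) : 0 <= a -> a <= b -> b <= T ->
    hq 0 (fun k => Vi b k - Vi a k) ((b - a) ^+ 2 * K).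
  move=> a0 ab bT.
  have := @cell_chain Vi (fun=> 0) h a b K h0 a0 ab KK0.
  have -> : (fun k : int => Vi b k - Vi a k + (b - a)%:C * 0) = (fun k => Vi b k - Vi a k).
    by apply/funext => k; rewrite mulr0 addr0.
  apply=> n p q ap pq qb np qn.
  have nT : n%:R * h <= T by exact: le_trans np (le_trans pq (le_trans qb bT)).
  have := hqZ (q - p) (hq_mono (isT : (0 <= 1)%N) (hg n nT)); apply: hq_eqsq => k.
  rewrite (Vi_cell h0 np (le_trans pq qn)) (Vi_cell h0 (le_trans np pq) qn).
  by rewrite -sqN; congr sq; rewrite !rmorphB /=; ring.
split=> //.
  by have := Vin 0%N; rewrite mul0r.
move=> C a tau b a0 atau taub bT; set z := Ff tau (Vi tau).
have tau0 : 0 <= tau by exact: le_trans atau.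
have tauT : tau <= T by exact: le_trans bT.
have C0 : 0 <= C by rewrite /C !mulr_ge0 //; lra.
have ab : a <= b by exact: le_trans taub.
have := @cell_chain Vi z h a b (C * (b - a) + (C * h + 2 * K / (1 + N%:R ^+ 2))) h0 a0 ab.
apply.
  have iN : 0 <= (1 + N%:R ^+ 2)^-1 :> R by rewrite invr_ge0 ltW.
  apply: addr_ge0; first by rewrite mulr_ge0 // subr_ge0.
  by apply: addr_ge0; rewrite mulr_ge0 ?(ltW h0) // mulr_ge0.
move=> n p q ap pq qb np qn.
have nT : n%:R * h <= T by exact: le_trans np (le_trans pq (le_trans qb bT)).
have nh0 : 0 <= n%:R * h by rewrite mulr_ge0 // ltW.
pose d := `|n%:R * h - tau|.
have d0 : 0 <= d by exact: normr_ge0.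
have dle : d <= (b - a) + h.
  rewrite /d ler_norml; apply/andP; split; last by lra.
  by move: qn; rewrite -natr1 mulrDl; lra.
have e1 : hq 1 (fun k => Vn N h phi n k - Vi tau k) (d * (K + 4 * M')).
  have [dz|dp] := eqVneq d 0.
    move/eqP: dz; rewrite normr_eq0 subr_eq0 => /eqP nt.
    rewrite -nt Vin.
    have -> : (fun k => Vn N h phi n k - Vn N h phi n k) = fun=> 0.
      by apply/funext => k; rewrite subrr.
    by apply: hq_zero; rewrite mulr_ge0 //; lra.
  have {}dp : 0 < d by rewrite lt_def dp.
  have e0 : hq 0 (fun k => Vn N h phi n k - Vi tau k) (d ^+ 2 * K).
    rewrite -Vin; have [nt|nt] := leP (n%:R * h) tau.
      apply: hq_swap; have -> : d = tau - n%:R * h by rewrite /d distrC ger0_norm // subr_ge0.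
      exact: L.
    have -> : d = n%:R * h - tau by rewrite /d ger0_norm // subr_ge0 ltW.
    by apply: L => //; exact: ltW.
  apply: hq_le (hq_interp dp e0 (hqB (hV' _ nT) (B _ tau0 tauT))).
  by rewrite le_eqVlt; apply/orP; left; apply/eqP; field; rewrite gt_eqF.
have e2 := F1 (n%:R * h) tau _ _ _ (hV' _ nT) (B _ tau0 tauT) e1.
have e3 := hq_Qn N (F3 (n%:R * h) _ (hV' _ nT)).
have := hqZ (q - p) (hqB e2 e3).
have -> : (fun k => (q - p)%:C * (Ff (n%:R * h) (Vn N h phi n) k - Ff tau (Vi tau) k -
   (Ff (n%:R * h) (Vn N h phi n) k - Pn N (Ff (n%:R * h) (Vn N h phi n)) k))) =
   (fun k => (q - p)%:C * (g n k - z k)).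
  by apply/funext => k; rewrite /z; ring.
move=> e4; apply: (@hq_le _ _ _ ((q - p) ^+ 2 * (2 * (K * (d * (K + 4 * M') + d)) + 2 * ((1 + N%:R ^+ 2)^-1 * K)))).
  rewrite ler_wpM2l ?sqr_ge0 // addrA; apply: lerD; last first.
    by rewrite le_eqVlt; apply/orP; left; apply/eqP; ring.
  rewrite -mulrDr /C -[leLHS](_ : 2 * K * (K + 4 * M' + 1) * d = _); last by ring.
  by rewrite ler_wpM2l.
apply: hq_eqsq e4 => k.
rewrite (Vi_cell h0 np (le_trans pq qn)) (Vi_cell h0 (le_trans np pq) qn).
by rewrite -sqN; congr sq; rewrite !rmorphB /=; ring.
Qed.

End Interpolant.

Lemma asol_le C C' e e' T T' V : C <= C' -> e <= e' -> T' <= T ->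
  asol Nh C e T V -> asol Nh C' e' T' V.
Proof.
move=> CC ee TT H a tau b a0 at1 tb bT.
apply: hq_le (H _ _ _ a0 at1 tb (le_trans bT TT)).
by rewrite ler_wpM2l ?sqr_ge0 // lerD // ler_wpM2r // subr_ge0 (le_trans at1 tb).
Qed.

End Existence.

(** * Convergence of the interpolated schemes *)

Section EvolutionExistence.
Context {R : realType}.
Implicit Types (u v w c phi : int -> R[i]) (V W : R -> int -> R[i]).
Variable Nh : (int -> R[i]) -> int -> R[i].
Local Notation Ff := (Ff Nh).

Theorem evolution_exists (r0 : R) : good_nl Nh -> 0 <= r0 ->
  exists T M C : R, [/\ 0 < T, 0 <= C & forall phi, hq 2 phi r0 ->
    exists V, [/\ V 0 = phi, bdd2 M T V & asol Nh C 0 T V]].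
Proof.
move=> gN r00.
have [K0 [K01 H0 _ _]] := gN r0.
pose A := r0 + K0; pose B := 8 * A + 4 + 4 * K0.
pose M1 := 2 * (2 * r0 + 2) + 8 * B; pose M := 2 * M1 + 2.
have [K [K1 N3 N1 N2]] := gN M.
(* The iterates are bounded by [M], their interpolants and the limit only by [2 * M + 2]. The
   constants [K] and [K'] belong to these two balls. *)
have [K' gF] := goodF_ex gN (2 * M + 2).
have K'1 : 1 <= K' by case: gF.
have A1 : 1 <= A by rewrite -[leLHS]add0r lerD.
have M0 : 0 <= M by rewrite /M /M1 /B; move: (A) A1 => a a1; lra.
have AM : 0 < 4 * K * (A + M).
  by rewrite !mulr_gt0 //; [lra | move: (A) (M) A1 M0 => a m; lra].
pose T := (4 * K * (A + M))^-1.
have T0 : 0 < T by rewrite invr_gt0.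
have T1 : T * (4 * K * (A + M)) <= 1 by rewrite mulVf // gt_eqF.
pose C := 2 * K' * (K' + 4 * (2 * M + 2) + 1).
have C0 : 0 <= C by rewrite /C !mulr_ge0 //; move: (M) M0 => m m0; lra.
exists T, (2 * M + 2), (C + 1); split => //; first by lra.
move=> phi hphi.
pose rho (j : nat) : R := (1 + j%:R ^+ 2)^-1.
have rp j : 0 < rho j by rewrite invr_gt0 ltr_wpDr ?sqr_ge0.
have r1 j : rho j <= 1 by rewrite invf_le1 ?lerDl ?sqr_ge0 // ltr_wpDr ?sqr_ge0.
have rho0 : rho @ \oo --> 0 by exact: cvg_inv_sqr.
have KK1 : 1 <= K * K' by rewrite -[leLHS]mulr1 ler_pM.
have KK0 : 0 < K * K' by rewrite (lt_le_trans ltr01).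
(* The cutoff is [j], and this step meets the restriction of the scheme with [K] and that of the
   interpolant with [K'], while being at most [rho j]. Every error is then a multiple of [rho j]. *)
pose h j := rho j / (K * K').
have hp j : 0 < h j by rewrite divr_gt0.
have h1 j : h j <= 1.
  by rewrite ler_pdivrMr // mul1r; exact: le_trans (r1 j) KK1.
have hr j : h j <= rho j.
  by rewrite ler_pdivrMr // -[leLHS]mulr1 ler_wpM2l // ltW.
have rN (j : nat) : rho j * (1 + j%:R ^+ 2) = 1.
  by rewrite mulVf // gt_eqF // ltr_wpDr ?sqr_ge0.
have hK j : h j * (1 + j%:R ^+ 2) * K <= 1.
  have -> : h j * (1 + j%:R ^+ 2) * K = rho j * (1 + j%:R ^+ 2) / K'.
    by rewrite /h; field; rewrite !gt_eqF //; lra.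
  by rewrite rN mul1r invf_le1 //; lra.
have hK' j : h j * (1 + j%:R ^+ 2) * K' <= 1.
  have -> : h j * (1 + j%:R ^+ 2) * K' = rho j * (1 + j%:R ^+ 2) / K.
    by rewrite /h; field; rewrite !gt_eqF //; lra.
  by rewrite rN mul1r invf_le1 //; lra.
pose Vj j := Vi Nh j (h j) phi.
pose e j := (C + 2 * K') * rho j.
have HV j : [/\ Vj j 0 = Pn j phi, bdd2 (2 * M + 2) T (Vj j) & asol Nh C (e j) T (Vj j)].
  have bn n : n%:R * h j <= T -> hq 2 (Vn Nh j (h j) phi n) M.
    move=> nT; apply: (@hq_SgK _ _ (n%:R * h j)).
    exact: (@scheme_bound _ _ _ _ _ _ _ _ _ phi (hp j) K1 r00 K01 hphi H0 N3 N1 N2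
       A B M1 erefl erefl erefl erefl (hK j) T0 T1 _ nT).
  have [v0 bV aV] := Vi_asol (hp j) (h1 j) M0 gF (hK' j) bn.
  split=> //; apply: (asol_le _ _ _ aV) => //.
  rewrite -/C /e; move: (C) C0 => c c0.
  by rewrite (mulrDl c) lerD // ler_wpM2l.
have e0 j : 0 <= e j by rewrite /e mulr_ge0 ?(ltW (rp j)) //; lra.
pose E := expR ((2 * K' + 1) * T) * (2 * r0 + 4 * T * (C + 2 * K')).
have E0 : 0 <= E.
  rewrite /E mulr_ge0 ?expR_ge0 // addr_ge0 ?mulr_ge0 ?(ltW T0) //; lra.
have Cau t : 0 <= t -> t <= T -> forall i j,
    hq 0 (fun k => Vj i t k - Vj j t k) (E * rho i + E * rho j).
  move=> t0 tT i j.
  have [v1 b1 a1] := HV i; have [v2 b2 a2] := HV j.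
  have hX : hq 0 (fun k => Vj i 0 k - Vj j 0 k) (2 * r0 * (rho i + rho j)).
    have q m := hq_Qn m (hq_mono (isT : (1 <= 2)%N) hphi).
    have := hqB (q j) (q i); rewrite v1 v2.
    have -> : (fun k => phi k - Pn j phi k - (phi k - Pn i phi k)) =
              (fun k => Pn i phi k - Pn j phi k) by apply/funext => k; ring.
    by apply: hq_le; rewrite le_eqVlt /rho; apply/orP; left; apply/eqP; ring.
  have := gronwall gF C0 (e0 i) (e0 j) b1 b2 a1 a2 (lexx 0) (ltW T0) t0 tT hX.
  rewrite subr0 (ger0_norm t0); apply: hq_le.
  have -> : 2 * r0 * (rho i + rho j) + 4 * t * (e i + e j) =
    (2 * r0 + 4 * t * (C + 2 * K')) * (rho i + rho j) by rewrite /e; ring.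
  rewrite -mulrDr mulrA ler_wpM2r ?addr_ge0 ?(ltW (rp _)) //.
  apply: ler_pM; rewrite ?expR_ge0 //.
  - by rewrite addr_ge0 ?mulr_ge0 //; lra.
  - by rewrite ler_expR ler_wpM2l //; lra.
  - by rewrite lerD2l ler_wpM2r ?ler_wpM2l //; lra.
have Er0 : (fun j => E * rho j) @ \oo --> 0.
  by rewrite -[X in _ --> X](mulr0 E); apply: cvgM => //; exact: cvg_cst.
have /choice[V HVlim] : forall t, exists z, 0 <= t -> t <= T ->
    ccvg (fun j => Vj j t) z /\ forall j, hq 0 (fun k => Vj j t k - z k) (E * rho j).
  move=> t; have [t0|t0] := leP 0 t; last by exists (fun=> 0).
  have [tT|tT] := leP t T; last by exists (fun=> 0).
  by have [z cz hz] := ccvg_cauchy Er0 (Cau t t0 tT); exists z.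
have bV : bdd2 (2 * M + 2) T V.
  move=> t t0 tT; have [cz _] := HVlim t t0 tT.
  by apply: (hq_lim cz); apply: nearW => j; have [_ + _] := HV j; apply.
exists V; split => //.
  apply/funext => k.
  have [_ Hz] := HVlim 0 (lexx _) (ltW T0).
  have h2 : hq 0 (fun k => V 0 k - phi k) 0.
    apply: hq_eps => eps eps0; rewrite add0r.
    have [j _ Hj] : \forall j \near \oo, (2 * E + 2 * r0) * rho j < eps.
      apply: (cvgr_lt (0 : R)) => //; rewrite -[X in _ --> X](mulr0 (2 * E + 2 * r0)).
      by apply: cvgM => //; exact: cvg_cst.
    have [v0 _ _] := HV j.
    have := hqB (hq_Qn j (hq_mono (isT : (1 <= 2)%N) hphi)) (hq_swap (Hz j)).
    move=> q; apply: (@hq_le _ _ _ ((2 * E + 2 * r0) * rho j)); first exact: ltW (Hj _ (leqnn j)).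
    apply: (@hq_eqsq _ _ _ (fun k => phi k - Pn j phi k - (V 0 k - Vj j 0 k))).
      by move=> k'; rewrite -sqN v0; congr sq; ring.
    by apply: hq_le q; rewrite le_eqVlt -/(rho j); apply/orP; left; apply/eqP; ring.
  by apply/eqP; rewrite -subr_eq0; apply/eqP/sq_le0; have := hq_term k h2; rewrite wn0 mul1r.
move=> a tau b a0 atau taub bT.
have tau0 : 0 <= tau by exact: le_trans atau.
have tauT : tau <= T by exact: le_trans bT.
have ab : a <= b by exact: le_trans taub.
have [ca _] := HVlim a a0 (le_trans ab bT).
have [cb _] := HVlim b (le_trans a0 ab) bT.
have [_ ht] := HVlim tau tau0 tauT.
have cF : ccvg (fun j => Ff tau (Vj j tau)) (Ff tau (V tau)).
  pose L := K' * (2 * E + 4 * (2 * M + 2)).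
  apply: (@hq_near_ccvg _ _ _ (fun j => L * harmonic j)).
    rewrite -[X in _ --> X](mulr0 L); apply: cvgM; first exact: cvg_cst.
    exact: cvg_harmonic.
  move=> j; have [_ bj _] := HV j; have [_ _ F1 _] := gF.
  (* The l^2 error [E * rho j] is of order [j^-2], so this parameter makes both terms of the
     interpolation inequality of order [1 / j]. Convergence in h^1 is what carries [Ff] to the
     limit. *)
  have x0 : 0 < j.+1%:R^-1 :> R by rewrite invr_gt0.
  have := hq_interp x0 (ht j) (hqB (bj _ tau0 tauT) (bV _ tau0 tauT)).
  move=> /(F1 tau tau _ _ _ (bj _ tau0 tauT) (bV _ tau0 tauT)); apply: hq_le.
  rewrite subrr normr0 addr0 invrK /L -mulrA ler_wpM2l //; first by lra.
  rewrite /harmonic /= (mulrDl (2 * E)) lerD //; last first.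
    by rewrite le_eqVlt; apply/orP; left; apply/eqP; ring.
  have -> : 2 * E / j.+1%:R = E * (2 / j.+1%:R) by ring.
  rewrite mulrCA ler_wpM2l // /rho ler_pdivlMr // mulrAC ler_pdivrMr ?ltr_wpDr ?sqr_ge0 //.
  rewrite -natr1; have := sqr_ge0 (j%:R - 1 : R); lra.
apply: hq_eps => eps eps0.
apply: (hq_lim (ccvgD (ccvgD cb (ccvgN ca)) (ccvgZ (b - a) cF))).
have : \forall j \near \oo, (b - a) ^+ 2 * (C + 2 * K') * rho j < eps.
  apply: (cvgr_lt (0 : R)) => //; rewrite -[X in _ --> X](mulr0 ((b - a) ^+ 2 * (C + 2 * K'))).
  by apply: cvgM => //; exact: cvg_cst.
apply: filterS => j jeps; have [_ _ aj] := HV j.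
apply: hq_le (aj _ _ _ a0 atau taub bT).
rewrite /e mulrDr [in leRHS]addr0; apply: lerD; last by rewrite mulrA ltW.
by rewrite ler_wpM2l ?sqr_ge0 // ler_wpM2r ?subr_ge0 // lerDl.
Qed.
End EvolutionExistence.

(** * Continuity in h^2 *)

Section Strong.
Context {R : realType}.
Implicit Types (u v w c a b g : int -> R[i]) (V W : R -> int -> R[i]).

Lemma hq_pert (X e : R) : 0 <= X -> 0 < e -> exists2 d : R, 0 < d &
  forall s a b, hq s a X -> hq s (fun k => b k - a k) d -> hq s b (X + e).
Proof.
move=> X0 e0; pose t := e / (2 * X + 1); have Q0 : 0 < 2 * X + 1 by lra.
have t0 : 0 < t by rewrite divr_gt0.
have i0 : 0 < 1 + t^-1 by rewrite addr_gt0 ?invr_gt0.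
exists (e / (2 * (1 + t^-1))); first by rewrite divr_gt0 // mulr_gt0.
move=> s a b ha hb.
have -> : b = (fun k => a k + (b k - a k)) by apply/funext => k; ring.
apply: hq_le (hqDt t0 ha hb).
have -> : (1 + t^-1) * (e / (2 * (1 + t^-1))) = e / 2.
  by move: i0; set y := 1 + t^-1 => y0; field; rewrite gt_eqF.
have : t * X <= e / 2.
  by rewrite /t mulrAC ler_pdivrMr //; nra.
lra.
Qed.

(** The least bound is the exact squared norm. Being nearly attained by a partial sum, it makes the
    tails small. *)
Lemma hq_sup s c X : hq s c X -> exists2 Y, hq s c Y &
  forall e : R, 0 < e -> exists n, Y - e <= \sum_(k <- zs n) wn s k * sq (c k).
Proof.
move=> hX; pose S := [set x | exists n, x = \sum_(k <- zs n) wn s k * sq (c k)].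
have hS : has_sup S.
  split; first by exists (\sum_(k <- zs 0) wn s k * sq (c k)), 0%N.
  by exists X => _ [n ->]; exact: hX.
exists (sup S) => [n|e e0].
  by apply: ub_le_sup; [exact: hS.2 | exists n].
have [_ [n ->] h] := sup_adherent e0 hS.
by exists n; exact: ltW.
Qed.

Lemma hq_tail s c X e : hq s c X -> 0 < e -> exists n, forall m,
  \sum_(k <- zs m | (n < `|k|)%N) wn s k * sq (c k) <= e.
Proof.
move=> /hq_sup [Y hY hs] e0; have [n hn] := hs e e0; exists n => m.
have [nm|mn] := leqP n m.
  by have := hY m; rewrite (zs_split _ nm); lra.
rewrite big_seq_cond big1 ?(ltW e0) // => k; rewrite mem_zs => /andP[h1 h2]; lia.
Qed.

(* A family of multipliers of modulus at most [sqrt B] that is small at each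
   frequency is small in norm on a fixed element. *)
Lemma hq_mult s c X (m : R -> int -> R[i]) (B : R) : 0 <= B -> hq s c X ->
  (forall t k, sq (m t k) <= B) ->
  (forall n (e : R), 0 < e -> exists2 d : R, 0 < d & forall t, `|t| < d ->
     forall k : int, (`|k| <= n)%N -> sq (m t k) <= e) ->
  forall e : R, 0 < e -> exists2 d : R, 0 < d & forall t, `|t| < d ->
    hq s (fun k => m t k * c k) e.
Proof.
move=> B0 hc mB ms e e0.
have X0 := hq_ge0 hc.
have e1 : 0 < e / (2 * (B + 1)) by rewrite divr_gt0 //; lra.
have [n hn] := hq_tail hc e1.
have e2 : 0 < e / (2 * (X + 1)) by rewrite divr_gt0 //; lra.
have [d d0 hd] := ms n _ e2; exists d => // t td.
suff H j : (n <= j)%N -> \sum_(k <- zs j) wn s k * sq (m t k * c k) <= e.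
  move=> j; apply: le_trans (H _ (leq_maxl n j)); apply: zs_sum_le (leq_maxr _ _) _ => k.
  exact: wsq_ge0.
move=> nj; rewrite (zs_split _ nj).
have h1 : \sum_(k <- zs n) wn s k * sq (m t k * c k) <= e / 2.
  apply: (@le_trans _ _ (e / (2 * (X + 1)) * X)).
    apply: le_trans (_ : _ <= e / (2 * (X + 1)) * \sum_(k <- zs n) wn s k * sq (c k)) _.
      rewrite mulr_sumr big_seq [leRHS]big_seq ler_sum // => k; rewrite mem_zs => kn.
      by rewrite sqM mulrCA ler_wpM2r ?wsq_ge0 // hd.
    by rewrite ler_wpM2l // ltW.
  rewrite mulrAC ler_pdivrMr; nra.
have h2 : \sum_(k <- zs j | (n < `|k|)%N) wn s k * sq (m t k * c k) <= e / 2.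
  apply: (@le_trans _ _ (B * (e / (2 * (B + 1))))).
    apply: le_trans (_ : _ <= B * \sum_(k <- zs j | (n < `|k|)%N) wn s k * sq (c k)) _.
      rewrite mulr_sumr ler_sum // => k _.
      by rewrite sqM mulrCA ler_wpM2r ?wsq_ge0.
    by rewrite ler_wpM2l.
  rewrite mulrA ler_pdivrMr; nra.
lra.
Qed.

Lemma Sg_strong s c X : hq s c X -> forall e : R, 0 < e ->
  exists2 d : R, 0 < d & forall t, `|t| < d -> hq s (fun k => Sg t c k - c k) e.
Proof.
move=> hc e e0.
pose m (t : R) (k : int) : R[i] := expi (- (k%:~R ^+ 2 * t)) - 1.
have m4 t k : sq (m t k) <= 4 by exact: sq_expi_sub1_le4.
have ms n (x : R) : 0 < x -> exists2 d : R, 0 < d & forall t, `|t| < d ->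
     forall k : int, (`|k| <= n)%N -> sq (m t k) <= x.
  move=> x0; pose Q : R := (1 + n%:R ^+ 2) ^+ 2.
  have Q1 : 1 <= Q by rewrite /Q exprn_ege1 // lerDl sqr_ge0.
  exists (Num.min 1 (x / Q)).
    by rewrite lt_min ltr01 divr_gt0 // (lt_le_trans ltr01).
  move=> t; rewrite lt_min => /andP[t1 tx] k kn.
  apply: le_trans (sq_expi_sub1_le _) _.
  rewrite sqrrN exprMn; apply: (@le_trans _ _ (Q * `|t|)); last first.
    by rewrite mulrC -ler_pdivlMr ?(lt_le_trans ltr01) // ltW.
  apply: ler_pM; rewrite ?sqr_ge0 //.
    rewrite /Q ler_sqr ?nnegrE ?addr_ge0 ?sqr_ge0 //.
    by apply: le_trans (_ : n%:R ^+ 2 <= _); rewrite ?intr_sqr_le // lerDr.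
  by rewrite -(real_normK (num_real t)) expr2 -[leRHS]mulr1 ler_wpM2l ?normr_ge0 // ltW.
have [d d0 hd] := hq_mult (ler0n _ 4) hc m4 ms e0.
exists d => // t td; apply: hq_eqsq (hd t td) => k.
by rewrite sq_Sg_sub sqM.
Qed.

(** The generator [i d_x^2] of the group [Sg]. *)
Definition Lop c : int -> R[i] := fun k => (0 +i* (- (k%:~R ^+ 2))) * c k.

Lemma sq_expi_taylor (x : R) : 0 <= x -> x <= 1 ->
  sq (expi (- x) - 1 - (0 +i* (- x))) <= x ^+ 4.
Proof.
move=> x0 x1; rewrite /sq /expi /= cosN sinN !subr0.
have C : {within `[0, x], continuous (@sin R)}.
  by apply: continuous_subspaceT => y; exact: continuous_sin.
have [y] := MVT_segment x0 (fun y _ => is_derive_sin y) C.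
rewrite in_itv /= => /andP[y0 yx]; rewrite sin0 !subr0 => ->.
have H (z : R) : 0 <= 1 - cos z /\ 1 - cos z <= z ^+ 2 / 2.
  have -> : cos z = cos (z / 2) * cos (z / 2) - sin (z / 2) * sin (z / 2).
    by rewrite -cosD -splitr.
  by have := cos2Dsin2 (z / 2); have := sqr_sin_le (z / 2); split; nra.
have [a1 a2] := H x; have [b1 b2] := H y.
have yx2 : y ^+ 2 <= x ^+ 2 by rewrite ler_sqr ?nnegrE.
have E1 : (cos x - 1) ^+ 2 <= (x ^+ 2 / 2) ^+ 2.
  by rewrite -sqrrN opprB ler_sqr ?nnegrE // divr_ge0 ?sqr_ge0.
have E2 : (- (cos y * x) - - x) ^+ 2 <= (x ^+ 2 / 2) ^+ 2.
  have -> : - (cos y * x) - - x = x * (1 - cos y) by ring.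
  have B0 : 0 <= x * (1 - cos y) by rewrite mulr_ge0.
  rewrite ler_sqr ?nnegrE // ?divr_ge0 ?sqr_ge0 //.
  by rewrite -[leRHS]mul1r; apply: ler_pM => //; lra.
have -> : x ^+ 4 = 4 * (x ^+ 2 / 2) ^+ 2 by field.
apply: le_trans (lerD E1 E2) _; have := sqr_ge0 (x ^+ 2 / 2); lra.
Qed.

Lemma gen_strong c X : hq 2 c X -> forall e : R, 0 < e ->
  exists2 d : R, 0 < d & forall t, 0 < t -> t < d ->
    hq 0 (fun k => t^-1%:C * (Sg t c k - c k) - Lop c k) e.
Proof.
move=> hc e e0.
(* Dividing by [1 + k^2] moves two derivatives onto the sequence [c2] and leaves a bounded
   multiplier. The value 0 for [t <= 0] is a filler, as [hq_mult] speaks of all small [t] of either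
   sign. *)
pose m (t : R) (k : int) : R[i] := if 0 < t then
  (((1 + k%:~R ^+ 2)^-1)%:C * (t^-1%:C * (expi (- (k%:~R ^+ 2 * t)) - 1) - (0 +i* (- (k%:~R ^+ 2)))))
  else 0.
have pk (k : int) : 0 < 1 + k%:~R ^+ 2 :> R by rewrite ltr_wpDr ?sqr_ge0.
pose c2 k := (1 + k%:~R ^+ 2)%:C * c k.
have hc2 : hq 0 c2 X.
  rewrite -[X]mul1r; apply: hq_dom hc _ => // k.
  by rewrite /c2 sqM sqC wn0 !mul1r /wn.
have m4 t k : sq (m t k) <= 4.
  rewrite /m; case: ifP => [t0|]; last by rewrite sq0.
  rewrite sqM sqC exprVn ler_pdivrMl ?exprn_gt0 //.
  apply: le_trans (sqB2 _ _) _.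
  have h1 := sq_expi_sub1_le (- (k%:~R ^+ 2 * t)).
  have h2 : sq (t^-1%:C * (expi (- (k%:~R ^+ 2 * t)) - 1)) <= (k%:~R ^+ 2) ^+ 2.
    rewrite sqM sqC exprVn ler_pdivrMl ?exprn_gt0 //.
    by apply: le_trans h1 _; rewrite sqrrN exprMn mulrC.
  have h3 : sq (0 +i* (- (k%:~R ^+ 2))) = (k%:~R ^+ 2) ^+ 2 :> R.
    by rewrite /sq /= expr0n add0r sqrrN.
  rewrite h3; have y0 : 0 <= k%:~R ^+ 2 :> R by exact: sqr_ge0.
  move: h2 y0; set y : R := k%:~R ^+ 2 => h2 y0; nra.
have ms n (x : R) : 0 < x -> exists2 d : R, 0 < d & forall t, `|t| < d ->
     forall k : int, (`|k| <= n)%N -> sq (m t k) <= x.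
  move=> x0; pose Q : R := (1 + n%:R ^+ 2) ^+ 2.
  have Q1 : 1 <= Q by rewrite /Q exprn_ege1 // lerDl sqr_ge0.
  have Q0 : 0 < Q by rewrite (lt_le_trans ltr01).
  exists (Num.min Q^-1 (x / Q)); first by rewrite lt_min invr_gt0 Q0 divr_gt0.
  move=> t; rewrite lt_min => /andP[tQ tx] k kn; rewrite /m.
  case: ifP => [t0|]; last by rewrite sq0 ltW.
  rewrite (gtr0_norm t0) in tQ tx.
  have yQ : k%:~R ^+ 2 <= Q :> R.
    apply: le_trans (_ : n%:R ^+ 2 <= _); rewrite ?intr_sqr_le //.
    by rewrite /Q; have := sqr_ge0 (n%:R : R); nra.
  have y2Q : (k%:~R ^+ 2) ^+ 2 <= Q :> R.
    rewrite /Q ler_sqr ?nnegrE ?sqr_ge0 ?addr_ge0 ?sqr_ge0 //.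
    by apply: le_trans (_ : n%:R ^+ 2 <= _); rewrite ?intr_sqr_le // lerDr.
  have y0 : 0 <= k%:~R ^+ 2 :> R by exact: sqr_ge0.
  have tQ1 : Q * t <= 1 by rewrite mulrC -ler_pdivlMr // mul1r ltW.
  have tQx : Q * t <= x by rewrite mulrC -ler_pdivlMr // ltW.
  have yt1 : k%:~R ^+ 2 * t <= 1 by apply: le_trans tQ1; rewrite ler_wpM2r // ltW.
  have yt0 : 0 <= k%:~R ^+ 2 * t by rewrite mulr_ge0 // ltW.
  have T := sq_expi_taylor yt0 yt1.
  rewrite sqM sqC exprVn ler_pdivrMl ?exprn_gt0 //.
  have -> : t^-1%:C * (expi (- (k%:~R ^+ 2 * t)) - 1) - (0 +i* (- (k%:~R ^+ 2))) =
    t^-1%:C * (expi (- (k%:~R ^+ 2 * t)) - 1 - (0 +i* (- (k%:~R ^+ 2 * t)))).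
    rewrite [RHS]mulrBr; congr (_ - _); simpc; congr (_ +i* _).
    by field; rewrite gt_eqF.
  rewrite sqM sqC exprVn ler_pdivrMl ?exprn_gt0 //; apply: le_trans T _.
  move: yQ y2Q y0 yt1 yt0; set y : R := k%:~R ^+ 2 => yQ y2Q y0 yt1 yt0.
  have -> : (y * t) ^+ 4 = t ^+ 2 * (y ^+ 2 * (y * t) ^+ 2) by ring.
  rewrite ler_wpM2l ?sqr_ge0 //.
  apply: (@le_trans _ _ ((1 + y) ^+ 2 * (Q * t))); last by rewrite ler_wpM2l ?sqr_ge0.
  apply: ler_pM; rewrite ?sqr_ge0 //; first by rewrite ler_sqr ?nnegrE //; lra.
  have t1 : t <= 1 by apply: le_trans tQ1; rewrite -[leLHS]mul1r ler_wpM2r // ltW.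
  rewrite exprMn; apply: ler_pM => //; rewrite ?sqr_ge0 //.
  by rewrite expr2 -[leRHS]mulr1 ler_wpM2l // ltW.
have [d d0 hd] := hq_mult (ler0n _ 4) hc2 m4 ms e0.
exists d => // t t0 td.
have td' : `|t| < d by rewrite gtr0_norm.
apply: hq_eqsq (hd t td') => k; congr sq; rewrite /m t0 /c2 /Sg /Lop.
have H : ((1 + k%:~R ^+ 2)^-1)%:C * (1 + k%:~R ^+ 2)%:C = 1 :> R[i].
  by rewrite -rmorphM /= mulVf // gt_eqF.
set x := t^-1%:C; set y := (0 +i* _); set z := expi _; set p := (_)%:C in H *; set q := (1 + _)%:C in H *.
have -> : p * (x * (z - 1) - y) * (q * c k) = (p * q) * ((x * (z - 1) - y) * c k) by ring.
by rewrite H; ring.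
Qed.

End Strong.

Section Continuity.
Context {R : realType}.
Implicit Types (u v w c a b g : int -> R[i]) (V W : R -> int -> R[i]).
Variable Nh : (int -> R[i]) -> int -> R[i].
Local Notation Ff := (Ff Nh).

Lemma asol_lip (M K C T : R) V : goodF Nh M K -> 0 <= C -> bdd2 M T V -> asol Nh C 0 T V ->
  forall t s : R, 0 <= t -> t <= T -> 0 <= s -> s <= T ->
  hq 0 (fun k => V t k - V s k) ((t - s) ^+ 2 * (2 * C * T + 2 * K)).
Proof.
move=> [K1 F3 _ _] C0 bV aV.
have H (s t : R) : 0 <= s -> s <= t -> t <= T ->
    hq 0 (fun k => V t k - V s k) ((t - s) ^+ 2 * (2 * C * T + 2 * K)).
  move=> s0 st tT.
  have e1 := aV s s t s0 (lexx _) st tT.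
  have e2 := hqZ (t - s) (hq_mono (isT : (0 <= 1)%N) (F3 s _ (bV s s0 (le_trans st tT)))).
  have := hqB e1 e2.
  have -> : (fun k => V t k - V s k + (t - s)%:C * Ff s (V s) k - (t - s)%:C * Ff s (V s) k) =
     (fun k => V t k - V s k) by apply/funext => k; ring.
  apply: hq_le; rewrite addr0.
  have -> : 2 * ((t - s) ^+ 2 * (C * (t - s))) + 2 * ((t - s) ^+ 2 * K) =
    (t - s) ^+ 2 * (2 * C * (t - s) + 2 * K) by ring.
  rewrite ler_wpM2l ?sqr_ge0 // lerD2r ler_wpM2l ?mulr_ge0 //; lra.
move=> t s t0 tT s0 sT; have [ts|ts] := leP s t; first exact: H.
by rewrite -sqrrN opprB; apply: hq_swap; apply: H => //; exact: ltW.
Qed.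

Lemma hq_interp_sqr c (d A B : R) : 0 <= d -> 0 <= B -> hq 0 c (d ^+ 2 * A) -> hq 2 c B ->
  hq 1 c (d * (A + B)).
Proof.
rewrite le_eqVlt => /orP[/eqP <-|d0] B0 h0 h2.
  rewrite mul0r => n; rewrite expr0n mul0r in h0.
  rewrite big1 // => k _; have := hq_term k h0; rewrite wn0 mul1r => H.
  by rewrite (sq_le0 H) sq0 mulr0.
apply: hq_le (hq_interp d0 h0 h2).
by rewrite le_eqVlt; apply/orP; left; apply/eqP; field; rewrite gt_eqF.
Qed.

Lemma asol_hold (M K C T : R) V : goodF Nh M K -> 0 <= C -> bdd2 M T V -> asol Nh C 0 T V ->
  forall t s : R, 0 <= t -> t <= T -> 0 <= s -> s <= T ->
  hq 0 (fun k => Ff t (V t) k - Ff s (V s) k)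
    (`|t - s| * (K * (2 * C * T + 2 * K + 4 * M + 1))).
Proof.
move=> gF C0 bV aV t s t0 tT s0 sT.
have [_ _ F1 _] := gF.
have e0 := asol_lip gF C0 bV aV t0 tT s0 sT.
rewrite -(real_normK (num_real (t - s))) in e0.
have M0 := hq_ge0 (bV t t0 tT).
have M4 : 0 <= 2 * M + 2 * M by lra.
have e1 := hq_interp_sqr (normr_ge0 _) M4 e0 (hqB (bV t t0 tT) (bV s s0 sT)).
apply: hq_le (F1 t s _ _ _ (bV t t0 tT) (bV s s0 sT) e1).
by rewrite le_eqVlt; apply/orP; left; apply/eqP; ring.
Qed.

(** The equation for [u] is autonomous. In the interaction picture the shifted solution is
    [S(-t) u(t + eta) = S(eta) V(t + eta)], whence the factor [Sg eta]. *)
Lemma asol_shift (M C T eta : R) V : 0 <= eta -> bdd2 M T V -> asol Nh C 0 T V ->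
  bdd2 M (T - eta) (fun t => Sg eta (V (t + eta))) /\
  asol Nh C 0 (T - eta) (fun t => Sg eta (V (t + eta))).
Proof.
move=> e0 bV aV; split=> [t t0 tT|a tau b a0 at1 tb bT].
  by apply: hq_Sg; apply: bV; lra.
have := aV (a + eta) (tau + eta) (b + eta).
have -> : b + eta - (a + eta) = b - a by ring.
move=> H; apply: hq_eqsq (H _ _ _ _); try lra.
move=> k; transitivity (sq (Sg eta (fun k => V (b + eta) k - V (a + eta) k +
  (b - a)%:C * Ff (tau + eta) (V (tau + eta)) k) k)); last exact: sq_Sg.
rewrite Sg_add SgB SgZ; congr (sq (_ + _ * _)).
by rewrite /Ff -!SgD; congr (Sg _ _ _); ring.
Qed.

Lemma asol_ratio (M K C T eta : R) V : goodF Nh M K -> 0 <= C -> bdd2 M T V -> asol Nh C 0 T V ->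
  0 <= eta -> forall t t' X : R, 0 <= t -> t <= T - eta -> 0 <= t' -> t' <= T - eta ->
  hq 0 (fun k => Sg eta (V (t + eta)) k - V t k) X ->
  hq 0 (fun k => Sg eta (V (t' + eta)) k - V t' k) (expR ((2 * K + 1) * `|t' - t|) * X).
Proof.
move=> gF C0 bV aV e0 t t' X t0 tT t'0 t'T hX.
have [bW aW] := asol_shift e0 bV aV.
have bV' : bdd2 M (T - eta) V by move=> s s0 sT; apply: bV => //; lra.
have aV' : asol Nh C 0 (T - eta) V by apply: asol_le aV => //; lra.
have := gronwall gF C0 (lexx 0) (lexx 0) bW bV' aW aV' t0 tT t'0 t'T hX.
by rewrite addr0 mulr0 addr0.
Qed.

(* [vel V t] is [- S(-t) u_t], by the equation. *)
Definition vel V (t : R) : int -> R[i] := fun k => Lop (V t) k - Ff t (V t) k.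

(** The quotient is [S(-t) (u(t + eta) - u(t)) / eta]. It splits into the defect of [V], the action
    of [Sg eta] on the velocity, and the difference quotient of the group on [V t], which converges
    because [V t] is in h^2. *)
Lemma quot_vel (M K C T : R) V : goodF Nh M K -> 0 <= C -> bdd2 M T V -> asol Nh C 0 T V ->
  forall t, 0 <= t -> t < T -> forall e : R, 0 < e -> exists2 d : R, 0 < d &
  forall eta, 0 < eta -> eta < d ->
  hq 0 (fun k => eta^-1%:C * (Sg eta (V (t + eta)) k - V t k) - vel V t k) e.
Proof.
move=> [K1 F3 _ _] C0 bV aV t t0 tT e e0.
have e9 : 0 < e / 9 by rewrite divr_gt0.
have [d d0 hd] := gen_strong (bV t t0 (ltW tT)) e9.
pose Q := 9 * (C + 4 * K).
have Q0 : 0 < Q by rewrite /Q; lra.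
exists (Num.min (T - t) (Num.min d (e / Q))).
  by rewrite !lt_min subr_gt0 tT d0 divr_gt0.
move=> eta eta0; rewrite !lt_min => /and3P[etaT etad etae].
have hQ : eta * Q <= e by rewrite -ler_pdivlMr // ltW.
have h1 := hd eta eta0 etad.
have tt : t <= t + eta by rewrite lerDl ltW.
have tT' : t + eta <= T by lra.
have h2 := aV t t (t + eta) t0 (lexx _) tt tT'.
have E : t + eta - t = eta by ring.
rewrite E in h2.
have h3 := hq_Sg_subN eta (F3 t _ (bV t t0 (ltW tT))).
have h4 := hqZ eta^-1 (hq_Sg eta h2).
have := hqD3 h4 (hqN h3) h1.
have en : eta != 0 by rewrite gt_eqF.
have -> : (fun k => eta^-1%:C * Sg eta (fun k => V (t + eta) k - V t k +
     eta%:C * Ff t (V t) k) k + - (Sg eta (Ff t (V t)) k - Ff t (V t) k) +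
     (eta^-1%:C * (Sg eta (V t) k - V t k) - Lop (V t) k)) =
   (fun k => eta^-1%:C * (Sg eta (V (t + eta)) k - V t k) - vel V t k).
  apply/funext => k; rewrite Sg_add SgB SgZ /vel.
  have H : (eta^-1)%:C * eta%:C = 1 :> R[i] by rewrite -rmorphM /= mulVf.
  rewrite mulrDr !mulrBr [_ * (eta%:C * _)]mulrA H mul1r; ring.
apply: hq_le.
rewrite addr0 (gtr0_norm eta0).
have -> : eta^-1 ^+ 2 * (eta ^+ 2 * (C * eta)) = C * eta by field.
rewrite /Q in hQ; lra.
Qed.

(** The Gronwall estimate between the solution and its shift is homogeneous: it is divided by
    [eta^2], and [eta] tends to 0. As [t] and [t'] come in either order, the l^2 norm of [vel] is
    continuous. *)
Lemma vel_ratio (M K C T : R) V : goodF Nh M K -> 0 <= C -> bdd2 M T V -> asol Nh C 0 T V ->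
  forall t t' X : R, 0 <= t -> t < T -> 0 <= t' -> t' < T ->
  hq 0 (vel V t) X -> hq 0 (vel V t') (expR ((2 * K + 1) * `|t' - t|) * X).
Proof.
move=> gF C0 bV aV t t' X t0 tT t'0 t'T hX; set E := expR _.
have E0 : 0 < E by exact: expR_gt0.
have X0 := hq_ge0 hX.
apply: hq_eps => e e0.
have e1 : 0 < e / (2 * E) by rewrite divr_gt0 // mulr_gt0.
have [d1 d10 p1] := hq_pert X0 e1.
have X1 : 0 <= E * (X + e / (2 * E)) by rewrite mulr_ge0 ?addr_ge0 ?(ltW E0) ?(ltW e1).
have e2 : 0 < e / 2 by rewrite divr_gt0.
have [d2 d20 p2] := hq_pert X1 e2.
have [q1 q10 h1] := quot_vel gF C0 bV aV t0 tT d10.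
have [q2 q20 h2] := quot_vel gF C0 bV aV t'0 t'T d20.
pose q := Num.min (Num.min q1 q2) (Num.min (T - t) (T - t')).
have q0 : 0 < q by rewrite !lt_min q10 q20 !subr_gt0 tT t'T.
pose eta := q / 2.
have eta0 : 0 < eta by rewrite divr_gt0.
have : eta < q by rewrite /eta; lra.
rewrite !lt_min => /andP[/andP[eq1 eq2] /andP[eT eT']].
have s1 := p1 _ _ _ hX (h1 _ eta0 eq1).
have := hqZ eta s1.
have en : eta != 0 by rewrite gt_eqF.
have H : eta%:C * (eta^-1)%:C = 1 :> R[i] by rewrite -rmorphM /= divff.
have -> : (fun k => eta%:C * ((eta^-1)%:C * (Sg eta (V (t + eta)) k - V t k))) =
   (fun k => Sg eta (V (t + eta)) k - V t k).
  by apply/funext => k; rewrite mulrA H mul1r.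
have a1 : t <= T - eta by lra.
have a2 : t' <= T - eta by lra.
move=> /(asol_ratio gF C0 bV aV (ltW eta0) t0 a1 t'0 a2) /(hqZ eta^-1).
rewrite -/E => s2.
have {}s2 : hq 0 (fun k => (eta^-1)%:C * (Sg eta (V (t' + eta)) k - V t' k)) (E * (X + e / (2 * E))).
  by apply: hq_le s2; rewrite le_eqVlt; apply/orP; left; apply/eqP; field; rewrite en gt_eqF.
have := p2 _ _ _ s2 (hq_swap (h2 _ eta0 eq2)); apply: hq_le.
by rewrite le_eqVlt; apply/orP; left; apply/eqP; field; rewrite gt_eqF.
Qed.

(** The Radon-Riesz argument: closeness of finitely many coefficients, together with a norm that is
    not much larger, leaves no mass for the high frequencies of [g']. *)
Lemma strong_of_norm g g' (X e : R) n : 0 < e -> hq 0 g X -> X - e <= \sum_(k <- zs n) sq (g k) ->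
  hq 0 g' (X + e) ->
  \sum_(k <- zs n) sq (g' k - g k) <= Num.min e (e / (1 + (X + e) / e)) ->
  hq 0 (fun k => g' k - g k) (11 * e).
Proof.
move=> e0 hX hn hg'; rewrite le_min => /andP[c1 c2].
have X0 := hq_ge0 hX.
have wE (f : int -> R[i]) m : \sum_(k <- zs m) wn 0 k * sq (f k) = \sum_(k <- zs m) sq (f k).
  by apply: eq_bigr => k _; rewrite wn0 mul1r.
have Xe : 0 < X + e by lra.
pose t := e / (X + e); have t0 : 0 < t by rewrite divr_gt0.
have t1 : 0 < 1 + (X + e) / e by rewrite addr_gt0 // divr_gt0.
have G' m : \sum_(k <- zs m) sq (g' k) <= X + e by rewrite -wE.
have G m : \sum_(k <- zs m) sq (g k) <= X by rewrite -wE.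
have low : \sum_(k <- zs n) sq (g k) <= \sum_(k <- zs n) sq (g' k) + 2 * e.
  apply: (@le_trans _ _ ((1 + t) * (\sum_(k <- zs n) sq (g' k)) +
       (1 + t^-1) * \sum_(k <- zs n) sq (g' k - g k))).
    rewrite !mulr_sumr -big_split ler_sum // => k _.
    have {1}-> : g k = g' k + - (g' k - g k) by ring.
    by rewrite -[in leRHS](sqN (g' k - g k)); exact: sqD_le.
  have h1 : t * (\sum_(k <- zs n) sq (g' k)) <= e.
    by rewrite /t mulrAC ler_pdivrMr // ler_wpM2l // ltW.
  have h2 : (1 + t^-1) * (\sum_(k <- zs n) sq (g' k - g k)) <= e.
    rewrite /t invf_div mulrC; apply: le_trans (_ : e / (1 + (X + e) / e) * (1 + (X + e) / e) <= _).
      by rewrite ler_wpM2r // ltW.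
    by rewrite divfK // gt_eqF.
  lra.
suff H m : (n <= m)%N -> \sum_(k <- zs m) sq (g' k - g k) <= 11 * e.
  move=> m; rewrite wE; apply: le_trans (H _ (leq_maxl n m)).
  by apply: zs_sum_le (leq_maxr _ _) _ => k; exact: sq_ge0.
move=> nm; rewrite (zs_split _ nm).
(* Above [n] the mass of [g] is at most [e], that of [g'] at most [(X + e) - (X - 3 * e) = 4 * e].
   With the low part this gives [e + 2 * 4 * e + 2 * e = 11 * e]. *)
have S1 := G m; have S2 := G' m; rewrite !(zs_split _ nm) in S1 S2.
have : \sum_(k <- zs m | (n < `|k|)%N) sq (g' k - g k) <=
  2 * (\sum_(k <- zs m | (n < `|k|)%N) sq (g' k)) + 2 * \sum_(k <- zs m | (n < `|k|)%N) sq (g k).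
  by rewrite !mulr_sumr -big_split ler_sum // => k _; exact: sqB2.
lra.
Qed.

Lemma vel_strong (M K C T : R) V : goodF Nh M K -> 0 <= C -> bdd2 M T V -> asol Nh C 0 T V ->
  forall t : R, 0 <= t -> t < T -> forall e : R, 0 < e -> exists2 d : R, 0 < d &
  forall t' : R, 0 <= t' -> t' < T -> `|t' - t| < d -> hq 0 (fun k => vel V t' k - vel V t k) e.
Proof.
move=> gF C0 bV aV t t0 tT e e0.
have [K1 F3 _ _] := gF.
have bt := bV t t0 (ltW tT); have M0 := hq_ge0 bt.
have LM : hq 0 (vel V t) (2 * M + 2 * K).
  apply: hqB; last exact: hq_mono (isT : (0 <= 1)%N) (F3 _ _ bt).
  rewrite -[M]mul1r; apply: hq_dom bt _ => // k.
  rewrite /Lop sqM wn0 !mul1r ler_wpM2r ?sq_ge0 // /sq /= expr0n add0r sqrrN /wn.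
  by rewrite ler_sqr ?nnegrE ?addr_ge0 ?sqr_ge0 // lerDr.
have [X hX hs] := hq_sup LM.
have X0 := hq_ge0 hX.
pose e' := e / 11; have e'0 : 0 < e' by rewrite divr_gt0.
have [n hn] := hs _ e'0.
have {}hn : X - e' <= \sum_(k <- zs n) sq (vel V t k).
  by apply: le_trans hn _; apply: ler_sum => k _; rewrite wn0 mul1r.
pose mu := Num.min e' (e' / (1 + (X + e') / e')).
have mu0 : 0 < mu.
  by rewrite lt_min e'0 divr_gt0 // addr_gt0 // divr_gt0 //; lra.
pose kap := 2 * K + 1.
pose L1 := 2 * C * T + 2 * K; pose L2 := K * (2 * C * T + 2 * K + 4 * M + 1).
have T0 : 0 < T by exact: le_lt_trans tT.
have L10 : 0 <= L1 by rewrite /L1 addr_ge0 ?mulr_ge0 ?(ltW T0) //; lra.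
have L20 : 0 <= L2.
  by rewrite /L2 mulr_ge0 ?addr_ge0 ?mulr_ge0 ?(ltW T0) //; lra.
pose NN : R := (1 + n%:R ^+ 2) ^+ 2.
pose Q := 2 * NN * L1 + 2 * L2 + 1.
have NN0 : 0 <= NN by rewrite /NN sqr_ge0.
have Q0 : 0 < Q by rewrite /Q ltr_wpDl // addr_ge0 // mulr_ge0 // mulr_ge0.
pose Y := e' / (X + 1).
have Y0 : 0 < Y by rewrite divr_gt0 //; lra.
have lY : 0 < ln (1 + Y) by rewrite ln_gt0 //; lra.
have kap0 : 0 < kap by rewrite /kap; lra.
exists (Num.min 1 (Num.min (mu / Q) (ln (1 + Y) / kap))).
  by rewrite !lt_min ltr01 !divr_gt0.
move=> t' t'0 t'T; rewrite !lt_min => /and3P[d1 d2 d3].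
have -> : e = 11 * e' by rewrite /e'; field.
apply: (strong_of_norm e'0 hX hn).
  apply: hq_le (vel_ratio gF C0 bV aV t0 tT t'0 t'T hX).
  have : expR ((2 * K + 1) * `|t' - t|) <= 1 + Y.
    rewrite -[leRHS]lnK ?posrE; last by lra.
    by rewrite ler_expR mulrC -ler_pdivlMr // ltW.
  move=> h; apply: le_trans (ler_wpM2r X0 h) _.
  rewrite mulrDl mul1r lerD2l /Y mulrAC ler_pdivrMr //; last by lra.
  by rewrite ler_wpM2l ?(ltW e'0) //; lra.
rewrite -/mu; apply: (@le_trans _ _ (Q * `|t' - t|)); last first.
  by rewrite mulrC -ler_pdivlMr // ltW.
have l1 := asol_lip gF C0 bV aV t'0 (ltW t'T) t0 (ltW tT).
have l2 := asol_hold gF C0 bV aV t'0 (ltW t'T) t0 (ltW tT).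
apply: (@le_trans _ _ (2 * NN * (\sum_(k <- zs n) wn 0 k * sq (V t' k - V t k)) +
   2 * (\sum_(k <- zs n) wn 0 k * sq (Ff t' (V t') k - Ff t (V t) k)))).
  rewrite !mulr_sumr -big_split big_seq [leRHS]big_seq ler_sum // => k; rewrite mem_zs => kn.
  rewrite !wn0 !mul1r.
  have -> : vel V t' k - vel V t k = (0 +i* (- (k%:~R ^+ 2))) * (V t' k - V t k) -
      (Ff t' (V t') k - Ff t (V t) k) by rewrite /vel /Lop; ring.
  apply: le_trans (sqB2 _ _) _; rewrite lerD2r sqM -mulrA ler_wpM2l //.
  rewrite ler_wpM2r ?sq_ge0 // /sq /= expr0n add0r sqrrN /NN ler_sqr ?nnegrE ?sqr_ge0 ?addr_ge0 ?sqr_ge0 //.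
  by apply: le_trans (_ : n%:R ^+ 2 <= _); rewrite ?intr_sqr_le // lerDr.
apply: (@le_trans _ _ (2 * NN * ((t' - t) ^+ 2 * L1) + 2 * (`|t' - t| * L2))).
  by apply: lerD; rewrite ler_wpM2l ?mulr_ge0.
rewrite -(real_normK (num_real (t' - t))); move: d1 (normr_ge0 (t' - t)).
set x := `|t' - t| => d1 x0.
have xx : x ^+ 2 * L1 <= x * L1.
  by rewrite ler_wpM2r // expr2 -[leRHS]mulr1 ler_wpM2l // ltW.
have : 2 * NN * (x ^+ 2 * L1) <= 2 * NN * (x * L1) by rewrite ler_wpM2l // mulr_ge0.
rewrite /Q; lra.
Qed.

(** Since [k^2 V] is, up to a factor of modulus 1, the sum of [vel] and [Ff], both continuous in
    l^2, the sequence [V] is continuous in h^2, and strong continuity of the group gives the same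
    for [Sg t (V t)]. Forward difference quotients confine the result to [t < T]. *)
Theorem asol_continuous (M K C T : R) V : goodF Nh M K -> 0 <= C -> bdd2 M T V -> asol Nh C 0 T V ->
  forall t : R, 0 <= t -> t < T -> forall e : R, 0 < e -> exists2 d : R, 0 < d &
  forall t' : R, 0 <= t' -> t' < T -> `|t' - t| < d ->
    hq 2 (fun k => Sg t' (V t') k - Sg t (V t) k) e.
Proof.
move=> gF C0 bV aV t t0 tT e e0.
have [K1 F3 _ _] := gF.
have bt := bV t t0 (ltW tT); have M0 := hq_ge0 bt.
have T0 : 0 < T by exact: le_lt_trans tT.
pose L1 := 2 * C * T + 2 * K; pose L2 := K * (2 * C * T + 2 * K + 4 * M + 1).
have L10 : 0 <= L1 by rewrite /L1 addr_ge0 ?mulr_ge0 ?(ltW T0) //; lra.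
have L20 : 0 <= L2.
  by rewrite /L2 mulr_ge0 ?addr_ge0 ?mulr_ge0 ?(ltW T0) //; lra.
have e1 : 0 < e / 32 by rewrite divr_gt0.
have e2 : 0 < e / 4 by rewrite divr_gt0.
have [d1 d10 h1] := vel_strong gF C0 bV aV t0 tT e1.
have [d2 d20 h2] := Sg_strong (hq_Sg t bt) e2.
pose Q := 32 * (L1 + L2 + 1); have Q0 : 0 < Q by rewrite /Q; lra.
exists (Num.min (Num.min 1 (e / Q)) (Num.min d1 d2)).
  by rewrite !lt_min ltr01 d10 d20 divr_gt0.
move=> t' t'0 t'T; rewrite !lt_min => /andP[/andP[x1 xQ] /andP[xd1 xd2]].
have a1 := h1 t' t'0 t'T xd1; have a2 := h2 _ xd2.
have l1 := asol_lip gF C0 bV aV t'0 (ltW t'T) t0 (ltW tT).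
have l2 := asol_hold gF C0 bV aV t'0 (ltW t'T) t0 (ltW tT).
rewrite -/L1 in l1; rewrite -/L2 in l2.
have b1 := hqD a1 l2.
have b2 : hq 2 (fun k => V t' k - V t k) (2 * ((t' - t) ^+ 2 * L1) + 2 * (2 * (e / 32) + 2 * (`|t' - t| * L2))).
  apply: hq_dom2 l1 b1 _ => // k; rewrite !wn0 !mul1r.
  have -> : vel V t' k - vel V t k + (Ff t' (V t') k - Ff t (V t) k) =
     (0 +i* (- (k%:~R ^+ 2))) * (V t' k - V t k) by rewrite /vel /Lop; ring.
  rewrite sqM mulrA -mulrDl ler_wpM2r ?sq_ge0 // /wn /sq /= expr0n add0r sqrrN.
  set y : R := k%:~R ^+ 2; have := sqr_ge0 (1 - y); lra.
have := hqD (hq_Sg t' b2) a2.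
have -> : (fun k => Sg t' (fun k => V t' k - V t k) k +
      (Sg (t' - t) (Sg t (V t)) k - Sg t (V t) k)) =
   (fun k => Sg t' (V t') k - Sg t (V t) k).
  by apply/funext => k; rewrite SgB -SgD subrK; ring.
apply: hq_le; have xQ' : `|t' - t| * Q <= e by rewrite -ler_pdivlMr // ltW.
rewrite -(real_normK (num_real (t' - t))); move: x1 xQ' (normr_ge0 (t' - t)).
set x := `|t' - t| => x1 xQ' x0.
have xx : x ^+ 2 * L1 <= x * L1.
  by rewrite ler_wpM2r // expr2 -[leRHS]mulr1 ler_wpM2l // ltW.
have x2 : 0 <= x * L2 by rewrite mulr_ge0.
have x3 : 0 <= x * L1 by rewrite mulr_ge0.
rewrite /Q in xQ'; lra.
Qed.

End Continuity.

(** * Integration and Fourier series on the torus *)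

Section RealIntegral.
Context {R : realType}.
Local Notation mu := (@lebesgue_measure R).
Local Notation D := (@torus R).
Implicit Types f g h : R -> R.

Definition Ig f : Prop := mu.-integrable D (EFin \o f).
Definition It f : R := Rintegral mu D f.

Lemma pi2_gt0 : 0 < 2 * pi :> R.
Proof. by rewrite mulr_gt0 // pi_gt0. Qed.

Lemma mtorus : measurable (D : set (measurableTypeR R)).
Proof. exact: measurable_itv. Qed.

Lemma mu_torus : mu D = (2 * pi)%:E.
Proof. by rewrite /torus lebesgue_measure_itv /= lte_fin pi2_gt0 oppr0 adde0. Qed.

Lemma Ig_meas f : Ig f -> measurable_fun D f.
Proof. by move=> h; apply/measurable_EFinP; exact: measurable_int h. Qed.

Lemma IgD f g : Ig f -> Ig g -> Ig (fun x => f x + g x).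
Proof. by move=> hf hg; have := integrableD mtorus hf hg; rewrite /Ig. Qed.

Lemma IgB f g : Ig f -> Ig g -> Ig (fun x => f x - g x).
Proof. by move=> hf hg; have := integrableB mtorus hf hg; rewrite /Ig. Qed.

Lemma IgZ (r : R) f : Ig f -> Ig (fun x => r * f x).
Proof. by move=> hf; have := integrableZl mtorus r hf; rewrite /Ig. Qed.

Lemma Ig_le f g : measurable_fun D f -> Ig g -> (forall x, D x -> `|f x| <= g x) -> Ig f.
Proof.
move=> mf hg H; apply: (le_integrable mtorus _ _ hg); first exact/measurable_EFinP.
move=> x Dx /=; rewrite lee_fin; apply: le_trans (H x Dx) _; exact: ler_norm.
Qed.

Lemma Ig_cst (r : R) : Ig (fun=> r).
Proof.
apply: measurable_bounded_integrable.
- exact: mtorus.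
- by apply: (@le_lt_trans _ _ (2 * pi)%:E); [rewrite -mu_torus | exact: ltry].
- exact: measurable_cst.
- exact: bounded_cst.
Qed.

Lemma Ig_bdd f (B : R) : measurable_fun D f -> (forall x, D x -> `|f x| <= B) -> Ig f.
Proof. by move=> mf H; apply: Ig_le mf (Ig_cst B) H. Qed.

Lemma Ig_mulb f h (B : R) : Ig f -> measurable_fun D h ->
  (forall x, D x -> `|h x| <= B) -> Ig (fun x => f x * h x).
Proof.
move=> hf mh H; have hf' : Ig (fun x => `|f x|).
  by have := integrable_abse hf; rewrite /Ig.
apply: (Ig_le _ (IgZ B hf')).
  by apply: measurable_funM => //; exact: Ig_meas.
by move=> x Dx; rewrite normrM mulrC ler_wpM2r // H.
Qed.

Lemma Ig_cont f : continuous f -> Ig f.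
Proof.
move=> cf; have h : mu.-integrable `[0, 2 * pi] (EFin \o f).
  apply: continuous_compact_integrable; first exact: segment_compact.
  exact: continuous_subspaceT.
apply: integrableS h => //; first exact: mtorus.
by apply: subset_itvl; rewrite bnd_simp.
Qed.

Lemma cont_meas f : continuous f -> measurable_fun D f.
Proof. by move=> cf; apply: measurable_funTS; exact: continuous_measurable_fun. Qed.

Lemma ItD f g : Ig f -> Ig g -> It (fun x => f x + g x) = It f + It g.
Proof. by move=> hf hg; exact: (RintegralD mtorus hf hg). Qed.

Lemma ItB f g : Ig f -> Ig g -> It (fun x => f x - g x) = It f - It g.
Proof. by move=> hf hg; exact: (RintegralB mtorus hf hg). Qed.

Lemma ItZ (r : R) f : Ig f -> It (fun x => r * f x) = r * It f.
Proof. by move=> hf; apply: RintegralZl hf; exact: mtorus. Qed.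

Lemma It_ge0 f : (forall x, D x -> 0 <= f x) -> 0 <= It f.
Proof. by move=> H; rewrite /It; apply: Rintegral_ge0 => x; exact: H. Qed.

Lemma It_le f g : Ig f -> Ig g -> (forall x, D x -> f x <= g x) -> It f <= It g.
Proof. by move=> hf hg H; exact: (le_Rintegral mtorus hf hg H). Qed.

Lemma It_cst (r : R) : It (fun=> r) = r * (2 * pi).
Proof.
rewrite /It Rintegral_cst; last exact: mtorus.
by congr (_ * _); exact: (congr1 fine mu_torus).
Qed.

Lemma It_eq f g : (forall x, D x -> f x = g x) -> It f = It g.
Proof. by move=> H; apply: eq_Rintegral => x; rewrite inE => /H. Qed.

Lemma It_deriv0 (F f : R -> R) : (forall x : R, is_derive x 1 F (f x)) -> continuous f ->
  F (2 * pi) = F 0 -> It f = 0.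
Proof.
move=> dF cf FF.
have cF : continuous F.
  move=> x; apply/differentiable_continuous/derivable1_diffP.
  by have [] := dF x.
rewrite /It /torus Rintegral_itv_bndo_bndc; last exact: Ig_cont.
rewrite /Rintegral (continuous_FTC2 pi2_gt0 _ (F := F)).
- by rewrite FF subee.
- exact: continuous_subspaceT.
- split => [x _||]; first by have [] := dF x.
  + by apply: cvg_at_right_filter; exact: cF.
  + by apply: cvg_at_left_filter; exact: cF.
- by move=> x _; rewrite derive1E; exact: derive_val.
Qed.

End RealIntegral.

Section ComplexIntegral.
Context {R : realType}.
Local Notation mu := (@lebesgue_measure R).
Local Notation D := (@torus R).
Implicit Types f g h : R -> R[i].

Definition CI f : Prop :=
  Ig (fun x => complex.Re (f x)) /\ Ig (fun x => complex.Im (f x)).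
Definition Ci f : R[i] := Cintegral D f.

Lemma Re_mul (z w : R[i]) : complex.Re (z * w) =
  complex.Re z * complex.Re w - complex.Im z * complex.Im w.
Proof. by case: z => ? ?; case: w. Qed.

Lemma Im_mul (z w : R[i]) : complex.Im (z * w) =
  complex.Re z * complex.Im w + complex.Im z * complex.Re w.
Proof. by case: z => ? ?; case: w. Qed.

Lemma Re_scale (r : R) (w : R[i]) : complex.Re (r%:C * w) = r * complex.Re w.
Proof. by rewrite Re_mul /= mul0r subr0. Qed.

Lemma complex_eq (z w : R[i]) : complex.Re z = complex.Re w -> complex.Im z = complex.Im w -> z = w.
Proof. by case: z => ? ?; case: w => ? ? /= -> ->. Qed.

Lemma CID f g : CI f -> CI g -> CI (fun x => f x + g x).
Proof.
move=> [f1 f2] [g1 g2]; split.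
  by under eq_fun do rewrite raddfD; exact: IgD.
by under eq_fun do rewrite raddfD; exact: IgD.
Qed.

Lemma CIZ (z : R[i]) f : CI f -> CI (fun x => z * f x).
Proof.
move=> [f1 f2]; split.
  by under eq_fun do rewrite Re_mul; apply: IgB; exact: IgZ.
by under eq_fun do rewrite Im_mul; apply: IgD; exact: IgZ.
Qed.

Lemma CiD f g : CI f -> CI g -> Ci (fun x => f x + g x) = Ci f + Ci g.
Proof.
move=> [f1 f2] [g1 g2]; apply: complex_eq; rewrite raddfD /= -/(It _).
  by rewrite -(ItD f1 g1); apply: It_eq => x _; rewrite raddfD.
by rewrite -(ItD f2 g2); apply: It_eq => x _; rewrite raddfD.
Qed.

Lemma CiZ (z : R[i]) f : CI f -> Ci (fun x => z * f x) = z * Ci f.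
Proof.
move=> [f1 f2]; apply: complex_eq; rewrite ?Re_mul ?Im_mul /= -/(It _).
  rewrite -!ItZ // -ItB; [|exact: IgZ..].
  by apply: It_eq => x _; rewrite Re_mul.
rewrite -!ItZ // -ItD; [|exact: IgZ..].
by apply: It_eq => x _; rewrite Im_mul.
Qed.

Lemma CI0 : CI (fun=> 0).
Proof. by split; exact: Ig_cst. Qed.

Lemma Ci_eq f g : (forall x, D x -> f x = g x) -> Ci f = Ci g.
Proof. by move=> H; congr (_ +i* _); apply: It_eq => x /H ->. Qed.

Lemma Ci_seq0 : Ci (fun=> 0) = 0.
Proof. by apply: complex_eq; rewrite /= -/(It _) It_cst mul0r. Qed.

Lemma CI_sum (I : Type) (r : seq I) (F : I -> R -> R[i]) : (forall i, CI (F i)) ->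
  CI (fun x => \sum_(i <- r) F i x).
Proof.
move=> H; elim: r => [|i r IH].
  by rewrite (_ : (fun x => _) = fun=> 0); [exact: CI0 | apply/funext => x; rewrite big_nil].
rewrite (_ : (fun x => _) = fun x => F i x + \sum_(j <- r) F j x); last first.
  by apply/funext => x; rewrite big_cons.
exact: CID.
Qed.

Lemma Ci_sum (I : Type) (r : seq I) (F : I -> R -> R[i]) : (forall i, CI (F i)) ->
  Ci (fun x => \sum_(i <- r) F i x) = \sum_(i <- r) Ci (F i).
Proof.
move=> H; elim: r => [|i r IH].
  by rewrite big_nil (_ : (fun x => _) = fun=> 0); [exact: Ci_seq0 | apply/funext => x; rewrite big_nil].
rewrite big_cons -IH -CiD //; last exact: CI_sum.
by apply: Ci_eq => x _; rewrite big_cons.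
Qed.

Lemma contD (u v : R -> R) : continuous u -> continuous v -> continuous (fun x => u x + v x).
Proof. by move=> hu hv x; apply: cvgD; [exact: hu | exact: hv]. Qed.

Lemma contB (u v : R -> R) : continuous u -> continuous v -> continuous (fun x => u x - v x).
Proof. by move=> hu hv x; apply: cvgB; [exact: hu | exact: hv]. Qed.

Lemma contM (u v : R -> R) : continuous u -> continuous v -> continuous (fun x => u x * v x).
Proof. by move=> hu hv x; apply: cvgM; [exact: hu | exact: hv]. Qed.

Definition ccont f : Prop :=
  continuous (fun x => complex.Re (f x)) /\ continuous (fun x => complex.Im (f x)).

Lemma ccont_CI f : ccont f -> CI f.
Proof. by move=> [h1 h2]; split; exact: Ig_cont. Qed.

Lemma ccontD f g : ccont f -> ccont g -> ccont (fun x => f x + g x).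
Proof.
move=> [f1 f2] [g1 g2]; split.
  by under eq_fun do rewrite raddfD; exact: contD.
by under eq_fun do rewrite raddfD; exact: contD.
Qed.

Lemma ccontM f g : ccont f -> ccont g -> ccont (fun x => f x * g x).
Proof.
move=> [f1 f2] [g1 g2]; split.
  by under eq_fun do rewrite Re_mul; apply: contB; exact: contM.
by under eq_fun do rewrite Im_mul; apply: contD; exact: contM.
Qed.

Lemma ccont_cst (z : R[i]) : ccont (fun=> z).
Proof. by split => x; exact: cst_continuous. Qed.

Lemma ccont_sum (I : Type) (r : seq I) (F : I -> R -> R[i]) : (forall i, ccont (F i)) ->
  ccont (fun x => \sum_(i <- r) F i x).
Proof.
move=> H; elim: r => [|i r IH].
  by rewrite (_ : (fun x => _) = fun=> 0); [exact: ccont_cst | apply/funext => x; rewrite big_nil].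
rewrite (_ : (fun x => _) = fun x => F i x + \sum_(j <- r) F j x); last first.
  by apply/funext => x; rewrite big_cons.
exact: ccontD.
Qed.

Lemma rderiv_add (u v : R -> R) (x du dv : R) : is_derive x 1 u du -> is_derive x 1 v dv ->
  is_derive x 1 (fun y => u y + v y) (du + dv).
Proof. by move=> hu hv; exact: is_deriveD hu hv. Qed.

Lemma rderiv_mul (u v : R -> R) (x du dv : R) : is_derive x 1 u du -> is_derive x 1 v dv ->
  is_derive x 1 (fun y => u y * v y) (u x * dv + v x * du).
Proof. by move=> hu hv; exact: is_deriveM hu hv. Qed.

Lemma rderiv_scale (a : R) (u : R -> R) (x du : R) : is_derive x 1 u du ->
  is_derive x 1 (fun y => a * u y) (a * du).
Proof. by move=> hu; exact: is_deriveZ hu. Qed.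

Lemma rderiv_comp (u v : R -> R) (x du dv : R) : is_derive (v x) 1 u du -> is_derive x 1 v dv ->
  is_derive x 1 (fun y => u (v y)) (du * dv).
Proof. by move=> hu hv; exact: is_derive1_comp hu hv. Qed.

Lemma is_derive_lin (a x : R) : is_derive x 1 (fun y => a * y) a.
Proof. by rewrite -[X in is_derive _ _ _ X](mulr1 a); apply: rderiv_scale; exact: is_derive_id. Qed.

Lemma is_derive_cosM (a x : R) : is_derive x 1 (fun y => cos (a * y)) (- (a * sin (a * x))).
Proof. by rewrite mulrC -mulNr; exact: (rderiv_comp (is_derive_cos (a * x)) (is_derive_lin a x)). Qed.

Lemma is_derive_sinM (a x : R) : is_derive x 1 (fun y => sin (a * y)) (a * cos (a * x)).
Proof. by rewrite mulrC; exact: (rderiv_comp (is_derive_sin (a * x)) (is_derive_lin a x)). Qed.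

Lemma derive_continuous (F F' : R -> R) : (forall x : R, is_derive x 1 F (F' x)) -> continuous F.
Proof.
move=> dF x; apply/differentiable_continuous/derivable1_diffP.
by have [] := dF x.
Qed.

Lemma ccont_expi (a : R) : ccont (fun x => expi (a * x)).
Proof.
split; rewrite /=; first exact: (derive_continuous (is_derive_cosM a)).
exact: (derive_continuous (is_derive_sinM a)).
Qed.

Lemma cos_sin_int (k : int) : cos (k%:~R * (2 * pi)) = 1 :> R /\ sin (k%:~R * (2 * pi)) = 0 :> R.
Proof.
have H (n : nat) : cos (n%:R * (2 * pi)) = 1 :> R /\ sin (n%:R * (2 * pi)) = 0 :> R.
  have -> : n%:R * (2 * pi) = 0 + (pi *+ 2) *+ n :> R.
    by rewrite add0r mulr_natl mulr_natl.
  by rewrite (periodicn (@cosD2pi R)) (periodicn (@sinD2pi R)) cos0 sin0.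
case: (intP k) => [|n|n]; rewrite ?mul0r ?cos0 ?sin0 //; first exact: H.
by rewrite mulrNz mulNr cosN sinN; have [-> ->] := H n.+1; rewrite oppr0.
Qed.

Lemma Ci_expi (k : int) : Ci (fun x => expi (k%:~R * x)) = if k == 0 then (2 * pi)%:C else 0.
Proof.
have [->|k0] := eqVneq k 0.
  apply: complex_eq; rewrite /= -/(It _).
    by rewrite -[RHS]mul1r -It_cst; apply: It_eq => x _; rewrite mul0r cos0.
  by rewrite -[RHS](mul0r (2 * pi)) -It_cst; apply: It_eq => x _; rewrite mul0r sin0.
have a0 : k%:~R != 0 :> R by rewrite intr_eq0.
have [C S] := cos_sin_int k.
have [hc hs] := ccont_expi k%:~R.
have Z1 : It (fun x : R => k%:~R * cos (k%:~R * x)) = 0.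
  apply: (@It_deriv0 _ (fun y => sin (k%:~R * y)) _ (is_derive_sinM k%:~R)); last by rewrite S mulr0 sin0.
  by apply: contM => // x; exact: cst_continuous.
have Z2 : It (fun x : R => - (k%:~R * sin (k%:~R * x))) = 0.
  apply: (@It_deriv0 _ (fun y => cos (k%:~R * y)) _ (is_derive_cosM k%:~R)); last by rewrite C mulr0 cos0.
  by move=> x; apply: cvgN; apply: (@contM (fun=> k%:~R) (fun y => sin (k%:~R * y))) => // y; exact: cst_continuous.
apply: complex_eq; rewrite /= -/(It _).
  by move: Z1; rewrite ItZ; [move/eqP; rewrite mulf_eq0 (negbTE a0) => /eqP | exact: Ig_cont].
have E : It (fun x : R => - k%:~R * sin (k%:~R * x)) = 0.
  by rewrite -Z2; apply: It_eq => x _; rewrite mulNr.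
by move: E; rewrite ItZ; [move/eqP; rewrite mulf_eq0 oppr_eq0 (negbTE a0) => /eqP | exact: Ig_cont].
Qed.

Lemma abs_Re_expi (x : R) : `|cos x| <= 1. Proof. by rewrite ler_norml cos_geN1 cos_le1. Qed.
Lemma abs_Im_expi (x : R) : `|sin x| <= 1. Proof. by rewrite ler_norml sin_geN1 sin_le1. Qed.

Lemma CI_expi f (a : R) : CI f -> CI (fun x => f x * expi (a * x)).
Proof.
move=> [f1 f2]; have [c1 c2] := ccont_expi a; split.
  under eq_fun do rewrite Re_mul; apply: IgB.
    by apply: (Ig_mulb f1 (cont_meas c1)) => x _; exact: abs_Re_expi.
  by apply: (Ig_mulb f2 (cont_meas c2)) => x _; exact: abs_Im_expi.
under eq_fun do rewrite Im_mul; apply: IgD.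
  by apply: (Ig_mulb f1 (cont_meas c2)) => x _; exact: abs_Im_expi.
by apply: (Ig_mulb f2 (cont_meas c1)) => x _; exact: abs_Re_expi.
Qed.

Lemma fourierE f k : fourier f k = ((2 * pi)^-1)%:C * Ci (fun x => f x * expi (- k%:~R * x)).
Proof.
rewrite /fourier -/(Ci _) (@Ci_eq _ (fun x => f x * expi (- k%:~R * x))) // => x _.
by rewrite mulNr.
Qed.

Lemma fourierD f g k : CI f -> CI g -> fourier (fun x => f x + g x) k = fourier f k + fourier g k.
Proof.
move=> hf hg; rewrite !fourierE -mulrDr -CiD; try exact: CI_expi.
by congr (_ * _); apply: Ci_eq => x _; rewrite mulrDl.
Qed.

Lemma fourierZ (z : R[i]) f k : CI f -> fourier (fun x => z * f x) k = z * fourier f k.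
Proof.
move=> hf; rewrite !fourierE mulrCA -(CiZ z); last exact: CI_expi.
by congr (_ * _); apply: Ci_eq => x _; rewrite mulrA.
Qed.

Lemma fourierB f g k : CI f -> CI g -> fourier (fun x => f x - g x) k = fourier f k - fourier g k.
Proof.
move=> hf hg; rewrite -mulN1r -fourierZ // -fourierD //; last exact: CIZ.
by congr (fourier _ k); apply/funext => x; rewrite mulN1r.
Qed.

Lemma CIB f g : CI f -> CI g -> CI (fun x => f x - g x).
Proof.
move=> hf hg; have := CID hf (CIZ (-1) hg); congr CI.
by apply/funext => x; rewrite mulN1r.
Qed.

Lemma fourier_sum (I : Type) (r : seq I) (F : I -> R -> R[i]) k : (forall i, CI (F i)) ->
  fourier (fun x => \sum_(i <- r) F i x) k = \sum_(i <- r) fourier (F i) k.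
Proof.
move=> H; rewrite fourierE; under [in RHS]eq_bigr do rewrite fourierE.
rewrite -mulr_sumr -Ci_sum; last by move=> i; exact: CI_expi.
by congr (_ * _); apply: Ci_eq => x _; rewrite mulr_suml.
Qed.

Definition Tp (n : nat) (c : int -> R[i]) : R -> R[i] :=
  fun x => \sum_(k <- zs n) c k * expi (k%:~R * x).

Lemma ccont_Tp n c : ccont (Tp n c).
Proof.
apply: ccont_sum => k; apply: ccontM; [exact: ccont_cst | exact: ccont_expi].
Qed.

Lemma twopi_unit : ((2 * pi)^-1)%:C * (2 * pi)%:C = 1 :> R[i].
Proof. by rewrite -rmorphM /= mulVf // gt_eqF // pi2_gt0. Qed.

Lemma fourier_expi (j k : int) : fourier (fun x => expi (j%:~R * x)) k = (j == k)%:R :> R[i].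
Proof.
rewrite fourierE.
have -> : Ci (fun x => expi (j%:~R * x) * expi (- k%:~R * x)) = Ci (fun x => expi ((j - k)%:~R * x)).
  by apply: Ci_eq => x _; rewrite -expiD -mulrDl intrD mulrNz.
by rewrite Ci_expi subr_eq0; case: eqP => _; rewrite ?mulr0 ?twopi_unit.
Qed.

Lemma fourier_Tp n c k : fourier (Tp n c) k = Pn n c k.
Proof.
rewrite /Tp fourier_sum; last first.
  by move=> j; apply: ccont_CI; apply: ccontM; [exact: ccont_cst | exact: ccont_expi].
under eq_bigr => j _.
  rewrite fourierZ; last by apply: ccont_CI; exact: ccont_expi.
  rewrite fourier_expi; over.
rewrite /Pn -mem_zs; case: ifPn => kn.
  rewrite (perm_big _ (perm_to_rem kn)) big_cons eqxx mulr1 big_seq big1 => [|j]; first exact: addr0.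
  by rewrite mem_rem_uniq ?zs_uniq // inE => /andP[/negbTE -> _]; rewrite mulr0.
rewrite big_seq big1 // => j jn; case: eqP => [jk|_]; last by rewrite mulr0.
by rewrite -jk jn in kn.
Qed.

Lemma L2E f : L2 f <-> [/\ measurable_fun D (fun x => complex.Re (f x)),
  measurable_fun D (fun x => complex.Im (f x)) & Ig (fun x => sq (f x))].
Proof.
have msq : measurable_fun D (fun x => complex.Re (f x)) ->
    measurable_fun D (fun x => complex.Im (f x)) -> measurable_fun D (fun x => sq (f x)).
  by move=> m1 m2; apply: measurable_funD; apply: measurable_funX.
have E : L2norm f = sqrte (\int[mu]_(x in D) `|(sq (f x))%:E|)%E.
  rewrite /L2norm; congr sqrte; apply: eq_integral => x _.
  by rewrite sqE /= ger0_norm // sq_ge0.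
split=> [[m1 m2]|[m1 m2 hI]].
  rewrite E => h; split => //; apply/integrableP; split.
    by apply/measurable_EFinP; exact: msq.
  have H (y : \bar R) : (sqrte y < +oo -> y < +oo)%E.
    by case: y => //= r _; rewrite ltry.
  exact: H.
split => //; rewrite E; have /integrableP[_ /=] := hI.
have H (y : \bar R) : (y < +oo -> sqrte y < +oo)%E.
  by case: y => //= r _; rewrite ltry.
exact: H.
Qed.

Lemma L2normE f : L2 f -> L2norm f = (Num.sqrt (It (fun x => sq (f x))))%:E.
Proof.
move=> /L2E[_ _ hI]; rewrite /L2norm.
have -> : (\int[mu]_(x in D) (normc (f x) ^+ 2)%:E = (It (fun x => sq (f x)))%:E)%E.
  rewrite /It /Rintegral fineK; last exact: (integrable_fin_num mtorus hI).
  by apply: eq_integral => x _; rewrite sqE.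
by [].
Qed.

Lemma L2_CI f : L2 f -> CI f.
Proof.
move=> /L2E[m1 m2 hI]; have h := IgD (Ig_cst 1) hI.
have E (x y : R) : `|x| <= 1 + (x ^+ 2 + y ^+ 2).
  rewrite -(real_normK (num_real x)); have := sqr_ge0 y; have := normr_ge0 x.
  by have := sqr_ge0 (`|x| - 1); nra.
split; [apply: (Ig_le m1 h) | apply: (Ig_le m2 h)] => x _; first exact: E.
by have := E (complex.Im (f x)) (complex.Re (f x)); rewrite /sq; lra.
Qed.

Lemma L2D f g : L2 f -> L2 g -> L2 (fun x => f x + g x).
Proof.
move=> /L2E[f1 f2 fI] /L2E[g1 g2 gI].
have m1 : measurable_fun D (fun x => complex.Re (f x + g x)).
  by under eq_fun do rewrite raddfD; exact: measurable_funD.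
have m2 : measurable_fun D (fun x => complex.Im (f x + g x)).
  by under eq_fun do rewrite raddfD; exact: measurable_funD.
apply/L2E; split => //.
apply: Ig_le (IgD (IgZ 2 fI) (IgZ 2 gI)) _.
  by apply: measurable_funD; apply: measurable_funX.
by move=> x _; rewrite ger0_norm ?sq_ge0 // sqD2.
Qed.

Lemma L2Z (z : R[i]) f : L2 f -> L2 (fun x => z * f x).
Proof.
move=> hf; have [h1 h2] := CIZ z (L2_CI hf); have /L2E[_ _ fI] := hf.
apply/L2E; split; [exact: Ig_meas | exact: Ig_meas |].
by under eq_fun do rewrite sqM; exact: IgZ.
Qed.

Lemma L2B f g : L2 f -> L2 g -> L2 (fun x => f x - g x).
Proof.
move=> hf hg; have := L2D hf (L2Z (-1) hg); congr L2.
by apply/funext => x; rewrite mulN1r.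
Qed.

Lemma ccont_L2 f : ccont f -> L2 f.
Proof.
move=> [h1 h2]; apply/L2E; split; [exact: cont_meas | exact: cont_meas |].
apply: Ig_cont; apply: contD; under eq_fun do rewrite expr2; exact: contM.
Qed.

Lemma L2_sum (I : Type) (r : seq I) (F : I -> R -> R[i]) : (forall i, L2 (F i)) ->
  L2 (fun x => \sum_(i <- r) F i x).
Proof.
move=> H; elim: r => [|i r IH].
  rewrite (_ : (fun x => _) = fun=> 0); first by apply: ccont_L2; exact: ccont_cst.
  by apply/funext => x; rewrite big_nil.
rewrite (_ : (fun x => _) = fun x => F i x + \sum_(j <- r) F j x); last first.
  by apply/funext => x; rewrite big_cons.
exact: L2D.
Qed.

Lemma conj_expi (x : R) : conjc (expi x) = expi (- x).
Proof. by rewrite /expi /= cosN sinN. Qed.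

Lemma conj_sum (I : Type) (r : seq I) (F : I -> R[i]) :
  conjc (\sum_(i <- r) F i) = \sum_(i <- r) conjc (F i).
Proof.
apply: (big_morph (@conjc R)) => [x y|]; last by apply: complex_eq; rewrite /= ?oppr0.
by case: x => ? ?; case: y => ? ?; apply: complex_eq; rewrite //= opprD.
Qed.

Lemma conjM (z w : R[i]) : conjc (z * w) = conjc z * conjc w.
Proof. by case: z => ? ?; case: w => ? ?; apply: complex_eq => /=; ring. Qed.

Lemma It_pair f n c : CI f ->
  Ig (fun x => complex.Re (f x * conjc (Tp n c x))) /\
  It (fun x => complex.Re (f x * conjc (Tp n c x))) =
  2 * pi * \sum_(k <- zs n) complex.Re (fourier f k * conjc (c k)).
Proof.
move=> hf.
have E x : f x * conjc (Tp n c x) = \sum_(k <- zs n) conjc (c k) * (f x * expi (- k%:~R * x)).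
  rewrite /Tp conj_sum mulr_sumr; apply: eq_bigr => k _.
  have -> : conjc (c k * expi (k%:~R * x)) = conjc (c k) * expi (- k%:~R * x).
    by rewrite mulNr -conj_expi conjM.
  by ring.
have hE : CI (fun x => f x * conjc (Tp n c x)).
  by under eq_fun do rewrite E; apply: CI_sum => k; apply: CIZ; exact: CI_expi.
split; first by case: hE.
have -> : It (fun x => complex.Re (f x * conjc (Tp n c x))) = complex.Re (Ci (fun x => f x * conjc (Tp n c x))).
  by [].
under [Ci _]Ci_eq do rewrite E.
rewrite Ci_sum; last by move=> k; apply: CIZ; exact: CI_expi.
rewrite raddf_sum mulr_sumr; apply: eq_bigr => k _.
rewrite CiZ; last exact: CI_expi.
have -> : Ci (fun x => f x * expi (- k%:~R * x)) = (2 * pi)%:C * fourier f k.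
  by rewrite fourierE mulrA (mulrC (2 * pi)%:C) twopi_unit mul1r.
by rewrite (mulrCA (conjc (c k))) -[LHS]/(complex.Re _) Re_scale (mulrC (conjc _)).
Qed.

Lemma sqB_pair (z w : R[i]) : sq (z - w) = sq z - 2 * complex.Re (z * conjc w) + sq w.
Proof. by case: z => a b; case: w => p q; rewrite /sq /=; ring. Qed.

Lemma sq_conj (z : R[i]) : complex.Re (z * conjc z) = sq z.
Proof. by case: z => a b; rewrite /sq /=; ring. Qed.

Lemma It_sq_Tp n c : It (fun x => sq (Tp n c x)) = 2 * pi * \sum_(k <- zs n) sq (c k).
Proof.
have [_ H] := It_pair n c (ccont_CI (ccont_Tp n c)).
under It_eq do rewrite -sq_conj.
rewrite H; congr (_ * _); rewrite big_seq [RHS]big_seq; apply: eq_bigr => k.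
by rewrite mem_zs fourier_Tp /Pn => ->; rewrite sq_conj.
Qed.

Lemma pythagoras f n : L2 f -> It (fun x => sq (f x - Tp n (fourier f) x)) =
  It (fun x => sq (f x)) - 2 * pi * \sum_(k <- zs n) sq (fourier f k).
Proof.
move=> hf; have /L2E[_ _ fI] := hf.
have [h1 h2] := It_pair n (fourier f) (L2_CI hf).
have /L2E[_ _ tI] := ccont_L2 (ccont_Tp n (fourier f)).
under It_eq do rewrite sqB_pair.
rewrite ItD //; last by apply: IgB => //; exact: IgZ.
rewrite ItB //; last exact: IgZ.
rewrite ItZ // h2 It_sq_Tp; under [X in 2 * (_ * X)]eq_bigr do rewrite sq_conj.
ring.
Qed.

Lemma bessel f : L2 f -> hq 0 (fourier f) ((2 * pi)^-1 * It (fun x => sq (f x))).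
Proof.
move=> hf n; under eq_bigr do rewrite wn0 mul1r.
have : 0 <= It (fun x => sq (f x - Tp n (fourier f) x)).
  by apply: It_ge0 => x _; exact: sq_ge0.
rewrite (pythagoras n hf) subr_ge0 => h.
by rewrite mulrC ler_pdivlMr ?pi2_gt0 // mulrC.
Qed.

End ComplexIntegral.

(** * Fejer means and injectivity of the Fourier coefficients *)

Section Uniqueness.
Context {R : realType}.
Local Notation mu := (@lebesgue_measure R).
Local Notation D := (@torus R).

Lemma Ci_real (r : R -> R) : Ci (fun x => (r x)%:C) = (It r)%:C.
Proof.
apply: complex_eq; rewrite /= -/(It _) //.
by rewrite It_cst mul0r.
Qed.

(** The Fejer kernel with total integral [2 * pi]. Written as a square modulus it is visibly
    nonnegative. *)
Definition fejer (n : nat) (x : R) : R :=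
  n.+1%:R^-1 * sq (\sum_(j < n.+1) expi (j%:R * x)).

Lemma sq_mul_conj (z : R[i]) : (sq z)%:C = z * conjc z.
Proof. by case: z => a b; apply: complex_eq; rewrite /sq /=; ring. Qed.

Lemma fejerE n x : (fejer n x)%:C = n.+1%:R^-1%:C *
  \sum_(j < n.+1) \sum_(l < n.+1) expi ((j%:Z - l%:Z)%:~R * x).
Proof.
rewrite /fejer rmorphM /=; congr (_ * _).
rewrite sq_mul_conj conj_sum mulr_suml; apply: eq_bigr => j _.
rewrite mulr_sumr; apply: eq_bigr => l _.
by rewrite conj_expi -expiD -mulNr -mulrDl rmorphB.
Qed.

Lemma fejer_ge0 n x : 0 <= fejer n x.
Proof. by rewrite mulr_ge0 ?invr_ge0 ?sq_ge0. Qed.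

Lemma sq_expi_sub1_cos (x : R) : sq (expi x - 1) = 2 - 2 * cos x.
Proof. by rewrite /sq /= subr0; have := cos2Dsin2 x; lra. Qed.

(** Multiplication by [expi x - 1] telescopes the geometric sum to [expi ((n + 1) x) - 1], which is
    bounded. Away from multiples of [2 * pi] only the factor [1 / (n + 1)] is left. *)
Lemma fejer_far n (x rho : R) : rho < 1 -> cos x <= rho ->
  fejer n x <= n.+1%:R^-1 * (4 / (2 - 2 * rho)).
Proof.
move=> r1 cx; have rp : 0 < 2 - 2 * rho by lra.
rewrite /fejer ler_wpM2l ?invr_ge0 // ler_pdivlMr //.
have geo m : (\sum_(j < m) expi (j%:R * x)) * (expi x - 1) = expi (m%:R * x) - 1.
  elim: m => [|m IH]; first by rewrite big_ord0 mul0r mul0r expi0 subrr.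
  rewrite big_ord_recr mulrDl IH -natr1 mulrDl mul1r expiD; ring.
apply: le_trans (sq_expi_sub1_le4 (n.+1%:R * x)); rewrite -geo sqM ler_wpM2l ?sq_ge0 //.
rewrite sq_expi_sub1_cos; lra.
Qed.

Lemma cos_far (d t : R) : 0 < d -> d <= pi -> d <= t -> t <= 2 * pi - d -> cos t <= cos d.
Proof.
move=> d0 dpi dt t2.
have pp := @pi_gt0 R.
have H (s : R) : d <= s -> s <= pi -> cos s <= cos d.
  rewrite le_eqVlt => /orP[/eqP -> //|ds] sp; apply: ltW.
  by rewrite ltr_cos // in_itv /=; apply/andP; split; lra.
have [tp|tp] := leP t pi; first exact: H.
have -> : cos t = cos (2 * pi - t).
  by rewrite -cosN -(cosD2pi (- t)); congr cos; rewrite -[pi *+ 2]mulr_natl; ring.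
by apply: H; lra.
Qed.

Lemma cos_lt1_pi (d : R) : 0 < d -> d <= pi -> cos d < 1.
Proof.
move=> d0 dpi.
have h0 : (0 : R) \in `[0, pi] by rewrite in_itv /= lexx pi_ge0.
have hd : d \in `[0, pi] by rewrite in_itv /= (ltW d0).
by rewrite -(@cos0 R) ltr_cos.
Qed.

Section Kernel.
Variables (w : R -> R).
Hypothesis hw : Ig w.

Let CIw : CI (fun y => (w y)%:C).
Proof. by split => /=; [exact: hw | exact: Ig_cst]. Qed.

Definition wfejer (n : nat) (x : R) : R := It (fun y => w y * fejer n (x - y)).

Lemma wfejerE n x : (wfejer n x)%:C = n.+1%:R^-1%:C *
  \sum_(j < n.+1) \sum_(l < n.+1) Ci (fun y => (w y)%:C * expi (- (j%:Z - l%:Z)%:~R * y)) *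
     expi ((j%:Z - l%:Z)%:~R * x).
Proof.
rewrite /wfejer -Ci_real.
rewrite (@Ci_eq _ _ (fun y => n.+1%:R^-1%:C * \sum_(j < n.+1) \sum_(l < n.+1)
   expi ((j%:Z - l%:Z)%:~R * x) * ((w y)%:C * expi (- (j%:Z - l%:Z)%:~R * y)))); last first.
  move=> y _; rewrite rmorphM /= fejerE mulrCA; congr (_ * _).
  rewrite mulr_sumr; apply: eq_bigr => j _; rewrite mulr_sumr; apply: eq_bigr => l _.
  by rewrite mulrBr expiD -mulNr; ring.
have H (j l : 'I_n.+1) : CI (fun y => expi ((j%:Z - l%:Z)%:~R * x) * ((w y)%:C * expi (- (j%:Z - l%:Z)%:~R * y))).
  by apply: CIZ; exact: CI_expi.
rewrite CiZ; last by apply: CI_sum => j; apply: CI_sum => l; exact: H.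
congr (_ * _); rewrite Ci_sum; last by move=> j; apply: CI_sum => l; exact: H.
apply: eq_bigr => j _; rewrite Ci_sum //; apply: eq_bigr => l _.
by rewrite CiZ ?(mulrC (expi _)) //; exact: CI_expi.
Qed.

Lemma Ig_wfejer n x : Ig (fun y => w y * fejer n (x - y)).
Proof.
have h : CI (fun y => (w y * fejer n (x - y))%:C).
  have -> : (fun y => (w y * fejer n (x - y))%:C) = (fun y => n.+1%:R^-1%:C * \sum_(j < n.+1) \sum_(l < n.+1)
   expi ((j%:Z - l%:Z)%:~R * x) * ((w y)%:C * expi (- (j%:Z - l%:Z)%:~R * y))).
    apply/funext => y; rewrite rmorphM /= fejerE mulrCA; congr (_ * _).
    rewrite mulr_sumr; apply: eq_bigr => j _; rewrite mulr_sumr; apply: eq_bigr => l _.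
    by rewrite mulrBr expiD -mulNr; ring.
  by apply: CIZ; apply: CI_sum => j; apply: CI_sum => l; apply: CIZ; exact: CI_expi.
by case: h.
Qed.

Lemma cont_wfejer n : continuous (wfejer n).
Proof.
have [h _] : ccont (fun x => (wfejer n x)%:C).
  under eq_fun do rewrite wfejerE.
  apply: ccontM; first exact: ccont_cst.
  apply: ccont_sum => j; apply: ccont_sum => l.
  by apply: ccontM; [exact: ccont_cst | exact: ccont_expi].
exact: h.
Qed.

Lemma wfejer_orth f n : CI f -> (forall k, fourier f k = 0) ->
  Ci (fun x => f x * (wfejer n x)%:C) = 0.
Proof.
move=> hf f0.
have z (k : int) : Ci (fun x => f x * expi (k%:~R * x)) = 0.
  have := f0 (- k); rewrite fourierE.
  rewrite (@Ci_eq _ _ (fun x => f x * expi (k%:~R * x))); last first.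
    by move=> x _; rewrite rmorphN /= opprK.
  move/eqP; rewrite mulf_eq0 => /orP[/eqP h|/eqP //].
  by have := @twopi_unit R; rewrite h mul0r => /eqP; rewrite eq_sym oner_eq0.
rewrite (@Ci_eq _ _ (fun x => n.+1%:R^-1%:C * \sum_(j < n.+1) \sum_(l < n.+1)
   Ci (fun y => (w y)%:C * expi (- (j%:Z - l%:Z)%:~R * y)) * (f x * expi ((j%:Z - l%:Z)%:~R * x)))); last first.
  move=> x _; rewrite wfejerE mulrCA; congr (_ * _).
  rewrite mulr_sumr; apply: eq_bigr => j _; rewrite mulr_sumr; apply: eq_bigr => l _.
  by rewrite mulrCA.
have H (j l : 'I_n.+1) : CI (fun x => Ci (fun y => (w y)%:C * expi (- (j%:Z - l%:Z)%:~R * y)) * (f x * expi ((j%:Z - l%:Z)%:~R * x))).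
  by apply: CIZ; exact: CI_expi.
rewrite CiZ; last by apply: CI_sum => j; apply: CI_sum => l; exact: H.
rewrite Ci_sum; last by move=> j; apply: CI_sum => l; exact: H.
rewrite big1 ?mulr0 // => j _; rewrite Ci_sum // big1 // => l _.
by rewrite CiZ ?z ?mulr0 //; exact: CI_expi.
Qed.

End Kernel.

Lemma wfejer1 n x : wfejer (fun=> 1) n x = 2 * pi.
Proof.
apply: (@complexI R); rewrite wfejerE; last exact: Ig_cst.
have E (j l : 'I_n.+1) : Ci (fun y => 1%:C * expi (- (j%:Z - l%:Z)%:~R * y)) * expi ((j%:Z - l%:Z)%:~R * x)
   = if j == l then (2 * pi)%:C else 0.
  rewrite (@Ci_eq _ _ (fun y => expi ((l%:Z - j%:Z)%:~R * y))); last first.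
    by move=> y _; rewrite mul1r -rmorphN opprB.
  rewrite Ci_expi subr_eq0 eqz_nat eq_sym -val_eqE; case: eqP => [->|_]; last by rewrite mul0r.
  by rewrite subrr mul0r expi0 mulr1.
under eq_bigr do under eq_bigr do rewrite E.
have -> : \sum_(j < n.+1) \sum_(l < n.+1) (if j == l then (2 * pi)%:C else 0) = n.+1%:R%:C * (2 * pi)%:C :> R[i].
  rewrite (eq_bigr (fun=> (2 * pi)%:C)); last first.
    by move=> j _; rewrite -big_mkcond (big_pred1 j) // => l; rewrite eq_sym.
  rewrite sumr_const card_ord; have E' (y : R) m : y%:C *+ m = m%:R%:C * y%:C.
    by rewrite -rmorphM mulr_natl rmorphMn.
  exact: E'.
by rewrite mulrA -rmorphM /= mulVf ?mul1r // pnatr_eq0.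
Qed.

Definition ind (b : R) : R -> R := fun y => (y < b)%R%:R.

Lemma meas_ind b : measurable_fun D (ind b).
Proof.
have -> : ind b = \1_(`]-oo, b[%classic : set R).
  by apply/funext => y; rewrite /ind indicE mem_setE in_itv.
by apply: measurable_funTS; apply: measurable_indic; exact: measurable_itv.
Qed.

Lemma ind01 b y : 0 <= ind b y <= 1.
Proof. by rewrite /ind; case: (y < b); rewrite ?lexx ler01. Qed.

Lemma Ig_ind b : Ig (ind b).
Proof.
apply: (Ig_bdd (B := 1)); first exact: meas_ind.
by move=> y _; have /andP[h0 h1] := ind01 b y; rewrite ger0_norm.
Qed.

Lemma wfejer_ind_bound b n x : 0 <= wfejer (ind b) n x /\ wfejer (ind b) n x <= 2 * pi.
Proof.
split.
  apply: It_ge0 => y _; have /andP[h0 h1] := ind01 b y.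
  by rewrite mulr_ge0 // fejer_ge0.
rewrite -(wfejer1 n x); apply: It_le; [exact: Ig_wfejer (Ig_ind b) n x|exact: Ig_wfejer (Ig_cst 1) n x|].
move=> y _; have /andP[h0 h1] := ind01 b y.
by rewrite ler_wpM2r ?fejer_ge0.
Qed.

(** The mass of the kernel on the wrong side of [b] is O(1/n). On the circle the indicator jumps at
    0 as well as at [b], so both points are excluded. *)
Lemma wfejer_ind_cvg b x : D x -> 0 < b -> b < 2 * pi -> x != 0 -> x != b ->
  exists C : R, forall n, `|wfejer (ind b) n x - 2 * pi * ind b x| <= n.+1%:R^-1 * C.
Proof.
rewrite /torus /= in_itv /= => /andP[x0 x2] b0 b2 xn0 xb.
have pp := @pi_gt0 R.
have {}x0 : 0 < x by rewrite lt_def xn0.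
have [lt_xb|lt_bx|eq_xb] := ltgtP x b; last by rewrite eq_xb eqxx in xb.
(* [b - x] is the direct distance to the points [y >= b], and [x] is the distance to them around the
   circle, through 0; [pi] keeps [d] where the cosine decreases. *)
- pose d := Num.min pi (Num.min (b - x) x).
  have d0 : 0 < d by rewrite !lt_min pp subr_gt0 lt_xb x0.
  have dpi : d <= pi by rewrite ge_min lexx.
  have dbx : d <= b - x by rewrite !ge_min lexx orbT.
  have dx : d <= x by rewrite !ge_min lexx !orbT.
  exists (2 * pi * (4 / (2 - 2 * cos d))) => n.
  rewrite {2}/ind lt_xb mulr1 -[X in `|_ - X|](wfejer1 n x) distrC /wfejer.
  have I1 := Ig_wfejer (Ig_cst 1) n x; have I2 := Ig_wfejer (Ig_ind b) n x.
  rewrite -ItB //.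
  have H y : D y -> 0 <= 1 * fejer n (x - y) - ind b y * fejer n (x - y) <= n.+1%:R^-1 * (4 / (2 - 2 * cos d)).
    rewrite /torus /= in_itv /= => /andP[y0 y2]; have F0 := fejer_ge0 n (x - y).
    rewrite /ind; have [yb|yb] := ltP y b.
      by rewrite subrr lexx /= mulr_ge0 ?divr_ge0 ?invr_ge0 //; have := cos_le1 d; lra.
    rewrite mul0r mul1r subr0 F0 /=; apply: fejer_far; first exact: cos_lt1_pi.
    by rewrite -opprB cosN; apply: cos_far => //; lra.
  rewrite ger0_norm; last by apply: It_ge0 => y /H /andP[].
  have -> : n.+1%:R^-1 * (2 * pi * (4 / (2 - 2 * cos d))) = n.+1%:R^-1 * (4 / (2 - 2 * cos d)) * (2 * pi) by ring.
  rewrite -It_cst; apply: It_le; [exact: IgB | exact: Ig_cst |].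
  by move=> y /H /andP[].
- pose d := Num.min pi (Num.min (x - b) (2 * pi - x)).
  have d0 : 0 < d by rewrite !lt_min pp !subr_gt0 lt_bx x2.
  have dpi : d <= pi by rewrite ge_min lexx.
  have dbx : d <= x - b by rewrite !ge_min lexx orbT.
  have dx : d <= 2 * pi - x by rewrite !ge_min lexx !orbT.
  exists (2 * pi * (4 / (2 - 2 * cos d))) => n.
  rewrite {2}/ind ltNge (ltW lt_bx) /= mulr0 subr0 /wfejer.
  have I2 := Ig_wfejer (Ig_ind b) n x.
  have H y : D y -> 0 <= ind b y * fejer n (x - y) <= n.+1%:R^-1 * (4 / (2 - 2 * cos d)).
    rewrite /torus /= in_itv /= => /andP[y0 y2]; have F0 := fejer_ge0 n (x - y).
    rewrite /ind; have [yb|yb] := ltP y b; last first.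
      by rewrite mul0r lexx /= mulr_ge0 ?divr_ge0 ?invr_ge0 //; have := cos_le1 d; lra.
    rewrite mul1r F0 /=; apply: fejer_far; first exact: cos_lt1_pi.
    by apply: cos_far => //; lra.
  rewrite ger0_norm; last by apply: It_ge0 => y /H /andP[].
  have -> : n.+1%:R^-1 * (2 * pi * (4 / (2 - 2 * cos d))) = n.+1%:R^-1 * (4 / (2 - 2 * cos d)) * (2 * pi) by ring.
  rewrite -It_cst; apply: It_le; [exact: I2 | exact: Ig_cst |].
  by move=> y /H /andP[].
Qed.

Lemma ae_neq (a : R) : {ae mu, forall x, x != a}.
Proof.
exists [set a]; split; [exact: measurable_set1 | exact: lebesgue_measure_set1 |].
by move=> x /= /negP; rewrite negbK => /eqP.
Qed.

Lemma ae_S2 (P Q S : R -> Prop) : (forall x, P x -> Q x -> S x) ->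
  {ae mu, forall x, P x} -> {ae mu, forall x, Q x} -> {ae mu, forall x, S x}.
Proof. by apply: filterS2; exact: (ae_filter_ringOfSetsType mu). Qed.

(** Dominated convergence: the Fejer means of the indicator are bounded by [2 * pi] and converge
    almost everywhere. *)
Lemma It_ind_fourier0 (g : R -> R) b : Ig g -> 0 < b -> b < 2 * pi ->
  (forall n, It (fun x => g x * wfejer (ind b) n x) = 0) -> It (fun x => g x * ind b x) = 0.
Proof.
move=> hg b0 b2 H.
have mg := Ig_meas hg.
have mw n : measurable_fun D (wfejer (ind b) n).
  by apply: cont_meas; apply: cont_wfejer; exact: Ig_ind.
pose F n x := (g x * wfejer (ind b) n x)%:E.
pose L x := (2 * pi * (g x * ind b x))%:E.
have [_ _ cv] : [/\ mu.-integrable D L,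
  [sequence (\int[mu]_(x in D) `|F n x - L x|)%E]_n @ \oo --> 0%E &
  [sequence (\int[mu]_(x in D) (F n x))%E]_n @ \oo --> (\int[mu]_(x in D) (L x))%E].
  apply: (@dominated_convergence _ _ _ mu D mtorus F L (fun x => (2 * pi * `|g x|)%:E)).
  - by move=> n; apply/measurable_EFinP; exact: (measurable_funM mg (mw n)).
  - apply/measurable_EFinP; apply: measurable_funM; first exact: measurable_cst.
    by apply: measurable_funM => //; exact: meas_ind.
  - apply: (ae_S2 _ (ae_neq b) (ae_neq 0)) => x xb x0 Dx.
    have [C HC] := wfejer_ind_cvg Dx b0 b2 x0 xb.
    apply: cvg_EFin; first by apply: nearW.
    have -> : 2 * pi * (g x * ind b x) = g x * (2 * pi * ind b x) by ring.
    apply: cvgM; first exact: cvg_cst.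
    apply/subr_cvg0; apply/norm_cvg0P.
    apply: (squeeze_cvgr _ (cvg_cst 0) (_ : (fun n => n.+1%:R^-1 * C) @ \oo --> 0)).
      by apply: nearW => n; rewrite normr_ge0 /= HC.
    by rewrite -[X in _ --> X](mul0r C); apply: cvgM; [exact: cvg_harmonic | exact: cvg_cst].
  - have h : Ig (fun x => `|g x|) by have := integrable_abse hg; rewrite /Ig.
    exact: (IgZ (2 * pi) h).
  - apply: aeW => x n Dx; rewrite /F /= lee_fin normrM mulrC ler_wpM2r //.
    by have [h1 h2] := wfejer_ind_bound b n x; rewrite ger0_norm.
have gi : Ig (fun x => g x * ind b x).
  apply: (Ig_mulb (B := 1)) hg (meas_ind b) _ => x _.
  by have /andP[h0 h1] := ind01 b x; rewrite ger0_norm.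
have Z n : (\int[mu]_(x in D) (F n x) = 0)%E.
  have gw : Ig (fun x => g x * wfejer (ind b) n x).
    apply: (Ig_mulb (B := 2 * pi)) hg (mw n) _ => x _.
    by have [h1 h2] := wfejer_ind_bound b n x; rewrite ger0_norm.
  have := H n; rewrite /It /Rintegral => h.
  by rewrite -[LHS]fineK; [rewrite h | exact: (integrable_fin_num mtorus gw)].
have lim0 : (\int[mu]_(x in D) (L x) = 0)%E.
  rewrite -(cvg_lim _ cv) //; under eq_fun do rewrite Z.
  by apply: cvg_lim => //; exact: cvg_cst.
have := congr1 fine lim0; rewrite -/(Rintegral mu D (fun x => 2 * pi * (g x * ind b x))) -/(It _) ItZ // => /eqP.
by rewrite mulf_eq0 gt_eqF ?pi2_gt0 //= => /eqP.
Qed.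

(** The primitive of [g] from 0 vanishes on the open interval, and by Lebesgue differentiation its
    derivative is [g] almost everywhere. *)
Lemma ae0_of_ind (g : R -> R) : Ig g ->
  (forall b, 0 < b -> b < 2 * pi -> It (fun x => g x * ind b x) = 0) ->
  {ae mu, forall x, D x -> g x = 0}.
Proof.
move=> hg H.
pose G := g \_ D.
have GI : mu.-integrable setT (EFin \o G).
  have := hg; rewrite /Ig integrable_mkcond; last exact: mtorus.
  by rewrite restrict_EFin.
have F0 b : 0 < b -> b < 2 * pi -> \int[mu]_(t in [set` Interval (BLeft 0) (BRight b)]) (G t) = 0.
  move=> b0 b2; rewrite -Rintegral_itv_bndo_bndc; last first.
    by apply: integrableS GI => //; exact: measurable_itv.
  rewrite -[RHS](H b b0 b2) /It Rintegral_mkcond [RHS]Rintegral_mkcond.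
  congr Rintegral; apply/funext => x; rewrite /G !patchE /ind.
  have -> : (x \in [set` Interval (BLeft 0) (BLeft b)]) = (0 <= x < b) by rewrite mem_setE in_itv.
  have -> : (x \in D) = (0 <= x < 2 * pi) by rewrite /torus mem_setE in_itv.
  have [x0|x0] //= := leP 0 x; have [xb|xb] := ltP x b.
    by rewrite (lt_trans xb b2) mulr1.
  by case: ifP; rewrite ?mulr0.
have loc : locally_integrable [set: R] G by apply: integrable_locally => //; exact: mtorus.
have := @FTC1 R G (BLeft 0) _ loc; have := ae_neq 0.
have intf y : mu.-integrable [set` Interval (BLeft 0) (BRight y)] (EFin \o G).
  by apply: integrableS GI => //; exact: measurable_itv.
move=> A1 /(_ intf) A2; apply: (ae_S2 _ A1 A2) => x x0 hx.
rewrite /torus /= in_itv /= => /andP[x0' x2].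
have {}x0 : 0 < x by rewrite lt_def x0.
have Gx : G x = g x by rewrite /G patchE mem_set // /torus /= in_itv /= x0' x2.
have [|_] := hx; first by rewrite /= lte_fin.
rewrite Gx => <-; rewrite derive1E.
rewrite (_ : 'D_1 _ x = 'D_1 (cst (0 : R)) x); first exact: derive_cst.
apply: near_eq_derive.
have : \forall y \near x, y \in `]0, 2 * pi[ by apply: near_in_itvoo; rewrite in_itv /= x0.
by apply: filterS => y; rewrite in_itv /= => /andP[y0 y2]; exact: F0.
Qed.

Theorem fourier_inj (f g : R -> R[i]) : L2 f -> L2 g -> (forall k, fourier f k = fourier g k) -> torus_eq f g.
Proof.
move=> hf hg fg.
have hd := CIB (L2_CI hf) (L2_CI hg).
have d0 k : fourier (fun x => f x - g x) k = 0.
  by rewrite fourierB ?fg ?subrr //; exact: L2_CI.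
have Z b : 0 < b -> b < 2 * pi -> It (fun x => complex.Re (f x - g x) * ind b x) = 0 /\
   It (fun x => complex.Im (f x - g x) * ind b x) = 0.
  move=> b0 b2; have [h1 h2] := hd; have := wfejer_orth (Ig_ind b) _ hd d0 => O.
  split; apply: It_ind_fourier0 => // n.
    have := congr1 (@complex.Re R) (O n); rewrite /= -/(It _) => E; rewrite -[RHS]E.
    by apply: It_eq => x _; rewrite mulrC -Re_scale mulrC.
  have := congr1 (@complex.Im R) (O n); rewrite /= -/(It _) => E; rewrite -[RHS]E.
  by apply: It_eq => x _; rewrite Im_mul /= mulr0 add0r.
have [h1 h2] := hd.
have A1 := ae0_of_ind h1 (fun b b0 b2 => (Z b b0 b2).1).
have A2 := ae0_of_ind h2 (fun b b0 b2 => (Z b b0 b2).2).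
apply: (ae_S2 _ A1 A2) => x r0 i0 Dx.
by apply/eqP; rewrite -subr_eq0; apply/eqP/complex_eq; [exact: r0 | exact: i0].
Qed.

Lemma torus_eq_fourier (f g : R -> R[i]) k : torus_eq f g -> CI f -> CI g -> fourier f k = fourier g k.
Proof.
move=> fg hf hg; rewrite !fourierE; congr (_ * _).
have [a1 a2] := CI_expi (- k%:~R) hf; have [b1 b2] := CI_expi (- k%:~R) hg.
congr (_ +i* _); rewrite /Rintegral; congr fine; apply: ae_eq_integral => //.
- exact: mtorus.
- exact: measurable_int a1.
- exact: measurable_int b1.
- by apply: (ae_S2 _ fg fg) => x /= h _ Dx; rewrite h.
- exact: mtorus.
- exact: measurable_int a2.
- exact: measurable_int b2.
- by apply: (ae_S2 _ fg fg) => x /= h _ Dx; rewrite h.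
Qed.

End Uniqueness.

(** * Uniformly convergent Fourier series and Parseval *)

Section Series.
Context {R : realType}.
Local Notation mu := (@lebesgue_measure R).
Local Notation D := (@torus R).
Implicit Types (f g : R -> R[i]) (c : int -> R[i]).

(** Weighted Cauchy-Schwarz by induction: Young's inequality with weight [A / al i] reproduces the
    product [(al i + A) * (be i + B)] exactly. *)
Lemma sq_sum_CS (I : Type) (r : seq I) (P : pred I) (F : I -> R[i]) (al be : I -> R) :
  (forall i, 0 < al i) -> (forall i, 0 <= be i) -> (forall i, sq (F i) <= al i * be i) ->
  sq (\sum_(i <- r | P i) F i) <= (\sum_(i <- r | P i) al i) * \sum_(i <- r | P i) be i.
Proof.
move=> a0 b0 H.
elim: r => [|i r IH]; first by rewrite !big_nil sq0 mul0r.
rewrite !big_cons; case: ifP => // _.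
set A := \sum_(j <- r | P j) al j in IH *; set B := \sum_(j <- r | P j) be j in IH *.
have A0 : 0 <= A by rewrite sumr_ge0 // => j _; exact: ltW.
have B0 : 0 <= B by rewrite sumr_ge0.
set z := \sum_(j <- r | P j) F j in IH *.
have [Az|Ap] := eqVneq A 0.
  move: IH; rewrite Az mul0r => /sq_le0 ->; rewrite !addr0.
  by apply: le_trans (H i) _; rewrite ler_wpM2l ?(ltW (a0 i)) // lerDl.
have {}Ap : 0 < A by rewrite lt_def Ap.
have t0 : 0 < A / al i by rewrite divr_gt0.
apply: le_trans (sqD_le _ _ t0) _.
apply: (@le_trans _ _ ((1 + A / al i) * (al i * be i) + (1 + (A / al i)^-1) * (A * B))).
  have p1 : 0 <= 1 + A / al i by rewrite addr_ge0 // ltW.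
  have p2 : 0 <= 1 + (A / al i)^-1 by rewrite addr_ge0 // invr_ge0 ltW.
  by apply: lerD; rewrite ler_wpM2l.
rewrite le_eqVlt; apply/orP; left; apply/eqP; field.
by rewrite !gt_eqF.
Qed.

Lemma zs_recr (f : int -> R) n : \sum_(k <- zs n.+1) f k =
  \sum_(k <- zs n) f k + (f n.+1%:Z + f (- n.+1%:Z)).
Proof.
rewrite (zs_split _ (leqnSn n)); congr (_ + _).
have p1 : n.+1%:Z \in zs n.+1 by rewrite mem_zs.
have p2 : - n.+1%:Z \in rem n.+1%:Z (zs n.+1).
  by rewrite mem_rem_uniq ?zs_uniq // inE mem_zs; apply/andP; split; [rewrite /=; lia | lia].
rewrite (perm_big _ (perm_to_rem p1)) big_cons /= ltnSn.
rewrite (perm_big _ (perm_to_rem p2)) big_cons.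
have -> : (n < `|(- n.+1%:Z)%R|)%N by lia.
rewrite big_seq_cond big1 => [|k /andP[]]; first by congr (_ + _); exact: addr0.
rewrite mem_rem_uniq ?rem_uniq ?zs_uniq // inE mem_rem_uniq ?zs_uniq // inE mem_zs.
move=> /andP[h1 /andP[h2 h3]] h4; lia.
Qed.

Lemma sum_inv_wn n : \sum_(k <- zs n) (wn 1 k)^-1 <= 6 :> R.
Proof.
(* The subtracted term makes the induction close: the two new terms, [2 / (1 + (n + 1)^2)], are at
   most [4 / (n + 1) - 4 / (n + 2)]. *)
have H : \sum_(k <- zs n) (wn 1 k)^-1 <= 6 - 4 / n.+1%:R :> R.
  elim: n => [|n IH].
    by rewrite /zs /= big_seq1 subrr /wn expr1 expr0n addr0 invr1; lra.
  rewrite zs_recr; apply: le_trans (lerD IH (lexx _)) _.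
  rewrite /wn !expr1 rmorphN /= sqrrN.
  have -> : n.+1%:~R = n%:R + 1 :> R by rewrite -[LHS]/(n.+1%:R : R) -natr1.
  have -> : n.+2%:R = n%:R + 2 :> R by rewrite -!natr1; ring.
  have -> : n.+1%:R = n%:R + 1 :> R by rewrite -natr1.
  have x0 : 0 <= n%:R :> R by [].
  move: (n%:R) x0 => x x0; rewrite -subr_ge0.
  have -> : 6 - 4 / (x + 2) - (6 - 4 / (x + 1) + ((1 + (x + 1) ^+ 2)^-1 + (1 + (x + 1) ^+ 2)^-1)) =
    (2 * x ^+ 2 + 2 * x + 4) / ((x + 1) * (x + 2) * (1 + (x + 1) ^+ 2)).
    by field; rewrite !gt_eqF //; nra.
  apply: divr_ge0; first by nra.
  by rewrite !mulr_ge0 //; nra.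
by apply: le_trans H _; rewrite gerBl divr_ge0.
Qed.

Lemma Tp_tail c n m (x : R) : (n <= m)%N -> sq (Tp m c x - Tp n c x) <=
  6 * \sum_(k <- zs m | (n < `|k|)%N) wn 1 k * sq (c k).
Proof.
move=> nm; rewrite /Tp (zs_split _ nm) [X in X - _]addrC addrK.
have w0 (k : int) : 0 < (wn 1 k)^-1 :> R by rewrite invr_gt0 (lt_le_trans ltr01) ?wn_ge1.
have h k : sq (c k * expi (k%:~R * x)) <= (wn 1 k)^-1 * (wn 1 k * sq (c k)).
  by rewrite sqM sq_expi mulr1 mulKf // gt_eqF // (lt_le_trans ltr01) ?wn_ge1.
apply: le_trans (sq_sum_CS _ _ w0 (fun k => wsq_ge0 1 k (c k)) h) _.
rewrite ler_wpM2r ?sumr_ge0 // => [k _|]; first exact: wsq_ge0.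
apply: le_trans (sum_inv_wn m); rewrite (zs_split _ nm) lerDr sumr_ge0 // => k _.
exact: ltW.
Qed.

Lemma Tp_bound c n X (x : R) : hq 1 c X -> sq (Tp n c x) <= 6 * X.
Proof.
move=> h.
have w0 (k : int) : 0 < (wn 1 k)^-1 :> R by rewrite invr_gt0 (lt_le_trans ltr01) ?wn_ge1.
have h' k : sq (c k * expi (k%:~R * x)) <= (wn 1 k)^-1 * (wn 1 k * sq (c k)).
  by rewrite sqM sq_expi mulr1 mulKf // gt_eqF // (lt_le_trans ltr01) ?wn_ge1.
apply: le_trans (sq_sum_CS _ xpredT w0 (fun k => wsq_ge0 1 k (c k)) h') _.
apply: ler_pM; rewrite ?sumr_ge0 ?sum_inv_wn // => k _; last exact: wsq_ge0.
exact: ltW.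
Qed.

Lemma complex_cauchy (z : nat -> R[i]) :
  (forall e : R, 0 < e -> exists n0, forall n, (n0 <= n)%N -> sq (z n - z n0) <= e) ->
  cvg ((fun n => complex.Re (z n)) @ \oo) /\ cvg ((fun n => complex.Im (z n)) @ \oo).
Proof.
move=> H.
have G (p : nat -> R) : (forall n m, (p n - p m) ^+ 2 <= sq (z n - z m)) -> cvg (p @ \oo).
  move=> hp; apply: cauchy_cvg; apply: cauchy_exP => e e0.
  have e2 : 0 < e ^+ 2 / 2 by rewrite divr_gt0 // exprn_gt0.
  have [n0 Hn] := H _ e2; exists (p n0); exists n0 => // n /= mn; rewrite /ball /=.
  rewrite -ltr_sqr ?nnegrE ?normr_ge0 ?(ltW e0) // real_normK ?num_real //.
  rewrite -sqrrN opprB; apply: le_lt_trans (hp _ _) _; apply: le_lt_trans (Hn _ mn) _.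
  by rewrite ltr_pdivrMr // ltr_pMr ?exprn_gt0 // ltr1n.
split; apply: G => n m; rewrite /sq !raddfB; first by rewrite lerDl sqr_ge0.
by rewrite lerDr sqr_ge0.
Qed.

(** The embedding of h^1 in the bounded functions: the series converges uniformly, so its pointwise
    limit is a measurable bounded representative, with no appeal to completeness of L^2. *)
Lemma series_ex c X : hq 1 c X -> exists f, [/\ L2 f, fourier f =1 c,
  forall x, sq (f x) <= 6 * X &
  forall e : R, 0 < e -> exists n0, forall n, (n0 <= n)%N -> forall x, sq (Tp n c x - f x) <= e].
Proof.
move=> hc.
have cau (e : R) : 0 < e -> exists n0, forall n x, (n0 <= n)%N -> sq (Tp n c x - Tp n0 c x) <= e.
  move=> e0; have e6 : 0 < e / 6 by rewrite divr_gt0.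
  have [n0 H] := hq_tail hc e6; exists n0 => n x nn.
  by apply: le_trans (Tp_tail c x nn) _; rewrite mulrC -ler_pdivlMr.
have cv x := complex_cauchy (fun e e0 => let: ex_intro n0 H := cau e e0 in ex_intro _ n0 (fun n => H n x)).
pose f x := limn (fun n => complex.Re (Tp n c x)) +i* limn (fun n => complex.Im (Tp n c x)).
have fr x : (fun n => complex.Re (Tp n c x)) @ \oo --> complex.Re (f x) by exact: (cv x).1.
have fi x : (fun n => complex.Im (Tp n c x)) @ \oo --> complex.Im (f x) by exact: (cv x).2.
have sqlim z x (B : R) : (\forall n \near \oo, sq (z - Tp n c x) <= B) -> sq (z - f x) <= B.
  move=> H; have h : (fun n => sq (z - Tp n c x)) @ \oo --> sq (z - f x).
    apply: cvg_sq.
      rewrite raddfB [X in X @ _ --> _](_ : _ = fun n => complex.Re z - complex.Re (Tp n c x)).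
        by apply: cvgB; [exact: cvg_cst | exact: fr].
      by apply/funext => n; rewrite raddfB.
    rewrite raddfB [X in X @ _ --> _](_ : _ = fun n => complex.Im z - complex.Im (Tp n c x)).
      by apply: cvgB; [exact: cvg_cst | exact: fi].
    by apply/funext => n; rewrite raddfB.
  rewrite -(cvg_lim _ h) //; apply: limr_le => //; by apply/cvg_ex; eexists; exact: h.
have unif (e : R) : 0 < e -> exists n0, forall n, (n0 <= n)%N -> forall x, sq (Tp n c x - f x) <= e.
  move=> e0; have e4 : 0 < e / 4 by rewrite divr_gt0.
  have [n0 H] := cau _ e4; exists n0 => n nn x; apply: sqlim; exists n0 => // m /= mn.
  have -> : Tp n c x - Tp m c x = (Tp n c x - Tp n0 c x) - (Tp m c x - Tp n0 c x) by ring.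
  by apply: le_trans (sqB2 _ _) _; have := H n x nn; have := H m x mn; lra.
have bd x : sq (f x) <= 6 * X.
  rewrite -[f x]opprK sqN -[- f x]add0r; apply: sqlim; apply: nearW => n.
  by rewrite add0r sqN; exact: Tp_bound.
have L2f : L2 f.
  have m1 : measurable_fun D (fun x => complex.Re (f x)).
    apply: (measurable_fun_cvg (h := fun n x => complex.Re (Tp n c x))) => [n|x _].
      by apply: cont_meas; have [] := ccont_Tp n c.
    exact: fr.
  have m2 : measurable_fun D (fun x => complex.Im (f x)).
    apply: (measurable_fun_cvg (h := fun n x => complex.Im (Tp n c x))) => [n|x _].
      by apply: cont_meas; have [] := ccont_Tp n c.
    exact: fi.
  apply/L2E; split => //; apply: (Ig_bdd (B := 6 * X)).
    by apply: measurable_funD; apply: measurable_funX.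
  by move=> x _; rewrite ger0_norm ?sq_ge0.
exists f; split => // k.
apply/eqP; rewrite -subr_eq0; apply/eqP/sq_le0/ler_addgt0Pr => e e0; rewrite add0r.
have [n0 H] := unif e e0.
pose n := maxn n0 `|k|.
have Tn := ccont_L2 (ccont_Tp n c).
have := hq_term k (bessel (L2B Tn L2f)).
rewrite wn0 mul1r fourierB; [|exact: L2_CI..].
rewrite fourier_Tp /Pn leq_maxr -sqN opprB => h; apply: le_trans h _.
rewrite mulrC ler_pdivrMr ?pi2_gt0 // -It_cst.
have /L2E[_ _ I] := L2B Tn L2f.
by apply: It_le => // [|x _]; [exact: Ig_cst | exact: H (leq_maxl _ _) x].
Qed.

Lemma torus_eq_It f g : torus_eq f g -> L2 f -> L2 g ->
  It (fun x => sq (f x)) = It (fun x => sq (g x)).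
Proof.
move=> fg /L2E[_ _ If] /L2E[_ _ Ig'].
rewrite /It /Rintegral; congr fine; apply: ae_eq_integral.
- exact: mtorus.
- exact: measurable_int If.
- exact: measurable_int Ig'.
- by apply: (ae_S2 _ fg fg) => x /= h _ Dx; rewrite h.
Qed.

(** The converse of [bessel]. The h^1 bound supplies a uniformly convergent series, equal to [f]
    almost everywhere by injectivity, and for it the remainder in [pythagoras] tends to 0. *)
Lemma parseval_le f X Y : L2 f -> hq 1 (fourier f) X -> hq 0 (fourier f) Y ->
  It (fun x => sq (f x)) <= 2 * pi * Y.
Proof.
move=> hf hX hY.
have [g [hg gc _ gu]] := series_ex hX.
rewrite (torus_eq_It (fourier_inj hf hg (fun k => esym (gc k))) hf hg).
apply/ler_addgt0Pr => e e0.
have e1 : 0 < e / (2 * pi) by rewrite divr_gt0 ?pi2_gt0.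
have [n H] := gu _ e1.
have := pythagoras n hg.
have -> : fourier g = fourier f by apply/funext.
have : It (fun x => sq (g x - Tp n (fourier f) x)) <= e.
  have -> : e = e / (2 * pi) * (2 * pi) by rewrite divfK // gt_eqF ?pi2_gt0.
  rewrite -It_cst; apply: It_le; [|exact: Ig_cst|].
    by have /L2E[] := L2B hg (ccont_L2 (ccont_Tp n (fourier f))).
  by move=> x _; rewrite -sqN opprB H.
have h : 2 * pi * \sum_(k <- zs n) sq (fourier f k) <= 2 * pi * Y.
  rewrite ler_wpM2l ?(ltW pi2_gt0) //; have := hY n.
  by under eq_bigr do rewrite wn0 mul1r.
lra.
Qed.

(* The value is 0 when no L^2 function has coefficients [c]. *)
Definition synth c : R -> R[i] := xget (fun=> 0) [set g | L2 g /\ forall k, fourier g k = c k].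

Lemma synthP c X : hq 1 c X -> L2 (synth c) /\ forall k, fourier (synth c) k = c k.
Proof.
move=> /series_ex[g [hg gc _ _]].
by have := @xgetPex _ (fun=> 0) [set g | L2 g /\ forall k, fourier g k = c k] (ex_intro _ g (conj hg gc)).
Qed.

Lemma multiplierE m f : multiplier m f = synth (fun k => m k * fourier f k).
Proof. by []. Qed.

End Series.

(** * The nonlinearity on trigonometric polynomials *)

Section Nonlinear.
Context {R : realType}.
Local Notation mu := (@lebesgue_measure R).
Local Notation D := (@torus R).
Implicit Types (f g : R -> R[i]) (a b c : int -> R[i]).

Definition cder f g : Prop := forall x : R,
  is_derive x 1 (fun y => complex.Re (f y)) (complex.Re (g x)) /\
  is_derive x 1 (fun y => complex.Im (f y)) (complex.Im (g x)).

Lemma cder_cst (z : R[i]) : cder (fun=> z) (fun=> 0).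
Proof. by move=> x; split; exact: is_derive_cst. Qed.

Lemma cderD f f1 g g1 : cder f f1 -> cder g g1 -> cder (fun x => f x + g x) (fun x => f1 x + g1 x).
Proof.
move=> hf hg x; have [a1 a2] := hf x; have [b1 b2] := hg x; rewrite !raddfD; split.
  by under eq_fun do rewrite raddfD; exact: rderiv_add.
by under eq_fun do rewrite raddfD; exact: rderiv_add.
Qed.

Lemma rderiv_sub (u v : R -> R) (x du dv : R) : is_derive x 1 u du -> is_derive x 1 v dv ->
  is_derive x 1 (fun y => u y - v y) (du - dv).
Proof. by move=> hu hv; exact: is_deriveB hu hv. Qed.

Lemma cderM f f1 g g1 : cder f f1 -> cder g g1 ->
  cder (fun x => f x * g x) (fun x => f1 x * g x + f x * g1 x).
Proof.
move=> hf hg x; have [a1 a2] := hf x; have [b1 b2] := hg x; rewrite !raddfD /=; split.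
  under eq_fun do rewrite Re_mul; rewrite !Re_mul.
  have := rderiv_sub (rderiv_mul a1 b1) (rderiv_mul a2 b2); congr is_derive; ring.
under eq_fun do rewrite Im_mul; rewrite !Im_mul.
have := rderiv_add (rderiv_mul a1 b2) (rderiv_mul a2 b1); congr is_derive; ring.
Qed.

Lemma cder_sum (I : Type) (r : seq I) (F F1 : I -> R -> R[i]) : (forall i, cder (F i) (F1 i)) ->
  cder (fun x => \sum_(i <- r) F i x) (fun x => \sum_(i <- r) F1 i x).
Proof.
move=> H; elim: r => [|i r IH].
  have E (G : I -> R -> R[i]) : (fun x => \sum_(i <- [::]) G i x) = fun=> 0.
    by apply/funext => x; rewrite big_nil.
  by rewrite !E; exact: cder_cst.
have E (G : I -> R -> R[i]) : (fun x => \sum_(j <- i :: r) G j x) = fun x => G i x + \sum_(j <- r) G j x.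
  by apply/funext => x; rewrite big_cons.
by rewrite !E; exact: cderD.
Qed.

Lemma cder_expi (al : R) : cder (fun x => expi (al * x)) (fun x => (0 +i* al) * expi (al * x)).
Proof.
move=> x; rewrite Re_mul Im_mul /= !mul0r !add0r; split.
  exact: is_derive_cosM.
exact: is_derive_sinM.
Qed.

Definition ik c : int -> R[i] := fun k => (0 +i* k%:~R) * c k.

Lemma cder_Tp n c : cder (Tp n c) (Tp n (ik c)).
Proof.
apply: cder_sum => k.
have := cderM (cder_cst (c k)) (cder_expi k%:~R); congr cder; apply/funext => x.
by rewrite /ik; ring.
Qed.

Lemma Tp_period n c : Tp n c (2 * pi) = Tp n c 0.
Proof.
apply: eq_bigr => k _; congr (_ * _); rewrite /expi mulr0 cos0 sin0.
by have [-> ->] := @cos_sin_int R k.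
Qed.

Lemma cder_ccont f g : cder f g -> ccont f.
Proof.
move=> h; split.
  exact: (derive_continuous (fun x => (h x).1)).
exact: (derive_continuous (fun x => (h x).2)).
Qed.

Lemma Ci_deriv0 f g : cder f g -> ccont g -> f (2 * pi) = f 0 -> Ci g = 0.
Proof.
move=> h [c1 c2] p; apply: complex_eq; rewrite /= -/(It _).
  by apply: (It_deriv0 (fun x => (h x).1)) => //; rewrite p.
by apply: (It_deriv0 (fun x => (h x).2)) => //; rewrite p.
Qed.

Lemma fourier_deriv f g k : cder f g -> ccont g -> f (2 * pi) = f 0 ->
  fourier g k = ik (fourier f) k.
Proof.
move=> h cg p; have cf := cder_ccont h.
have := Ci_deriv0 (cderM h (cder_expi (- k%:~R))).
have ce := ccont_expi (- k%:~R : R).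
have c1 : ccont (fun x => (0 +i* - k%:~R) * expi (- k%:~R * x) : R[i]).
  by apply: ccontM => //; exact: ccont_cst.
rewrite (@CiD _ (fun x => g x * expi (- k%:~R * x)) (fun x => f x * ((0 +i* - k%:~R) * expi (- k%:~R * x))));
  [|exact: ccont_CI (ccontM cg ce)|exact: ccont_CI (ccontM cf c1)].
rewrite (@Ci_eq _ (fun x => f x * ((0 +i* - k%:~R) * expi (- k%:~R * x)))
   (fun x => (0 +i* - k%:~R) * (f x * expi (- k%:~R * x)))); last by move=> x _; rewrite mulrCA.
rewrite CiZ; last exact: ccont_CI (ccontM cf ce).
have ep : expi (- k%:~R * (2 * pi)) = expi (- k%:~R * 0) :> R[i].
  by rewrite /expi mulr0 cos0 sin0 mulNr cosN sinN; have [-> ->] := @cos_sin_int R k; rewrite oppr0.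
have cc : ccont (fun x => g x * expi (- k%:~R * x) + f x * ((0 +i* - k%:~R) * expi (- k%:~R * x))).
  by apply: ccontD; apply: ccontM.
move=> /(_ cc); rewrite p ep => /(_ erefl) E.
rewrite /ik !fourierE.
have -> : Ci (fun x => g x * expi (- k%:~R * x)) = - ((0 +i* - k%:~R) * Ci (fun x => f x * expi (- k%:~R * x))).
  by apply/eqP; rewrite -subr_eq0 opprK E.
have -> : 0 +i* - k%:~R = - (0 +i* k%:~R) :> R[i] by rewrite /GRing.opp /= oppr0.
ring.
Qed.

Definition rip (z w : R[i]) : R := complex.Re z * complex.Re w + complex.Im z * complex.Im w.

Lemma sq_rip (z w : R[i]) (t : R) : sq (z + t%:C * w) = sq z + 2 * t * rip z w + t ^+ 2 * sq w.
Proof. by case: z => p q; case: w => r s; rewrite /sq /rip /=; ring. Qed.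

Lemma rip_le (z w : R[i]) : `|rip z w| <= (sq z + sq w) / 2.
Proof.
case: z => p q; case: w => r s; rewrite /rip /sq /= ler_norml.
have := sqr_ge0 (p - r); have := sqr_ge0 (q - s); have := sqr_ge0 (p + r); have := sqr_ge0 (q + s).
by move=> *; apply/andP; split; lra.
Qed.

Lemma d_sq f g (x : R) : cder f g -> is_derive x 1 (fun y => sq (f y)) (2 * rip (f x) (g x)).
Proof.
move=> h; have [h1 h2] := h x.
have := rderiv_add (rderiv_mul h1 h1) (rderiv_mul h2 h2); rewrite /sq; under eq_fun do rewrite -!expr2.
by congr is_derive; rewrite /rip; ring.
Qed.

Lemma cont_sq f : ccont f -> continuous (fun x => sq (f x)).
Proof. by move=> [h1 h2]; apply: contD; under eq_fun do rewrite expr2; exact: contM. Qed.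

Lemma cont_rip f g : ccont f -> ccont g -> continuous (fun x => rip (f x) (g x)).
Proof. by move=> [h1 h2] [g1 g2]; apply: contD; exact: contM. Qed.

(** [|z|^2 - |w|^2] is the real inner product of [z - w] and [z + w]; then Cauchy-Schwarz and the
    parallelogram law. *)
Lemma sqB_le (z w : R[i]) : (sq z - sq w) ^+ 2 <= sq (z - w) * (2 * sq z + 2 * sq w).
Proof.
case: z => p q; case: w => r s; rewrite /sq /=.
have -> : p ^+ 2 + q ^+ 2 - (r ^+ 2 + s ^+ 2) = (p - r) * (p + r) + (q - s) * (q + s) by ring.
set x := p - r; set y := q - s.
have -> : 2 * (p ^+ 2 + q ^+ 2) + 2 * (r ^+ 2 + s ^+ 2) =
  ((p + r) ^+ 2 + (q + s) ^+ 2) + (x ^+ 2 + y ^+ 2) by rewrite /x /y; ring.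
set u := p + r; set v := q + s.
have -> : (x ^+ 2 + y ^+ 2) * ((u ^+ 2 + v ^+ 2) + (x ^+ 2 + y ^+ 2)) =
  (x * u + y * v) ^+ 2 + ((x * v - y * u) ^+ 2 + (x ^+ 2 + y ^+ 2) ^+ 2) by ring.
by rewrite lerDl addr_ge0 ?sqr_ge0.
Qed.

Section Power.
Variable sigma : R.
Hypothesis hsigma : 1 <= sigma.

(** Mean value theorem, with a derivative bounded near 0 because [sigma >= 1]. At [x = 0] the power
    rule is replaced by [y^sigma = y * y^(sigma - 1)]. *)
Lemma powR_lip (B x y : R) : 0 <= x -> x <= B -> 0 <= y -> y <= B ->
  `|x `^ sigma - y `^ sigma| <= sigma * B `^ (sigma - 1) * `|x - y|.
Proof.
have hs := hsigma.
wlog xy : x y / x <= y => [H|] x0 xB y0 yB.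
  have [xy|/ltW xy] := leP x y; first exact: H.
  by rewrite distrC (distrC x); exact: H.
have B0 : 0 <= B `^ (sigma - 1) by exact: powR_ge0.
have mono z : 0 <= z -> z <= B -> z `^ (sigma - 1) <= B `^ (sigma - 1).
  by move=> z0 zB; apply: ge0_ler_powR; rewrite ?nnegrE ?subr_ge0 // (le_trans z0).
rewrite distrC (distrC x) (ger0_norm (_ : 0 <= y - x)) ?subr_ge0 //.
rewrite ger0_norm; last first.
  by rewrite subr_ge0; apply: ge0_ler_powR; rewrite ?nnegrE //; lra.
have [->|xn0] := eqVneq x 0.
  rewrite powR0 ?subr0; last by rewrite gt_eqF //; lra.
  rewrite -mulr_powRB1 //; last by lra.
  rewrite mulrC ler_wpM2r //; apply: le_trans (mono y y0 yB) _.
  by rewrite -[leLHS]mul1r ler_wpM2r.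
have {}x0 : 0 < x by rewrite lt_def xn0.
have dp (z : R) : 0 < z -> is_derive z 1 (fun t : R => t `^ sigma) (sigma * z `^ (sigma - 1)).
  by move=> z0; exact: is_derive1_powR.
have H1 (z : R) : z \in `]x, y[ -> is_derive z 1 (fun t : R => t `^ sigma) (sigma * z `^ (sigma - 1)).
  by rewrite in_itv /= => /andP[xz _]; apply: dp; exact: lt_trans xz.
have H2 : {within `[x, y], continuous (fun z : R => z `^ sigma)}.
  apply: derivable_within_continuous => z; rewrite in_itv /= => /andP[xz _].
  by have [] := dp z (lt_le_trans x0 xz).
have [z] := MVT_segment xy H1 H2; rewrite in_itv /= => /andP[xz zy] ->.
rewrite ler_wpM2r ?subr_ge0 // ler_wpM2l //; first by lra.
by apply: mono; [exact: ltW (lt_le_trans x0 xz) | exact: le_trans zy yB].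
Qed.

(* [gd d |u|^2] regularizes [|u|^(2 sigma)], which is [gd 0 |u|^2]. *)
Definition gd (d s : R) : R := (s + d) `^ sigma.

Section Bounds.
Variables (S : R).
Hypothesis S0 : 0 <= S.
Let L := sigma * (S + 1) `^ (sigma - 1).
Let G := (S + 1) `^ sigma.

Lemma L_ge0 : 0 <= L.
Proof. by have hs := hsigma; rewrite /L mulr_ge0 ?powR_ge0 //; lra. Qed.

Lemma gd_ge0 d s : 0 <= gd d s. Proof. exact: powR_ge0. Qed.

Lemma gd_le d s : 0 <= d -> d <= 1 -> 0 <= s -> s <= S -> gd d s <= G.
Proof.
move=> d0 d1 s0 sS; have hs := hsigma; have hS := S0.
by apply: ge0_ler_powR; rewrite ?nnegrE; lra.
Qed.

Lemma gd_lip d s t : 0 <= d -> d <= 1 -> 0 <= s -> s <= S -> 0 <= t -> t <= S ->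
  `|gd d s - gd d t| <= L * `|s - t|.
Proof.
move=> d0 d1 s0 sS t0 tS; have hS := S0.
have -> : s - t = (s + d) - (t + d) by ring.
by apply: powR_lip; lra.
Qed.

Lemma gd_near d s : 0 <= d -> d <= 1 -> 0 <= s -> s <= S -> `|gd d s - gd 0 s| <= L * d.
Proof.
move=> d0 d1 s0 sS; have hS := S0.
have {2}-> : d = `|(s + d) - (s + 0)| by rewrite addr0 addrC addKr ger0_norm.
by apply: powR_lip; lra.
Qed.

Definition gd' (d s : R) : R := sigma * (s + d) `^ (sigma - 1).

Lemma d_gd (d s : R) : 0 < d -> 0 <= s -> is_derive s 1 (gd d) (gd' d s).
Proof.
move=> d0 s0; have sd : 0 < s + d by rewrite ltr_wpDl.
have h : is_derive s 1 (fun y : R => y + d) 1.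
  by rewrite -[X in is_derive _ _ _ X](addr0 1); exact: (rderiv_add (is_derive_id s 1) (is_derive_cst d s 1)).
by have := @rderiv_comp R (fun t : R => t `^ sigma) (fun y => y + d) s _ _ (is_derive1_powR sigma sd) h; rewrite mulr1.
Qed.

Lemma gd'_bound d s : 0 <= d -> d <= 1 -> 0 <= s -> s <= S -> 0 <= gd' d s <= L.
Proof.
move=> d0 d1 s0 sS; have hs := hsigma; have hS := S0.
rewrite /gd' mulr_ge0 ?powR_ge0 //=; last by lra.
rewrite ler_wpM2l //; first by lra.
by apply: ge0_ler_powR; rewrite ?nnegrE; lra.
Qed.

End Bounds.

Lemma cont_gd' d f g : 0 < d -> cder f g -> continuous (fun x => gd' d (sq (f x))).
Proof.
move=> d0 h.
have sd x : 0 < sq (f x) + d by rewrite ltr_wpDl ?sq_ge0.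
apply: contM; first by move=> x; exact: cst_continuous.
apply: derive_continuous => x.
have h2 : is_derive x 1 (fun y => sq (f y) + d) (2 * rip (f x) (g x)).
  by rewrite -[X in is_derive _ _ _ X]addr0; exact: (rderiv_add (d_sq x h) (is_derive_cst d x 1)).
exact: (@rderiv_comp R (fun t : R => t `^ (sigma - 1)) (fun y => sq (f y) + d) x _ _ (is_derive1_powR (sigma - 1) (sd x)) h2).
Qed.

Lemma d_gdsq d f g (x : R) : 0 < d -> cder f g ->
  is_derive x 1 (fun y => gd d (sq (f y))) (gd' d (sq (f x)) * (2 * rip (f x) (g x))).
Proof. by move=> d0 h; exact: (@rderiv_comp R (gd d) (fun y => sq (f y)) x _ _ (d_gd d0 (sq_ge0 _)) (d_sq x h)). Qed.

Lemma meas_gd0 f : ccont f -> measurable_fun D (fun x => gd 0 (sq (f x))).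
Proof.
move=> h; have := cont_meas (cont_sq h) => m.
rewrite /gd; under eq_fun do rewrite addr0.
exact: (measurableT_comp (measurable_powR sigma) m).
Qed.

End Power.
End Nonlinear.

(** * Estimates of the nonlinearity uniform in the truncation *)

Section TrigEstimates.
Context {R : realType}.
Local Notation mu := (@lebesgue_measure R).
Local Notation D := (@torus R).
Implicit Types (f g : R -> R[i]) (a b c : int -> R[i]).

Lemma Im_scale (r : R) (w : R[i]) : complex.Im (r%:C * w) = r * complex.Im w.
Proof. by rewrite Im_mul /= mul0r addr0. Qed.

Lemma sq_scale (r : R) (w : R[i]) : sq (r%:C * w) = r ^+ 2 * sq w.
Proof. by rewrite sqM sqC. Qed.

Lemma rip_scale (z w : R[i]) (r : R) : rip z (r%:C * w) = r * rip z w.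
Proof. by rewrite /rip Re_scale Im_scale; ring. Qed.

Lemma ripDr (z w w' : R[i]) : rip z (w + w') = rip z w + rip z w'.
Proof. by rewrite /rip !raddfD /=; ring. Qed.

Lemma sq_ik c k : sq (ik c k) = k%:~R ^+ 2 * sq (c k).
Proof. by rewrite /ik sqM /sq /= expr0n add0r. Qed.

Lemma hq_ik s c X : hq s.+1 c X -> hq s (ik c) X.
Proof.
move=> h; rewrite -[X]mul1r; apply: hq_dom h _ => // k.
rewrite sq_ik mul1r wnS mulrA ler_wpM2r ?sq_ge0 // ler_wpM2l ?wn_ge0 //.
by rewrite lerDr.
Qed.

Lemma Tp_sub n a b x : Tp n a x - Tp n b x = Tp n (fun k => a k - b k) x.
Proof. by rewrite /Tp -sumrB; apply: eq_bigr => k _; rewrite mulrBl. Qed.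

Lemma ik_sub a b : ik (fun k => a k - b k) = fun k => ik a k - ik b k.
Proof. by apply/funext => k; rewrite /ik mulrBr. Qed.

Lemma Ig_sq_Tp n c : Ig (fun x => sq (Tp n c x)).
Proof. by apply: Ig_cont; apply: cont_sq; exact: ccont_Tp. Qed.

Lemma It_sq_Tp_le n c X : hq 0 c X -> It (fun x => sq (Tp n c x)) <= 2 * pi * X.
Proof.
move=> h; rewrite It_sq_Tp ler_wpM2l ?(ltW pi2_gt0) //.
by have := h n; under eq_bigr do rewrite wn0 mul1r.
Qed.

Lemma It_sq_Tp1_le n c X : hq 1 c X ->
  It (fun x => sq (Tp n c x) + sq (Tp n (ik c) x)) <= 2 * pi * X.
Proof.
move=> h; rewrite ItD; [|exact: Ig_sq_Tp..].
rewrite !It_sq_Tp -mulrDr ler_wpM2l ?(ltW pi2_gt0) // -big_split /=.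
apply: le_trans (h n); apply: ler_sum => k _.
by rewrite sq_ik /wn expr1 mulrDl mul1r.
Qed.

Lemma L2_bdd f (B : R) : measurable_fun D (fun x => complex.Re (f x)) ->
  measurable_fun D (fun x => complex.Im (f x)) -> (forall x, D x -> sq (f x) <= B) -> L2 f.
Proof.
move=> m1 m2 H; apply/L2E; split => //; apply: (Ig_bdd (B := B)).
  by apply: measurable_funD; apply: measurable_funX.
by move=> x Dx; rewrite ger0_norm ?sq_ge0 // H.
Qed.

Lemma fourier_bound f X : L2 f -> It (fun x => sq (f x)) <= 2 * pi * X -> hq 0 (fourier f) X.
Proof.
move=> hf H; apply: hq_le (bessel hf).
by rewrite mulrC ler_pdivrMr ?pi2_gt0 // mulrC.
Qed.

Variable sigma : R.
Hypothesis hsigma : 1 <= sigma.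
Local Notation gd := (gd sigma).
Local Notation gd' := (gd' sigma).

Definition nlT (d : R) n a : R -> R[i] := fun x => (gd d (sq (Tp n a x)))%:C * Tp n (ik a) x.

Variable M : R.
Hypothesis M0 : 0 <= M.
(** Bounds the squared sup norms of [u] and [u_x] when [u] is bounded by [M] in h^2; the 6 comes
    from [sum_inv_wn]. *)
Let S := 6 * M.
Let S0 : 0 <= S. Proof. by rewrite /S mulr_ge0. Qed.
Let L := sigma * (S + 1) `^ (sigma - 1).
Let G := (S + 1) `^ sigma.
Let L0 : 0 <= L. Proof. exact: L_ge0. Qed.
Let G0 : 0 <= G. Proof. exact: powR_ge0. Qed.

Lemma Tp_S n a x : hq 2 a M -> sq (Tp n a x) <= S.
Proof. by move=> h; exact: Tp_bound (hq_mono (isT : (1 <= 2)%N) h). Qed.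

Lemma Tp1_S n a x : hq 2 a M -> sq (Tp n (ik a) x) <= S.
Proof. by move=> h; exact: Tp_bound (hq_ik h). Qed.

Lemma sq_nlT d n a x : 0 <= d -> d <= 1 -> hq 2 a M -> sq (nlT d n a x) <= G ^+ 2 * S.
Proof.
move=> d0 d1 ha; rewrite /nlT sq_scale.
have h1 := Tp_S n x ha; have h2 := Tp1_S n x ha.
have g1 := gd_le hsigma S0 d0 d1 (sq_ge0 _) h1.
by apply: ler_pM; rewrite ?sqr_ge0 ?sq_ge0 // ler_sqr ?nnegrE // gd_ge0.
Qed.

Lemma L2_nlT0 n a : hq 2 a M -> L2 (nlT 0 n a).
Proof.
move=> ha; have mg := meas_gd0 sigma (ccont_Tp n a).
have [c1 c2] := ccont_Tp n (ik a).
apply: (@L2_bdd _ (G ^+ 2 * S)).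
- by under eq_fun do rewrite Re_scale; apply: measurable_funM => //; exact: cont_meas.
- by under eq_fun do rewrite Im_scale; apply: measurable_funM => //; exact: cont_meas.
- by move=> x _; exact: sq_nlT.
Qed.

Let K1 := 2 * G ^+ 2 + 8 * L ^+ 2 * S ^+ 2.

Lemma gd_diff_sq (z w : R[i]) : sq z <= S -> sq w <= S ->
  (gd 0 (sq z) - gd 0 (sq w)) ^+ 2 <= 4 * L ^+ 2 * S * sq (z - w).
Proof.
move=> h1 h2.
have h := gd_lip hsigma S0 (lexx 0) ler01 (sq_ge0 _) h1 (sq_ge0 _) h2.
rewrite -(real_normK (num_real (gd 0 _ - _))).
apply: (@le_trans _ _ ((L * `|sq z - sq w|) ^+ 2)).
  by rewrite ler_sqr ?nnegrE ?normr_ge0 // mulr_ge0.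
rewrite exprMn real_normK ?num_real //.
have -> : 4 * L ^+ 2 * S * sq (z - w) = L ^+ 2 * (sq (z - w) * (2 * S + 2 * S)) by ring.
rewrite ler_wpM2l ?sqr_ge0 //; apply: le_trans (sqB_le _ _) _.
by rewrite ler_wpM2l ?sq_ge0 // lerD // ler_wpM2l.
Qed.

Lemma nl_lip (z w z1 w1 : R[i]) : sq z <= S -> sq w <= S -> sq w1 <= S ->
  sq ((gd 0 (sq z))%:C * z1 - (gd 0 (sq w))%:C * w1) <= K1 * (sq (z - w) + sq (z1 - w1)).
Proof.
move=> h1 h1' h2.
have -> : (gd 0 (sq z))%:C * z1 - (gd 0 (sq w))%:C * w1 =
    (gd 0 (sq z))%:C * (z1 - w1) + (gd 0 (sq z) - gd 0 (sq w))%:C * w1.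
  by rewrite rmorphB /=; ring.
apply: le_trans (sqD2 _ _) _; rewrite !sq_scale.
have h3 := gd_diff_sq h1 h1'.
have g1 := gd_le hsigma S0 (lexx 0) ler01 (sq_ge0 _) h1.
have g2 : gd 0 (sq z) ^+ 2 <= G ^+ 2 by rewrite ler_sqr ?nnegrE // gd_ge0.
set p := sq (z - w) in h3 *; set p1 := sq (z1 - w1).
have w0 : 0 <= p by exact: sq_ge0.
have w10 : 0 <= p1 by exact: sq_ge0.
have E1 : gd 0 (sq z) ^+ 2 * p1 <= G ^+ 2 * p1 by rewrite ler_wpM2r.
have E2 : (gd 0 (sq z) - gd 0 (sq w)) ^+ 2 * sq w1 <= 4 * L ^+ 2 * S * p * S.
  by apply: ler_pM; rewrite ?sqr_ge0 ?sq_ge0.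
apply: (@le_trans _ _ (2 * (G ^+ 2 * p1) + 2 * (4 * L ^+ 2 * S * p * S))); first by lra.
rewrite -subr_ge0.
have -> : K1 * (p + p1) - (2 * (G ^+ 2 * p1) + 2 * (4 * L ^+ 2 * S * p * S)) =
  2 * G ^+ 2 * p + 8 * L ^+ 2 * S ^+ 2 * p1 by rewrite /K1; ring.
have q1 : 0 <= 2 * G ^+ 2 by rewrite mulr_ge0 ?sqr_ge0.
have q2 : 0 <= 8 * L ^+ 2 by rewrite mulr_ge0 ?sqr_ge0.
have q3 := sqr_ge0 S.
by apply: addr_ge0; [exact: mulr_ge0 | apply: mulr_ge0 => //; exact: mulr_ge0].
Qed.

Lemma nlT_diff_sq n a b x : hq 2 a M -> hq 2 b M ->
  sq (nlT 0 n a x - nlT 0 n b x) <= K1 * (sq (Tp n (fun k => a k - b k) x) +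
     sq (Tp n (ik (fun k => a k - b k)) x)).
Proof.
by move=> ha hb; rewrite ik_sub -!Tp_sub; apply: nl_lip; [exact: Tp_S|exact: Tp_S|exact: Tp1_S].
Qed.

Lemma K1_ge0 : 0 <= K1.
Proof.
have p1 : 0 <= 2 * G ^+ 2 by rewrite mulr_ge0 ?sqr_ge0.
have p2 : 0 <= 8 * L ^+ 2 by rewrite mulr_ge0 ?sqr_ge0.
have p3 := sqr_ge0 S.
by apply: addr_ge0 => //; exact: mulr_ge0.
Qed.

Lemma trig_lip n a b d : hq 2 a M -> hq 2 b M -> hq 1 (fun k => a k - b k) d ->
  hq 0 (fun k => fourier (nlT 0 n a) k - fourier (nlT 0 n b) k) (K1 * d).
Proof.
move=> ha hb hd.
have La := L2_nlT0 n ha; have Lb := L2_nlT0 n hb.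
have -> : (fun k => fourier (nlT 0 n a) k - fourier (nlT 0 n b) k) =
   fourier (fun x => nlT 0 n a x - nlT 0 n b x).
  by apply/funext => k; rewrite fourierB //; exact: L2_CI.
apply: fourier_bound; first exact: L2B.
apply: (@le_trans _ _ (K1 * It (fun x => sq (Tp n (fun k => a k - b k) x) +
     sq (Tp n (ik (fun k => a k - b k)) x)))); last first.
  by rewrite mulrCA ler_wpM2l ?K1_ge0 // It_sq_Tp1_le.
have I := IgD (Ig_sq_Tp n (fun k => a k - b k)) (Ig_sq_Tp n (ik (fun k => a k - b k))).
rewrite -ItZ //; apply: It_le; [|exact: IgZ|].
  by have /L2E[] := L2B La Lb.
by move=> x _; exact: nlT_diff_sq.
Qed.

(* Integration by parts: the transport term is skew up to the Lipschitz
   constant of the coefficient. The coefficient [(|u|^2 + d)^sigma], d > 0, is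
   smooth; [|u|^(2 sigma)] is reached in the limit. *)
Lemma transport n a c : hq 2 a M -> Ig (fun x => gd 0 (sq (Tp n a x)) * rip (Tp n c x) (Tp n (ik c) x)) /\
  `|It (fun x => gd 0 (sq (Tp n a x)) * rip (Tp n c x) (Tp n (ik c) x))| <=
    L * S * It (fun x => sq (Tp n c x)).
Proof.
move=> ha.
set u := Tp n a; set u1 := Tp n (ik a); set w := Tp n c; set w1 := Tp n (ik c).
have du : cder u u1 := cder_Tp n a; have dw : cder w w1 := cder_Tp n c.
have cu : ccont u := ccont_Tp n a; have cu1 : ccont u1 := ccont_Tp n _.
have cw : ccont w := ccont_Tp n c; have cw1 : ccont w1 := ccont_Tp n _.
have uS x : sq (u x) <= S by exact: Tp_S.
have u1S x : sq (u1 x) <= S by exact: Tp1_S.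
have Iw : Ig (fun x => sq (w x)) by exact: Ig_sq_Tp.
have Iww : Ig (fun x => sq (w x) + sq (w1 x)) by apply: IgD; exact: Ig_sq_Tp.
have mr := cont_meas (cont_rip cw cw1).
have Igd (d : R) : 0 <= d -> d <= 1 -> measurable_fun D (fun x => gd d (sq (u x))) ->
    Ig (fun x => gd d (sq (u x)) * rip (w x) (w1 x)).
  move=> d0 d1 mg; apply: (Ig_le _ (IgZ G Iww)); first exact: measurable_funM.
  move=> x _; rewrite normrM; apply: ler_pM => //.
    by rewrite ger0_norm ?gd_ge0 //; exact (gd_le hsigma S0 d0 d1 (sq_ge0 _) (uS x)).
  by apply: le_trans (rip_le _ _) _; have := sq_ge0 (w x); have := sq_ge0 (w1 x); lra.
have I0 : Ig (fun x => gd 0 (sq (u x)) * rip (w x) (w1 x)).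
  by apply: Igd => //; exact: meas_gd0.
split => //.
have main (d : R) : 0 < d -> d <= 1 ->
  `|It (fun x => gd d (sq (u x)) * rip (w x) (w1 x))| <= L * S * It (fun x => sq (w x)).
  move=> d0 d1; have d0' := ltW d0.
  have dA x := d_gdsq sigma x d0 du.
  have cA : continuous (fun x => gd d (sq (u x))) := derive_continuous dA.
  have cg' : continuous (fun x => gd' d (sq (u x))) by exact: (cont_gd' d0 du).
  have cr := cont_rip cu cu1; have crw := cont_rip cw cw1.
  have cst2 : continuous ((fun=> 2) : R -> R) by move=> x; exact: cst_continuous.
  have Id : Ig (fun x => gd d (sq (u x)) * rip (w x) (w1 x)).
    by apply: Ig_cont; exact: contM.
  have cP : continuous (fun x => gd' d (sq (u x)) * (2 * rip (u x) (u1 x)) * sq (w x)).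
    by apply: contM; [apply: contM => //; exact: contM | exact: cont_sq].
  have IP := Ig_cont cP.
  (* The integrand is the derivative of the periodic function [gd d |u|^2 * |w|^2]. It exchanges the
     derivative on [w] for one on the coefficient, which is bounded uniformly in [d]. *)
  have H : It (fun x => gd d (sq (u x)) * (2 * rip (w x) (w1 x)) +
                 sq (w x) * (gd' d (sq (u x)) * (2 * rip (u x) (u1 x)))) = 0.
    apply: (@It_deriv0 _ (fun x => gd d (sq (u x)) * sq (w x))).
    - by move=> x; exact: rderiv_mul (dA x) (d_sq x dw).
    - apply: contD; first by apply: contM => //; exact: contM.
      by apply: contM; [exact: cont_sq | apply: contM => //; exact: contM].
    - by rewrite /u /w !Tp_period.
  have E : 2 * It (fun x => gd d (sq (u x)) * rip (w x) (w1 x)) =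
     - It (fun x => gd' d (sq (u x)) * (2 * rip (u x) (u1 x)) * sq (w x)).
    apply/eqP; rewrite -subr_eq0 opprK -ItZ // -ItD //; last exact: IgZ.
    by rewrite -[X in _ == X]H; apply/eqP; apply: It_eq => x _; ring.
  have B x : `|gd' d (sq (u x)) * (2 * rip (u x) (u1 x)) * sq (w x)| <= 2 * L * S * sq (w x).
    rewrite normrM (ger0_norm (sq_ge0 _)) ler_wpM2r ?sq_ge0 //.
    have /andP[g0 gL] := gd'_bound hsigma S0 d0' d1 (sq_ge0 _) (uS x).
    rewrite normrM (ger0_norm g0) normrM (ger0_norm (ler0n _ 2)).
    have -> : 2 * L * S = L * (2 * S) by ring.
    apply: ler_pM => //.
    by have := rip_le (u x) (u1 x); have := uS x; have := u1S x; lra.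
  have N : `|It (fun x => gd' d (sq (u x)) * (2 * rip (u x) (u1 x)) * sq (w x))| <= 2 * L * S * It (fun x => sq (w x)).
    rewrite -ItZ // ler_norml -mulN1r -ItZ; last exact: IgZ.
    apply/andP; split; apply: It_le; rewrite ?mulN1r //; try exact: IgZ; try exact: (IgZ _ (IgZ _ Iw)).
      by move=> x _; rewrite mulN1r; have := B x; rewrite ler_norml => /andP[].
    by move=> x _; have := B x; rewrite ler_norml => /andP[].
  have : `|2 * It (fun x => gd d (sq (u x)) * rip (w x) (w1 x))| <= 2 * L * S * It (fun x => sq (w x)).
    by rewrite E normrN.
  rewrite normrM (ger0_norm (ler0n _ 2)); lra.
apply/ler_addgt0Pr => e e0.
pose J := It (fun x => sq (w x) + sq (w1 x)).
have J0 : 0 <= J by apply: It_ge0 => x _; rewrite addr_ge0 ?sq_ge0.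
have LJ : 0 < L * J + 1 by rewrite ltr_wpDl // mulr_ge0.
pose d := Num.min 1 (e / (L * J + 1)).
have d0 : 0 < d by rewrite lt_min ltr01 divr_gt0.
have d1 : d <= 1 by rewrite ge_min lexx.
have dJ : d * (L * J) <= e.
  have : d * (L * J + 1) <= e by rewrite -ler_pdivlMr // ge_min lexx orbT.
  by have := ltW d0; lra.
have Idd : Ig (fun x => gd d (sq (u x)) * rip (w x) (w1 x)).
  apply: Igd => //; first exact: ltW.
  by apply: cont_meas; exact: derive_continuous (fun x => d_gdsq sigma x d0 du).
have Hm := main d d0 d1.
have Hd : `|It (fun x => gd d (sq (u x)) * rip (w x) (w1 x)) - It (fun x => gd 0 (sq (u x)) * rip (w x) (w1 x))| <= d * (L * J).
  rewrite -ItB //.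
  have B x : `|gd d (sq (u x)) * rip (w x) (w1 x) - gd 0 (sq (u x)) * rip (w x) (w1 x)| <= d * L * (sq (w x) + sq (w1 x)).
    rewrite -mulrBl normrM; apply: ler_pM => //.
      by rewrite mulrC; exact (gd_near hsigma S0 (ltW d0) d1 (sq_ge0 _) (uS x)).
    by apply: le_trans (rip_le _ _) _; have := sq_ge0 (w x); have := sq_ge0 (w1 x); lra.
  rewrite mulrA -ItZ // ler_norml -mulN1r -ItZ; last exact: IgZ.
  apply/andP; split; apply: It_le; rewrite ?mulN1r //; try exact: IgB; try exact: IgZ; try exact: (IgZ _ (IgZ _ Iww)).
    by move=> x _; rewrite mulN1r; have := B x; rewrite ler_norml => /andP[].
  by move=> x _; have := B x; rewrite ler_norml => /andP[].
move: Hm Hd; set A := It _; set B := It (fun x => gd 0 _ * _); set W := It (fun x => sq _).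
have := ler_norm (A - B); have := ler_norm (B - A); rewrite (distrC B A).
rewrite !ler_norml => ? ? /andP[? ?] /andP[? ?]; apply/andP; split; lra.
Qed.

Lemma accretive_arith (w r f p kk K th d d1 : R) :
  `|r| <= kk * w -> 0 <= kk -> 0 <= w -> w <= p * d -> f <= K * (p * d1) ->
  w + 2 * th * r + th ^+ 2 * f <= p * ((1 + 2 * kk * `|th|) * d + K * th ^+ 2 * d1).
Proof.
move=> hr kk0 w0 wd hf.
have h1 : th * r <= `|th| * (kk * w).
  by apply: le_trans (ler_norm _) _; rewrite normrM ler_wpM2l.
have h2 : th ^+ 2 * f <= th ^+ 2 * (K * (p * d1)) by rewrite ler_wpM2l ?sqr_ge0.
have h3 : `|th| * kk * w <= `|th| * kk * (p * d) by rewrite ler_wpM2l ?mulr_ge0.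
lra.
Qed.

Let K3 := (1 + 4 * L ^+ 2 * S ^+ 2) / 2.

(** The square of [w + th * f] is expanded. The cross term is the transport of [w] by the
    coefficient of [a] ([q1]) plus the difference of the coefficients times the bounded [v_x]
    ([q2]). Each is bounded in absolute value by [|w|^2] in l^2, so the sign of [th] does not
    matter; the square of [f] is only bounded through h^1, but carries [th^2]. *)
Lemma trig_accretive n a b d d1 th : hq 2 a M -> hq 2 b M ->
  hq 0 (fun k => a k - b k) d -> hq 1 (fun k => a k - b k) d1 ->
  hq 0 (fun k => Pn n a k - Pn n b k + th%:C * (fourier (nlT 0 n a) k - fourier (nlT 0 n b) k))
    ((1 + 2 * (L * S + K3) * `|th|) * d + K1 * th ^+ 2 * d1).
Proof.
move=> ha hb hd hd1.
have La := L2_nlT0 n ha; have Lb := L2_nlT0 n hb.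
set c := fun k => a k - b k.
pose w := Tp n c; pose w1 := Tp n (ik c).
pose f x := nlT 0 n a x - nlT 0 n b x.
have Lf : L2 f by exact: L2B.
have Lw : L2 w := ccont_L2 (ccont_Tp n c).
have If : Ig (fun x => sq (f x)) by have /L2E[] := Lf.
have Iw : Ig (fun x => sq (w x)) by exact: Ig_sq_Tp.
have -> : (fun k => Pn n a k - Pn n b k + th%:C * (fourier (nlT 0 n a) k - fourier (nlT 0 n b) k)) =
   fourier (fun x => w x + th%:C * f x).
  apply/funext => k; rewrite fourierD; [|exact: L2_CI|exact: CIZ (L2_CI Lf)].
  rewrite fourierZ; last exact: L2_CI.
  rewrite fourierB; [|exact: L2_CI..]; congr (_ + _).
  by rewrite fourier_Tp /Pn; case: ifP; rewrite ?subrr.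
apply: fourier_bound; first by apply: L2D => //; exact: L2Z.
pose q1 x := gd 0 (sq (Tp n a x)) * rip (w x) (w1 x).
pose q2 x := (gd 0 (sq (Tp n a x)) - gd 0 (sq (Tp n b x))) * rip (w x) (Tp n (ik b) x).
have fE x : rip (w x) (f x) = q1 x + q2 x.
  rewrite /q1 /q2 -!rip_scale -ripDr; congr rip.
  by rewrite /f /nlT /w1 /c ik_sub -Tp_sub rmorphB /=; ring.
have [I1 B1] := transport n c ha; rewrite -/w -/w1 in I1 B1.
have B2 x : `|q2 x| <= K3 * sq (w x).
  rewrite /q2 -rip_scale; apply: le_trans (rip_le _ _) _; rewrite sq_scale.
  have h := gd_diff_sq (Tp_S n x ha) (Tp_S n x hb); rewrite Tp_sub -/c -/(w x) in h.
  have h2 := Tp1_S n x hb.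
  have : (gd 0 (sq (Tp n a x)) - gd 0 (sq (Tp n b x))) ^+ 2 * sq (Tp n (ik b) x) <=
     4 * L ^+ 2 * S * sq (w x) * S by apply: ler_pM; rewrite ?sqr_ge0 ?sq_ge0.
  rewrite /K3; lra.
have m2 : measurable_fun D q2.
  apply: measurable_funM; last exact: cont_meas (cont_rip (ccont_Tp _ _) (ccont_Tp _ _)).
  apply: measurable_funB; exact: meas_gd0 (ccont_Tp _ _).
have I2 : Ig q2 by apply: (Ig_le m2 (IgZ K3 Iw)).
have I12 : Ig (fun x => rip (w x) (f x)).
  by under eq_fun do rewrite fE; exact: IgD.
have E : It (fun x => sq (w x + th%:C * f x)) =
    It (fun x => sq (w x)) + 2 * th * It (fun x => rip (w x) (f x)) + th ^+ 2 * It (fun x => sq (f x)).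
  rewrite -!ItZ // -!ItD //; try exact: IgZ; try (by apply: IgD => //; exact: IgZ).
  by apply: It_eq => x _; rewrite sq_rip.
have N2 : `|It q2| <= K3 * It (fun x => sq (w x)).
  rewrite -ItZ // ler_norml -mulN1r -ItZ; last exact: IgZ.
  apply/andP; split; apply: It_le; rewrite ?mulN1r //; try exact: IgZ; try exact: (IgZ _ (IgZ _ Iw)).
    by move=> x _; rewrite mulN1r; have := B2 x; rewrite ler_norml => /andP[].
  by move=> x _; have := B2 x; rewrite ler_norml => /andP[].
have NN : `|It (fun x => rip (w x) (f x))| <= (L * S + K3) * It (fun x => sq (w x)).
  have -> : It (fun x => rip (w x) (f x)) = It q1 + It q2.
    by rewrite -ItD //; apply: It_eq => x _.
  by apply: le_trans (ler_normD _ _) _; rewrite mulrDl; exact: lerD.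
have F : It (fun x => sq (f x)) <= K1 * (2 * pi * d1).
  apply: le_trans (ler_wpM2l K1_ge0 (It_sq_Tp1_le n hd1)).
  have I := IgD (Ig_sq_Tp n c) (Ig_sq_Tp n (ik c)).
  rewrite -ItZ //; apply: It_le => //; first exact: IgZ.
  by move=> x _; exact: nlT_diff_sq.
have W := It_sq_Tp_le n hd; rewrite -/w in W.
have W0 : 0 <= It (fun x => sq (w x)) by apply: It_ge0 => x _; exact: sq_ge0.
have K30 : 0 <= L * S + K3.
  have p1 : 0 <= 4 * L ^+ 2 by rewrite mulr_ge0 ?sqr_ge0.
  have p2 : 0 <= 4 * L ^+ 2 * S ^+ 2 := mulr_ge0 p1 (sqr_ge0 S).
  by have p3 := mulr_ge0 L0 S0; rewrite /K3; lra.
rewrite E; apply: accretive_arith => //; exact: It_ge0.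
Qed.

Let K5 := 8 * L ^+ 2 * S ^+ 3 + 2 * G ^+ 2 * M.

(** For [d > 0] the chain rule applies. The derivative contains [u_xx], controlled in L^2, and
    otherwise only [u] and [u_x], controlled uniformly; the bound does not involve [d], which can
    then tend to 0. *)
Lemma trig_h1_reg (d : R) n a : 0 < d -> d <= 1 -> hq 2 a M ->
  L2 (nlT d n a) /\ hq 1 (fourier (nlT d n a)) (G ^+ 2 * S + K5).
Proof.
move=> d0 d1 ha; have d0' := ltW d0.
pose u := Tp n a; pose u1 := Tp n (ik a); pose u2 := Tp n (ik (ik a)).
have du : cder u u1 := cder_Tp n a; have du1 : cder u1 u2 := cder_Tp n _.
have cu : ccont u := ccont_Tp n a; have cu1 : ccont u1 := ccont_Tp n _.
have cu2 : ccont u2 := ccont_Tp n _.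
pose A x := gd d (sq (u x)); pose A' x := gd' d (sq (u x)) * (2 * rip (u x) (u1 x)).
have dA : cder (fun x => (A x)%:C) (fun x => (A' x)%:C).
  by move=> x; split; [exact: d_gdsq | exact: is_derive_cst].
have cst2 : continuous ((fun=> 2) : R -> R) by move=> x; exact: cst_continuous.
have cA' : ccont (fun x => (A' x)%:C).
  split; last by move=> x; exact: cst_continuous.
  apply: contM; first exact: (cont_gd' d0 du).
  by apply: contM => //; exact: cont_rip.
have cA := cder_ccont dA.
have df := cderM dA du1.
have cf : ccont (nlT d n a) := ccontM cA cu1.
have cf1 : ccont (fun x => (A' x)%:C * u1 x + (A x)%:C * u2 x) := ccontD (ccontM cA' cu1) (ccontM cA cu2).
have fp : (A (2 * pi))%:C * u1 (2 * pi) = (A 0)%:C * u1 0 by rewrite /A /u /u1 !Tp_period.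
have fd k := fourier_deriv k df cf1 fp.
have Lf := ccont_L2 cf; split => //.
have I1 : hq 0 (fourier (nlT d n a)) (G ^+ 2 * S).
  apply: fourier_bound => //; rewrite mulrC -It_cst; have /L2E[_ _ I] := Lf.
  by apply: It_le => // [|x _]; [exact: Ig_cst | exact: sq_nlT].
have I2 : hq 0 (ik (fourier (nlT d n a))) K5.
  have -> : ik (fourier (nlT d n a)) = fourier (fun x => (A' x)%:C * u1 x + (A x)%:C * u2 x).
    by apply/funext => k; rewrite fd.
  apply: fourier_bound; first exact: ccont_L2.
  have /L2E[_ _ I] := ccont_L2 cf1.
  have Iu2 : Ig (fun x => sq (u2 x)) by exact: Ig_sq_Tp.
  apply: (@le_trans _ _ (It (fun x => 8 * L ^+ 2 * S ^+ 3 + 2 * G ^+ 2 * sq (u2 x)))).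
    apply: It_le => //; first by apply: IgD; [exact: Ig_cst | exact: IgZ].
    move=> x _; apply: le_trans (sqD2 _ _) _; rewrite !sq_scale.
    have uS := Tp_S n x ha; have u1S := Tp1_S n x ha; rewrite -/u -/u1 in uS u1S.
    have /andP[g0 gL] := gd'_bound hsigma S0 d0' d1 (sq_ge0 _) uS.
    have gG := gd_le hsigma S0 d0' d1 (sq_ge0 _) uS.
    have E1 : A' x ^+ 2 <= (L * (2 * S)) ^+ 2.
      rewrite -(real_normK (num_real (A' x))) ler_sqr ?nnegrE ?normr_ge0 //; last first.
        by rewrite mulr_ge0 // mulr_ge0.
      rewrite /A' normrM (ger0_norm g0) normrM (ger0_norm (ler0n _ 2)).
      apply: ler_pM => //.
      by have := rip_le (u x) (u1 x); lra.
    have E2 : A x ^+ 2 <= G ^+ 2 by rewrite ler_sqr ?nnegrE // gd_ge0.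
    have F1 : A' x ^+ 2 * sq (u1 x) <= (L * (2 * S)) ^+ 2 * S.
      by apply: ler_pM; rewrite ?sqr_ge0 ?sq_ge0.
    have F2 : A x ^+ 2 * sq (u2 x) <= G ^+ 2 * sq (u2 x) by rewrite ler_wpM2r ?sq_ge0.
    apply: (@le_trans _ _ (2 * ((L * (2 * S)) ^+ 2 * S) + 2 * (G ^+ 2 * sq (u2 x)))); first by lra.
    by rewrite le_eqVlt; apply/orP; left; apply/eqP; ring.
  rewrite ItD; [|exact: Ig_cst|exact: IgZ].
  rewrite It_cst ItZ //.
  have -> : 2 * pi * K5 = 8 * L ^+ 2 * S ^+ 3 * (2 * pi) + 2 * G ^+ 2 * (2 * pi * M).
    by rewrite /K5; move: (L) (S) (G) => L' S' G'; ring.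
  rewrite lerD2l ler_wpM2l //; first by apply: mulr_ge0 => //; exact: sqr_ge0.
  by apply: It_sq_Tp_le; apply: hq_ik; exact: hq_ik.
have := @hq_dom2 R 1 0 0 (fourier (nlT d n a)) _ _ 1 1 _ _ ler01 ler01 I1 I2.
rewrite !mul1r; apply=> k.
by rewrite sq_ik !wn0 !mul1r /wn expr1 mulrDl mul1r.
Qed.

Lemma trig_h1 n a : hq 2 a M -> hq 1 (fourier (nlT 0 n a)) (G ^+ 2 * S + K5).
Proof.
move=> ha.
have h0 (m : nat) : 0 < m.+1%:R^-1 :> R by rewrite invr_gt0.
have h1 (m : nat) : m.+1%:R^-1 <= 1 :> R by rewrite invf_le1 // ler1n.
have L0' := L2_nlT0 n ha.
apply: (@hq_lim _ 1 (fun m => fourier (nlT m.+1%:R^-1 n a))); last first.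
  by apply: nearW => m; have [] := trig_h1_reg n (h0 m) (h1 m) ha.
apply: (@hq_near_ccvg _ _ _ (fun m => L ^+ 2 * S * harmonic m)).
  rewrite -[X in _ --> X](mulr0 (L ^+ 2 * S)); apply: cvgM; first exact: cvg_cst.
  exact: cvg_harmonic.
move=> m; have [Lm _] := trig_h1_reg n (h0 m) (h1 m) ha.
have -> : (fun k => fourier (nlT m.+1%:R^-1 n a) k - fourier (nlT 0 n a) k) =
   fourier (fun x => nlT m.+1%:R^-1 n a x - nlT 0 n a x).
  by apply/funext => k; rewrite fourierB //; exact: L2_CI.
apply: fourier_bound; first exact: L2B.
rewrite mulrC -It_cst; have /L2E[_ _ I] := L2B Lm L0'.
apply: It_le => // [|x _]; first exact: Ig_cst.
rewrite /nlT -mulrBl -rmorphB sq_scale.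
have h := gd_near hsigma S0 (ltW (h0 m)) (h1 m) (sq_ge0 _) (Tp_S n x ha).
rewrite -(real_normK (num_real (gd _ _ - _))) [leRHS]mulrAC.
apply: ler_pM; rewrite ?sqr_ge0 ?sq_ge0 //; last exact: Tp1_S.
apply: (@le_trans _ _ ((L * m.+1%:R^-1) ^+ 2)).
  by rewrite ler_sqr ?nnegrE ?normr_ge0 // mulr_ge0 // ltW.
rewrite exprMn ler_wpM2l ?sqr_ge0 // /harmonic /= expr2 -[leRHS]mulr1 ler_wpM2l ?(ltW (h0 m)) //.
Qed.

End TrigEstimates.

(** * The nonlinearity on H^2 *)

Section NonlinearityLimit.
Context {R : realType}.
Local Notation mu := (@lebesgue_measure R).
Local Notation D := (@torus R).
Implicit Types (f g : R -> R[i]) (a b c : int -> R[i]).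

Lemma L2_ae f g : measurable_fun D (fun x => complex.Re (f x)) ->
  measurable_fun D (fun x => complex.Im (f x)) -> torus_eq f g -> L2 g -> L2 f.
Proof.
move=> m1 m2 fg /L2E[n1 n2 Ih]; apply/L2E; split => //.
have mf : measurable_fun D (fun x => sq (f x)).
  by apply: measurable_funD; apply: measurable_funX.
apply/integrableP; split; first exact/measurable_EFinP.
have /integrableP[mg] := Ih; congr (_ < _)%E; apply: ae_eq_integral.
- exact: mtorus.
- by apply: measurableT_comp.
- by apply: measurableT_comp => //; exact/measurable_EFinP.
- by apply: (ae_S2 _ fg fg) => x /= h _ Dx; rewrite h.
Qed.

Lemma ccvg_hq0 (c : nat -> int -> R[i]) (z : int -> R[i]) :
  (forall e : R, 0 < e -> exists n0, forall n, (n0 <= n)%N -> hq 0 (fun k => c n k - z k) e) ->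
  ccvg c z.
Proof.
move=> H k.
have K (e : R) : 0 < e -> exists n0, forall n, (n0 <= n)%N -> sq (c n k - z k) <= (e / 2) ^+ 2.
  move=> e0; have e2 : 0 < (e / 2) ^+ 2 by rewrite exprn_gt0 // divr_gt0.
  have [n0 Hn] := H _ e2; exists n0 => n hn.
  by have := hq_term k (Hn n hn); rewrite wn0 mul1r.
have ab (x y e : R) : 0 < e -> x ^+ 2 + y ^+ 2 <= (e / 2) ^+ 2 -> `|x| < e /\ `|y| < e.
  move=> e0 h; have e2 : 0 <= e / 2 by rewrite divr_ge0 // ltW.
  have q (w : R) : w ^+ 2 <= (e / 2) ^+ 2 -> `|w| < e.
    rewrite -(real_normK (num_real w)) ler_sqr ?nnegrE ?normr_ge0 // => ?.
    have := e0; lra.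
  have hx := sqr_ge0 x; have hy := sqr_ge0 y.
  by split; apply: q; lra.
split; apply/cvgrPdist_lt => e e0; have [n0 Hn] := K e e0; exists n0 => // n /= hn.
- by rewrite distrC; have [] := ab _ _ e e0 (Hn n hn); case: (c n k) (z k) => [? ?] [? ?].
- by rewrite distrC; have [] := ab _ _ e e0 (Hn n hn); case: (c n k) (z k) => [? ?] [? ?].
Qed.

Lemma ccvg_Pn s c X : hq s c X -> ccvg (fun n => Pn n c) c.
Proof.
move=> hc k; split; apply: cvg_near_cst; exists `|k|%N => // n /= hn; rewrite /Pn hn //.
Qed.

Variable sigma : R.
Hypothesis hsigma : 1 <= sigma.
Local Notation gd := (gd sigma).
Local Notation nl := (nonlinearity sigma).

Lemma normc_powR (z : R[i]) : normc z `^ (2 * sigma) = gd 0 (sq z).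
Proof.
have h : 0 <= normc z by case: z => x y; exact: sqrtr_ge0.
by rewrite powRrM powR_mulrn // sqE /gd addr0.
Qed.

Lemma dxE f : dx f = synth (ik (fourier f)).
Proof. exact: multiplierE. Qed.

Lemma nl_meas f : L2 f -> L2 (dx f) ->
  measurable_fun D (fun x => complex.Re (nl f x)) /\ measurable_fun D (fun x => complex.Im (nl f x)).
Proof.
move=> /L2E[m1 m2 _] /L2E[d1 d2 _].
have mg : measurable_fun D (fun x => normc (f x) `^ (2 * sigma)).
  under eq_fun do rewrite normc_powR /gd addr0.
  apply: (measurableT_comp (measurable_powR sigma)).
  by apply: measurable_funD; apply: measurable_funX.
split; rewrite /nonlinearity.
- by under eq_fun do rewrite Re_scale; exact: measurable_funM.
- by under eq_fun do rewrite Im_scale; exact: measurable_funM.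
Qed.

(** [f] and [dx f] agree almost everywhere with the sums [F] and [G] of uniformly convergent series,
    so by the pointwise bound [nl_lip] the truncated nonlinearities converge uniformly. *)
Lemma nl_limit f M : L2 f -> hq 2 (fourier f) M ->
  L2 (nl f) /\ ccvg (fun n => fourier (nlT sigma 0 n (fourier f))) (fourier (nl f)).
Proof.
move=> Lf hM; have M0 := hq_ge0 hM.
set c := fourier f in hM *.
have h1 : hq 1 c M := hq_mono (s := 1) (s' := 2) isT hM.
have h1' : hq 1 (ik c) M := hq_ik hM.
have [F [LF cF bF uF]] := series_ex h1.
have [G [LG cG bG uG]] := series_ex h1'.
have [Ld cd] := synthP h1'; rewrite -dxE in Ld cd.
have fF : torus_eq f F by apply: fourier_inj => // k; rewrite cF.
have dG : torus_eq (dx f) G by apply: fourier_inj => // k; rewrite cd cG.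
pose NF x : R[i] := (gd 0 (sq (F x)))%:C * G x.
have S0 : 0 <= 6 * M by rewrite mulr_ge0.
have bNF x : sq (NF x) <= ((6 * M + 1) `^ sigma) ^+ 2 * (6 * M).
  rewrite /NF sq_scale; apply: ler_pM; rewrite ?sqr_ge0 ?sq_ge0 //.
  rewrite ler_sqr ?nnegrE ?powR_ge0 //.
  by apply: (gd_le hsigma S0) => //; exact: sq_ge0.
have [mF1 mF2 _] := (L2E F).1 LF; have [mG1 mG2 _] := (L2E G).1 LG.
have mg : measurable_fun D (fun x => gd 0 (sq (F x))).
  rewrite /gd; under eq_fun do rewrite addr0.
  apply: (measurableT_comp (measurable_powR sigma)).
  by apply: measurable_funD; apply: measurable_funX.
have LNF : L2 NF.
  apply: (@L2_bdd _ _ (((6 * M + 1) `^ sigma) ^+ 2 * (6 * M))) => //.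
  - by under eq_fun do rewrite Re_scale; exact: measurable_funM.
  - by under eq_fun do rewrite Im_scale; exact: measurable_funM.
have E : torus_eq (nl f) NF.
  apply: (ae_S2 _ fF dG) => x /= hf hd Dx.
  by rewrite /nonlinearity /NF normc_powR hf // hd.
have [mn1 mn2] := nl_meas Lf Ld.
have Ln : L2 (nl f) := L2_ae mn1 mn2 E LNF; split => //.
apply: ccvg_hq0 => e e0.
have K0 := K1_ge0 sigma M.
set K := (X in 0 <= X) in K0.
pose d := e / (2 * (K + 1)).
have d0 : 0 < d by rewrite /d divr_gt0 // mulr_gt0 // ltr_wpDl.
have [n1 H1] := uF d d0; have [n2 H2] := uG d d0.
exists (maxn n1 n2) => n; rewrite geq_max => /andP[hn1 hn2].
have LT := L2_nlT0 hsigma M0 n hM.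
have -> : (fun k => fourier (nlT sigma 0 n c) k - fourier (nl f) k) =
   fourier (fun x => nlT sigma 0 n c x - NF x).
  apply/funext => k; rewrite fourierB; [|exact: L2_CI..].
  by rewrite (torus_eq_fourier k E (L2_CI Ln) (L2_CI LNF)).
apply: fourier_bound; first exact: L2B.
rewrite mulrC -It_cst; have /L2E[_ _ I] := L2B LT LNF.
apply: It_le => //; first exact: Ig_cst.
move=> x _; rewrite /nlT /NF.
apply: le_trans (nl_lip hsigma M0 _ (Tp_S n x hM) (bF x) (bG x)) _; rewrite -/K.
apply: (@le_trans _ _ (K * (d + d))); first by rewrite ler_wpM2l // lerD ?H1 ?H2.
have -> : K * (d + d) = e * (K / (K + 1)) by rewrite /d; field; have := K0; lra.
by rewrite ger_pMr // ler_pdivrMr ?ltr_wpDl // mul1r lerDl.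
Qed.

Definition Nh c : int -> R[i] := fourier (nl (synth c)).

Lemma Nh_limit c M : hq 2 c M -> ccvg (fun n => fourier (nlT sigma 0 n c)) (Nh c).
Proof.
move=> hM; have [L E] := synthP (hq_mono (s := 1) (s' := 2) isT hM).
have Ec : fourier (synth c) = c by apply/funext.
by have := nl_limit (M := M) L; rewrite Ec => /(_ hM)[].
Qed.

Lemma fourier_nl f M : L2 f -> hq 2 (fourier f) M -> L2 (nl f) /\ fourier (nl f) = Nh (fourier f).
Proof.
move=> Lf hM; have [L E] := synthP (hq_mono (s := 1) (s' := 2) isT hM).
have Ec : fourier (synth (fourier f)) = fourier f by apply/funext.
have [Ln _] := nl_limit Lf hM; split; first exact: Ln.
apply/funext => k.
have hM' : hq 2 (fourier (synth (fourier f))) M by rewrite Ec.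
have [Ln' _] := nl_limit L hM'.
apply: torus_eq_fourier; [|exact: L2_CI..].
have fs : torus_eq f (synth (fourier f)) by apply: fourier_inj => // j; rewrite Ec.
apply: (ae_S2 _ fs fs) => x /= h _ Dx.
by rewrite /nonlinearity h // !dxE Ec.
Qed.

Lemma trig_consts M : 0 <= M -> exists A B C : R, [/\ 0 <= A, 0 <= B, 0 <= C &
  forall n, [/\ forall a, hq 2 a M -> hq 1 (fourier (nlT sigma 0 n a)) A,
    forall a b d, hq 2 a M -> hq 2 b M -> hq 1 (fun k => a k - b k) d ->
      hq 0 (fun k => fourier (nlT sigma 0 n a) k - fourier (nlT sigma 0 n b) k) (B * d) &
    forall a b d d1 th, hq 2 a M -> hq 2 b M ->
      hq 0 (fun k => a k - b k) d -> hq 1 (fun k => a k - b k) d1 ->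
      hq 0 (fun k => Pn n a k - Pn n b k +
          th%:C * (fourier (nlT sigma 0 n a) k - fourier (nlT sigma 0 n b) k))
        ((1 + C * `|th|) * d + B * th ^+ 2 * d1)]].
Proof.
move=> M0; have K0 := K1_ge0 sigma M.
have S0 : 0 <= 6 * M by rewrite mulr_ge0.
have L0 := L_ge0 hsigma (6 * M).
eexists; eexists; eexists; split; last first.
- move=> n; split.
  + by move=> a ha; exact: (trig_h1 hsigma M0 n ha).
  + by move=> a b d ha hb hd; exact: (trig_lip hsigma M0 n ha hb hd).
  + by move=> a b d d1 th ha hb hd hd1; exact: (trig_accretive hsigma M0 n th ha hb hd hd1).
- apply: mulr_ge0 => //; apply: addr_ge0; first exact: mulr_ge0.
  apply: divr_ge0 => //; apply: addr_ge0 => //; apply: mulr_ge0; last exact: sqr_ge0.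
  by apply: mulr_ge0 => //; exact: sqr_ge0.
- exact: K0.
- apply: addr_ge0; first by apply: mulr_ge0 => //; exact: sqr_ge0.
  apply: addr_ge0; apply: mulr_ge0 => //.
  + by apply: mulr_ge0 => //; exact: sqr_ge0.
  + exact: exprn_ge0.
  + by apply: mulr_ge0 => //; exact: sqr_ge0.
Qed.

Theorem good_Nh : good_nl Nh.
Proof.
move=> M; have [M0|M0] := lerP 0 M; last first.
  (* [good_nl] quantifies over all real [M]; for negative ones the ball is empty. *)
  have V u : ~ hq 2 u M by move=> /hq_ge0; rewrite leNgt M0.
  by exists 1; split => // [u /V|u v d /V|u v d d1 th /V].
have [A [B [C [A0 B0 C0 H]]]] := trig_consts M0.
exists (1 + A + B + C); split.
- lra.
- move=> u hu; apply: (hq_lim (Nh_limit hu)); apply: nearW => n; have [h _ _] := H n.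
  by apply: hq_le (h u hu); lra.
- move=> u v d hu hv hd; have d0 := hq_ge0 hd.
  have Cv := ccvgD (Nh_limit hu) (ccvgN (Nh_limit hv)).
  apply: (hq_lim Cv); apply: nearW => n; have [_ h _] := H n.
  by apply: hq_le (h u v d hu hv hd); rewrite ler_wpM2r //; lra.
- move=> u v d d1 th hu hv hd hd1; have d0 := hq_ge0 hd; have d10 := hq_ge0 hd1.
  have Cv := ccvgD (Nh_limit hu) (ccvgN (Nh_limit hv)).
  have Cp := ccvgD (ccvg_Pn hu) (ccvgN (ccvg_Pn hv)).
  apply: (hq_lim (ccvgD Cp (ccvgZ th Cv))); apply: nearW => n; have [_ _ h] := H n.
  apply: hq_le (h u v d d1 th hu hv hd hd1); apply: lerD.
    by rewrite ler_wpM2r // lerD2l ler_wpM2r //; lra.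
  by rewrite ler_wpM2r // ler_wpM2r ?sqr_ge0 //; lra.
Qed.

End NonlinearityLimit.

(** * Sobolev norms *)

Section SobolevNorm.
Context {R : realType}.
Local Notation mu := (@lebesgue_measure R).
Local Notation D := (@torus R).
Implicit Types (f g : R -> R[i]) (a b c : int -> R[i]).

Lemma esum_le (g : int -> R) (X : R) : (forall k, 0 <= g k) ->
  (\esum_(k in [set: int]) (g k)%:E <= X%:E)%E <-> forall n, \sum_(k <- zs n) g k <= X.
Proof.
move=> g0; split=> [H n | H].
  rewrite -lee_fin -sumEFin (fsbig_seq _ _ (zs_uniq n)); apply: le_trans H.
  apply: esum_ge; exists [set` zs n]; last exact: lexx.
  by split => //; exact: finite_seq.
apply: ge_ereal_sup => _ [A [fA _] <-].
have [r Ar] := (finite_seqP A).1 fA.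
pose n := \max_(k <- r) `|k|%N.
apply: (@le_trans _ _ (\sum_(k \in [set` zs n]) (g k)%:E)%E).
  apply: lee_fsum_nneg_subset => //=.
  - move=> k /set_mem Ak; apply/mem_set; rewrite /= mem_zs.
    by apply: leq_bigmax_seq => //; move: Ak; rewrite Ar.
  - by move=> k _; rewrite lee_fin.
by rewrite -(fsbig_seq _ _ (zs_uniq n)) sumEFin lee_fin.
Qed.

Definition ws (s : R) (k : int) : R := (1 + k%:~R ^+ 2) `^ s.

Lemma ws_ge0 s k : 0 <= ws s k. Proof. exact: powR_ge0. Qed.

Lemma Hnorm_leP s f (X : R) : 0 <= X -> (Hnorm s f <= X%:E)%E <->
  forall n, \sum_(k <- zs n) ws s k * sq (fourier f k) <= X ^+ 2.
Proof.
move=> X0; rewrite -esum_le; last by move=> k; rewrite mulr_ge0 ?ws_ge0 ?sq_ge0.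
have -> : (X%:E = sqrte (X ^+ 2)%:E)%E by rewrite /sqrte sqrtr_sqr ger0_norm.
rewrite /Hnorm lee_sqrt ?lee_fin ?sqr_ge0 //.
by under eq_esum do rewrite sqE.
Qed.

Lemma Hnorm2P f (X : R) : 0 <= X -> (Hnorm 2 f <= X%:E)%E <-> hq 2 (fourier f) (X ^+ 2).
Proof.
move=> X0; rewrite Hnorm_leP //.
by split=> H n; apply: le_trans (H n); apply: ler_sum => k _; rewrite /ws /wn powR_mulrn // addr_ge0 ?sqr_ge0.
Qed.

Lemma Hnorm_ltP s f (e : R) : 0 < e -> (Hnorm s f < e%:E)%E <->
  exists2 X, 0 <= X < e & (Hnorm s f <= X%:E)%E.
Proof.
move=> e0; split=> [H | [X /andP[X0 Xe] H]]; last by apply: le_lt_trans H _; rewrite lte_fin.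
have : (0 <= Hnorm s f)%E by exact: sqrte_ge0.
move: H; case E: (Hnorm s f) => [x||] //; rewrite lte_fin lee_fin => xe x0.
by exists x; rewrite ?x0.
Qed.

Lemma Hnorm2_lt f (e : R) : 0 < e -> (Hnorm 2 f < e%:E)%E -> hq 2 (fourier f) (e ^+ 2).
Proof.
by move=> e0 h; apply/Hnorm2P; [exact: ltW | exact: ltW].
Qed.

Lemma Sobolev2P f : Sobolev 2 f <-> L2 f /\ exists M, hq 2 (fourier f) M.
Proof.
split=> [[Lf H] | [Lf [M H]]]; split => //.
  have : (0 <= Hnorm 2 f)%E by exact: sqrte_ge0.
  move: H; case E: (Hnorm 2 f) => [x||] // _; rewrite lee_fin => x0.
  by exists (x ^+ 2); apply/Hnorm2P => //; rewrite E.
apply: (@le_lt_trans _ _ ((Num.sqrt M)%:E)); last exact: ltry.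
by apply/Hnorm2P; rewrite ?sqrtr_ge0 // sqr_sqrtr // (hq_ge0 H).
Qed.

Lemma Hnorm_s_hq0 (s : R) f (e : R) : 0 <= s -> 0 < e -> (Hnorm s f < e%:E)%E -> hq 0 (fourier f) (e ^+ 2).
Proof.
move=> s0 e0 /ltW /Hnorm_leP H n; apply: le_trans (H (ltW e0) n).
apply: ler_sum => k _; rewrite wn0 ler_wpM2r ?sq_ge0 // /ws.
by rewrite -[leLHS](powRr0 (1 + k%:~R ^+ 2)) ler_powR // lerDl sqr_ge0.
Qed.

(** High and low frequencies: [w^s <= eta * w^2] as soon as [w^(2 - s) >= 1 / eta], and below that
    threshold [w] is bounded by [B]. *)
Lemma weight_interp (s eta : R) : s < 2 -> 0 < eta -> exists2 A : R, 0 <= A &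
  forall k, ws s k <= eta * wn 2 k + A.
Proof.
move=> s2 eta0; have d0 : 0 < 2 - s by rewrite subr_gt0.
pose B := Num.max 1 (eta^-1 `^ (2 - s)^-1).
have B1 : 1 <= B by rewrite le_max lexx.
exists (B ^+ 2); first exact: sqr_ge0.
move=> k; rewrite /ws /wn; set w := 1 + _.
have w1 : 1 <= w by rewrite lerDl sqr_ge0.
have w0 : 0 < w := lt_le_trans ltr01 w1.
have [wB|wB] := lerP w B.
  apply: (@le_trans _ _ (w ^+ 2)).
    by rewrite -powR_mulrn ?(ltW w0) // ler_powR // ltW.
  apply: ler_wpDl; first by apply: mulr_ge0; [exact: ltW | exact: sqr_ge0].
  by rewrite ler_sqr ?nnegrE ?(ltW w0) // (le_trans (ltW w0)).
apply: ler_wpDr; first exact: sqr_ge0.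
have h : eta^-1 <= w `^ (2 - s).
  have hB : eta^-1 `^ (2 - s)^-1 <= w by apply: le_trans (ltW wB); rewrite le_max lexx orbT.
  have := ge0_ler_powR (ltW d0) (powR_ge0 _ _) (ltW w0) hB.
  by rewrite -powRrM mulVf ?gt_eqF // powRr1 // invr_ge0 ltW.
have E : w ^+ 2 = w `^ s * w `^ (2 - s).
  by rewrite -powRD ?(gt_eqF w0) ?implybT // subrKC powR_mulrn // ltW.
rewrite E mulrCA ler_peMr ?powR_ge0 //.
by rewrite -(ler_pM2l (x := eta^-1)) ?invr_gt0 // mulrA mulVf ?gt_eqF // mulr1 mul1r.
Qed.

Lemma Hnorm_interp (s e N : R) : 0 <= N -> s < 2 -> 0 < e -> exists2 d : R, 0 < d & forall f,
  hq 2 (fourier f) N -> hq 0 (fourier f) d -> (Hnorm s f < e%:E)%E.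
Proof.
move=> N0 s2 e0.
pose eta := e ^+ 2 / (8 * (N + 1)).
have e2 : 0 < e ^+ 2 by rewrite exprn_gt0.
have N1 : 0 < N + 1 by rewrite ltr_wpDl.
have eta0 : 0 < eta by rewrite divr_gt0 // mulr_gt0.
have [A A0 H] := weight_interp s2 eta0.
have A1 : 0 < A + 1 by rewrite ltr_wpDl.
exists (e ^+ 2 / (8 * (A + 1))); first by rewrite divr_gt0 // mulr_gt0.
move=> f h2 h0; apply/Hnorm_ltP => //; exists (e / 2).
  by rewrite divr_ge0 ?ltW // ltr_pdivrMr // ltr_pMr // ltr1n.
apply/Hnorm_leP => [|n]; first by rewrite divr_ge0 // ltW.
apply: (@le_trans _ _ (eta * N + A * (e ^+ 2 / (8 * (A + 1))))); last first.
  have -> : eta * N = e ^+ 2 / 8 * (N / (N + 1)) by rewrite /eta; field; rewrite gt_eqF.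
  have -> : A * (e ^+ 2 / (8 * (A + 1))) = e ^+ 2 / 8 * (A / (A + 1)) by field; rewrite gt_eqF.
  have q (x : R) : 0 <= x -> e ^+ 2 / 8 * (x / (x + 1)) <= e ^+ 2 / 8.
    move=> x0; rewrite ger_pMr ?divr_gt0 // ler_pdivrMr ?mul1r ?lerDl //.
    by rewrite ltr_wpDl.
  have -> : (e / 2) ^+ 2 = e ^+ 2 / 8 + e ^+ 2 / 8 by field.
  by apply: lerD; exact: q.
apply: (@le_trans _ _ (\sum_(k <- zs n) (eta * (wn 2 k * sq (fourier f k)) + A * (wn 0 k * sq (fourier f k))))).
  by apply: ler_sum => k _; rewrite [wn 0 k]wn0 mul1r mulrA -mulrDl ler_wpM2r ?sq_ge0 //; exact: H.
rewrite big_split /= -mulr_sumr -[X in _ + X <= _]mulr_sumr; apply: lerD; first by rewrite ler_wpM2l // ltW.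
by apply: ler_wpM2l => //; exact: h0.
Qed.

Lemma Hnorm_cvg0 (F : set_system R) (h : R -> R -> R[i]) : Filter F ->
  Hnorm 2 (h t) @[t --> F] --> 0%E <->
  forall e : R, 0 < e -> \forall t \near F, (Hnorm 2 (h t) < e%:E)%E.
Proof.
move=> FF; split=> [H e e0 | H A].
  apply: (H [set y | (y < e%:E)%E]); rewrite /nbhs /=.
  by near do rewrite lte_fin; exact: lt_nbhsl.
rewrite /nbhs /= => -[e /= e0 He].
apply: filterS (H e e0) => t ht.
have : (0 <= Hnorm 2 (h t))%E by exact: sqrte_ge0.
move: ht; rewrite /=; case: (Hnorm 2 (h t)) => [x||] //; rewrite lte_fin lee_fin => xe x0.
by apply: He; rewrite /ball /= sub0r normrN ger0_norm.
Unshelve. all: by end_near.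
Qed.

End SobolevNorm.

(** * Mild solutions *)

Section MildSolutions.
Context {R : realType}.
Local Notation mu := (@lebesgue_measure R).
Local Notation D := (@torus R).
Implicit Types (f g : R -> R[i]) (a b c : int -> R[i]).

Lemma L2_hq0 g (e : R) : 0 < e -> L2 g -> (L2norm g < e%:E)%E -> hq 0 (fourier g) (e ^+ 2).
Proof.
move=> e0 Lg; rewrite L2normE // lte_fin => h.
have I0 : 0 <= It (fun x => sq (g x)) by apply: It_ge0 => x _; exact: sq_ge0.
apply: fourier_bound => //.
apply: (@le_trans _ _ (e ^+ 2)).
  by rewrite -[leLHS]sqr_sqrtr // ler_sqr ?nnegrE ?sqrtr_ge0 ?(ltW e0) // ltW.
rewrite ler_peMl ?sqr_ge0 //; have := pi_ge2 R; lra.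
Qed.

Lemma L2norm_small g (X Y e : R) : 0 < e -> L2 g -> hq 1 (fourier g) X -> hq 0 (fourier g) Y ->
  2 * pi * Y < e ^+ 2 -> (L2norm g < e%:E)%E.
Proof.
move=> e0 Lg hX hY h; rewrite L2normE // lte_fin.
have I0 : 0 <= It (fun x => sq (g x)) by apply: It_ge0 => x _; exact: sq_ge0.
rewrite -ltr_sqr ?nnegrE ?sqrtr_ge0 ?(ltW e0) // sqr_sqrtr //.
exact: le_lt_trans (parseval_le Lg hX hY) h.
Qed.

Lemma schrodingerP t f X : hq 1 (fourier f) X ->
  L2 (schrodinger t f) /\ fourier (schrodinger t f) = Sg t (fourier f).
Proof.
move=> h; have [L E] := synthP (hq_Sg t h).
by split; [exact: L | apply/funext => k; exact: E].
Qed.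

Lemma part_mono n (p : nat -> R) : (forall j, (j < n)%N -> p j <= p j.+1) ->
  forall l j, (l <= j)%N -> (j <= n)%N -> p l <= p j.
Proof.
move=> H l j lj jn; have := jn; rewrite -(subnKC lj).
elim: (j - l)%N => [|m IH]; first by rewrite addn0.
by rewrite addnS => h; apply: le_trans (IH (ltnW h)) _; exact: H.
Qed.

Variable sigma : R.
Hypothesis hsigma : 1 <= sigma.
Local Notation nl := (nonlinearity sigma).
Local Notation Nh := (Nh sigma).
Local Notation Ff := (Ff Nh).

Lemma fourier_sub f g : L2 f -> L2 g -> fourier (f \- g) = fun k => fourier f k - fourier g k.
Proof. by move=> Lf Lg; apply/funext => k; apply: fourierB; exact: L2_CI. Qed.

Lemma nl_hq f M : L2 f -> hq 2 (fourier f) M ->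
  [/\ L2 (nl f), fourier (nl f) = Nh (fourier f) & exists X, hq 1 (fourier (nl f)) X].
Proof.
move=> Lf hM; have [Ln E] := fourier_nl hsigma Lf hM; split; [exact: Ln | exact: E |].
by have [K [_ H _ _]] := good_Nh hsigma M; exists K; rewrite E; exact: H.
Qed.

(** Continuity bounds the h^2 norm near each time, and compactness of the interval makes the bound
    uniform. *)
Lemma CH2_bounded (T : R) u : in_CH2 T u -> exists M, forall t, t \in `[0, T] ->
  L2 (u t) /\ hq 2 (fourier (u t)) M.
Proof.
move=> [hS hC].
have := (compact_near_coveringP `[0, T]%classic).1 (@segment_compact _ 0 T).
move=> /(_ nat \oo (fun n t => t \in `[0, T] -> hq 2 (fourier (u t)) n%:R)) [].
  move=> t tT; have [Lt [Mt Ht]] := (Sobolev2P (u t)).1 (hS t tT).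
  have /Hnorm_cvg0 /(_ 1 ltr01) B := hC t tT.
  have [n Hn] : exists n : nat, 2 * 1 + 2 * Mt <= n%:R.
    by exists (Num.truncn (2 * 1 + 2 * Mt)).+1; apply: ltW; exact: truncnS_gt.
  exists ([set t' | t' \in `[0, T] -> (Hnorm 2 (u t' \- u t)%R < 1%:E)%E], [set m | (n <= m)%N]).
    by split; [exact: B | exists n].
  move=> [t' m] /= [Bt' nm] t'T.
  have [Lt' _] := (Sobolev2P (u t')).1 (hS t' t'T).
  have := Hnorm2_lt ltr01 (Bt' t'T); rewrite fourier_sub // expr1n => h.
  have := hqD h Ht; under eq_fun do rewrite subrK; apply: hq_le.
  by apply: le_trans Hn _; rewrite ler_nat.
move=> n _ H; exists n%:R => t tT; have [Lt _] := (Sobolev2P (u t)).1 (hS t tT).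
by split => //; exact: (H n (leqnn n) t tT tT).
Qed.

Section FromMild.
Variables (T M : R) (u0 : R -> R[i]) (u : R -> R -> R[i]).
Hypothesis h0 : Sobolev 2 u0.
Hypothesis hM : forall t, t \in `[0, T] -> L2 (u t) /\ hq 2 (fourier (u t)) M.
Hypothesis hmild : mild_solution sigma T u0 u.

Let V (t : R) : int -> R[i] := Sg (- t) (fourier (u t)).

(** After applying [S(-t)] the integrand [Ff s (V s)] no longer depends on the end time [t]. This is
    why sums belonging to different times can be subtracted. *)
Lemma mild_riemann (t e : R) : t \in `[0, T] -> 0 < e -> exists2 delta : R, 0 < delta &
  forall n (p tag : nat -> R), p 0%N = 0 -> p n = t ->
    (forall j, (j < n)%N -> [/\ p j <= tag j, tag j <= p j.+1 & p j.+1 - p j < delta]) ->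
    hq 0 (fun k => \sum_(j < n) (p j.+1 - p j)%:C * Ff (tag j) (V (tag j)) k + (V t k - fourier u0 k)) e.
Proof.
move=> tT e0; have se0 : 0 < Num.sqrt e by rewrite sqrtr_gt0.
have [w [Lw Hw] E] := hmild tT.
have [d d0 Hd] := Hw _ se0; exists d => // n p tag p0 pn Hp.
have [Lt ht] := hM tT.
have [L0 [M0 hM0]] := (Sobolev2P u0).1 h0.
have [Ls Es] := schrodingerP t (hq_mono (s := 1) (s' := 2) isT hM0).
have Ew : fourier w = fun k => Sg t (fourier u0) k - fourier (u t) k.
  apply/funext => k; rewrite (torus_eq_fourier k E (L2_CI Lt) (L2_CI (L2B Ls Lw))).
  by rewrite fourier_sub // Es opprB addrC subrK.
have pm : forall l j, (l <= j)%N -> (j <= n)%N -> p l <= p j.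
  by apply: part_mono => j jn; have [h1 h2 _] := Hp j jn; exact: le_trans h2.
have tagT j : (j < n)%N -> tag j \in `[0, T].
  move=> jn; have [h1 h2 _] := Hp j jn; move: tT; rewrite !in_itv /= => /andP[_ tT].
  apply/andP; split; first by apply: le_trans h1; rewrite -p0; apply: pm => //; exact: ltnW.
  by apply: le_trans h2 (le_trans _ tT); rewrite -pn; exact: pm.
pose F (j : nat) := schrodinger (t - tag j) (nl (u (tag j))).
have HF j : (j < n)%N -> L2 (F j) /\ fourier (F j) = Sg t (Ff (tag j) (V (tag j))).
  move=> jn; have [Lj hj] := hM (tagT j jn).
  have [Ln En [X hX]] := nl_hq Lj hj.
  have [LF EF] := schrodingerP (t - tag j) hX; split; first exact: LF.
  by rewrite EF En /Ff /V SgNK SgD.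
have LS : L2 (fun x => \sum_(j < n) (p j.+1 - p j)%:C * F j x).
  by apply: L2_sum => j; apply: L2Z; have [] := HF j (ltn_ord j).
have := L2_hq0 se0 (L2B LS Lw) (Hd n p tag p0 pn Hp).
rewrite sqr_sqrtr ?(ltW e0) // => h.
apply: (@hq_SgK _ _ t); move: h; apply: hq_eqsq => k; congr sq.
rewrite fourierB; [|exact: L2_CI..].
rewrite fourier_sum; last by move=> j; apply: CIZ; apply: L2_CI; have [] := HF j (ltn_ord j).
rewrite Ew /Sg mulrDr mulr_sumr mulrBr; congr (_ + _).
  apply: eq_bigr => j _; have [Lj Ej] := HF j (ltn_ord j).
  by rewrite fourierZ ?Ej; [rewrite /Sg mulrCA | exact: L2_CI].
rewrite opprB; congr (_ - _).
by have := congr1 (fun c => c k) (SgNK t (fourier (u t))); rewrite /V /Sg => ->.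
Qed.

Lemma mild_init : 0 <= T -> V 0 = fourier u0.
Proof.
move=> T0; have t0 : 0 \in `[0, T] by rewrite in_itv /= lexx.
apply/funext => k; apply/eqP; rewrite -subr_eq0; apply/eqP; apply: sq_le0.
rewrite -[leLHS]mul1r -(wn0 k).
apply: (@hq_term _ 0 (fun k => V 0 k - fourier u0 k)); apply: hq_eps => e e0; rewrite add0r.
have [d _ H] := mild_riemann t0 e0.
(* At time 0 the empty partition is admissible, and its Riemann sum is 0. *)
have := H 0%N (fun=> 0) (fun=> 0) erefl erefl (fun _ => ltac:(by [])).
by under eq_fun do rewrite big_ord0 add0r.
Qed.

Lemma mild_average (a b X : R) z : 0 <= a -> a <= b -> b <= T -> 0 <= X ->
  (forall s, a <= s -> s <= b -> hq 0 (fun k => z k - Ff s (V s) k) X) ->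
  hq 0 (fun k => V b k - V a k + (b - a)%:C * z k) ((b - a) ^+ 2 * X).
Proof.
move=> a0 ab bT X0 hz; apply: hq_eps => e e0.
have Y0 : 0 <= (b - a) ^+ 2 * X by rewrite mulr_ge0 ?sqr_ge0.
have [d d0 Hpert] := hq_pert Y0 e0.
have d4 : 0 < d / 4 by rewrite divr_gt0.
have aT : a \in `[0, T] by rewrite in_itv /= a0 (le_trans ab).
have bT' : b \in `[0, T] by rewrite in_itv /= (le_trans a0).
have [da da0 Ha] := mild_riemann aT d4.
have [db db0 Hb] := mild_riemann bT' d4.
have b0 : 0 <= b := le_trans a0 ab.
have [m [m0 ma mb]] : exists m : nat, [/\ (0 < m)%N, b / m%:R < da & b / m%:R < db].
  have dd : 0 < Num.min da db by rewrite lt_min da0.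
  have := @truncnS_gt _ (b / Num.min da db); set m := Num.truncn _.
  rewrite ltr_pdivrMr // => h; exists m.+1; split => //; rewrite ltr_pdivrMr ?ltr0n // mulrC;
    by apply: lt_le_trans h _; rewrite ler_wpM2l // ge_min lexx ?orbT.
have m0' : 0 < m%:R :> R by rewrite ltr0n.
(* A partition of [[0, b]] with node [a] at index [m]. Its first half serves for [[0, a]], so the
   difference of the two sums is a Riemann sum over [[a, b]]. *)
pose p (j : nat) : R := if (j <= m)%N then a * (j%:R / m%:R) else a + (b - a) * ((j - m)%:R / m%:R).
have pS1 j : (j < m)%N -> p j.+1 - p j = a / m%:R.
  by move=> jm; rewrite /p jm (ltnW jm) -(addn1 j) natrD; field; rewrite gt_eqF.
have pS2 j : (j < m)%N -> p (m + j).+1 - p (m + j)%N = (b - a) / m%:R.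
  move=> jm; rewrite /p ltnNge leq_addr /= -addnS addKn addKn.
  case: j jm => [|j] jm; first by rewrite addn0 leqnn; field; rewrite gt_eqF.
  by rewrite -[X in (_ <= X)%N]addn0 leq_add2l /= -(addn1 j.+1) natrD; field; rewrite gt_eqF.
have p0 : p 0%N = 0 by rewrite /p leq0n mul0r mulr0.
have pm : p m = a by rewrite /p leqnn divff ?mulr1 // gt_eqF.
have p2m : p (m + m)%N = b.
  by rewrite /p -[X in (_ <= X)%N]addn0 leq_add2l leqn0 gtn_eqF // addnK divff ?gt_eqF // mulr1 addrC subrK.
have lea : a / m%:R <= b / m%:R by rewrite ler_wpM2r // invr_ge0 ltW.
have leb : (b - a) / m%:R <= b / m%:R by rewrite ler_wpM2r ?invr_ge0 ?(ltW m0') // gerBl.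
have qa0 : 0 <= a / m%:R by rewrite divr_ge0 // ltW.
have qb0 : 0 <= (b - a) / m%:R by rewrite divr_ge0 ?subr_ge0 // ltW.
have st1 j : (j < m)%N -> p j <= p j.+1 by move=> jm; rewrite -subr_ge0 pS1.
have st2 j : (j < m)%N -> p (m + j)%N <= p (m + j).+1 by move=> jm; rewrite -subr_ge0 pS2.
have := Ha m p p p0 pm.
have Pa : forall j, (j < m)%N -> [/\ p j <= p j, p j <= p j.+1 & p j.+1 - p j < da].
  by move=> j jm; split => //; [exact: st1 | rewrite pS1 //; exact: le_lt_trans ma].
have Pb : forall j, (j < m + m)%N -> [/\ p j <= p j, p j <= p j.+1 & p j.+1 - p j < db].
  move=> j jm; split => //.
    by have [h|h] := ltnP j m; [exact: st1 | rewrite -(subnKC h); apply: st2; rewrite ltn_subLR].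
  have [h|h] := ltnP j m; first by rewrite pS1 //; exact: le_lt_trans mb.
  by rewrite -(subnKC h) pS2 ?ltn_subLR //; exact: le_lt_trans mb.
move=> /(_ Pa) RA; have RB := Hb (m + m)%N p p p0 p2m Pb.
pose S k := \sum_(j < m) (p (m + j).+1 - p (m + j)%N)%:C * (z k - Ff (p (m + j)%N) (V (p (m + j)%N)) k).
have sm : \sum_(j < m) (p (m + j).+1 - p (m + j)%N) = b - a.
  rewrite (eq_bigr (fun=> (b - a) / m%:R)) => [|j _]; last exact: pS2.
  by rewrite sumr_const card_ord -[LHS]mulr_natr divfK // gt_eqF.
have hS : hq 0 S ((b - a) ^+ 2 * X).
  rewrite -sm; apply: (hq_sumM (a := fun j k => (p (m + j).+1 - p (m + j)%N)%:C * (z k - Ff (p (m + j)%N) (V (p (m + j)%N)) k))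
     (x := fun j => p (m + j).+1 - p (m + j)%N)) => // j jm; first by rewrite subr_ge0 st2.
  have pp : forall l j, (l <= j)%N -> (j <= m + m)%N -> p l <= p j.
    by apply: part_mono => l /Pb[].
  apply: hqZ; apply: hz.
    by rewrite -pm; apply: pp; rewrite ?leq_addr // leq_add2l ltnW.
  by rewrite -p2m; apply: pp; rewrite ?leq_addr // leq_add2l ltnW.
apply: (Hpert 0%N S) => //.
have := hqB RB RA; have -> : 2 * (d / 4) + 2 * (d / 4) = d by field.
apply: hq_eqsq => k; congr sq.
rewrite big_split_ord /= /S.
have smC : \sum_(j < m) (p (m + j).+1 - p (m + j)%N)%:C = (b - a)%:C.
  by rewrite -rmorph_sum sm.
have -> : \sum_(j < m) (p (m + j).+1 - p (m + j)%N)%:C *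
    (z k - Ff (p (m + j)%N) (V (p (m + j)%N)) k) = (b - a)%:C * z k -
    \sum_(j < m) (p (m + j).+1 - p (m + j)%N)%:C * Ff (p (m + j)%N) (V (p (m + j)%N)) k.
  by rewrite -smC mulr_suml -sumrB; apply: eq_bigr => j _; rewrite mulrBr.
have ringE (vb va zz s1 s2 f0 : R[i]) :
    vb - va + zz - (zz - s2) = s1 + s2 + (vb - f0) - (s1 + (va - f0)) by ring.
exact: ringE.
Qed.

Lemma mild_bdd2 : bdd2 M T V.
Proof. by move=> t t0 tT; apply: hq_Sg; apply: (hM _).2; rewrite in_itv /= t0. Qed.

(** [mild_average] is used twice. With [z = 0], boundedness of [Ff] gives a Lipschitz bound in l^2;
    interpolation with the h^2 bound turns it into Holder-1/2 continuity in h^1, hence of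
    [Ff s (V s)] in l^2. With [z = Ff tau (V tau)] this is the required expansion. *)
Lemma mild_asol : exists2 C, 0 <= C & asol Nh C 0 T V.
Proof.
have [K gF] := goodF_ex (good_Nh hsigma) M; have [K1 F1 F2 _] := gF.
have [T0|T0] := lerP 0 T; last first.
  by exists 0 => // a tau b a0 at' tb bT; have := le_trans (le_trans a0 at') (le_trans tb bT); rewrite leNgt T0.
have M0 : 0 <= M by apply: hq_ge0; apply: (mild_bdd2 (lexx 0) T0).
have K0 : 0 <= K by lra.
have lip (a b : R) : 0 <= a -> a <= b -> b <= T -> hq 0 (fun k => V b k - V a k) ((b - a) ^+ 2 * K).
  move=> a0 ab bT.
  have -> : (fun k => V b k - V a k) = fun k => V b k - V a k + (b - a)%:C * (fun=> 0) k.
    by apply/funext => k; rewrite /= mulr0 addr0.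
  apply: mild_average => // s sa sb; have s0 := le_trans a0 sa.
  have := F1 s (V s) (mild_bdd2 s0 (le_trans sb bT)).
  by move=> /(hq_mono (leq0n 1)); apply: hq_eqsq => k; rewrite sub0r sqN.
have lip' (s t : R) : 0 <= s -> s <= T -> 0 <= t -> t <= T -> hq 0 (fun k => V s k - V t k) (`|s - t| ^+ 2 * K).
  move=> s0 sT t0 tT; have [st|ts] := lerP s t.
    by apply: hq_swap; exact: lip.
  by apply: lip => //; exact: ltW.
pose C := K * (K + (2 * M + 2 * M) + 1).
have C0 : 0 <= C by rewrite mulr_ge0 // !addr_ge0 // mulr_ge0.
exists C => // a tau b a0 at' tb bT.
have ab := le_trans at' tb.
rewrite addr0; apply: mild_average => //; first by rewrite mulr_ge0 // subr_ge0.
move=> s sa sb.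
have s0 := le_trans a0 sa; have sT := le_trans sb bT.
have t0 := le_trans a0 at'; have tT := le_trans tb bT.
have hs := mild_bdd2 s0 sT; have ht := mild_bdd2 t0 tT.
have h1 := hq_interp_sqr (normr_ge0 _) (ltac:(lra) : 0 <= 2 * M + 2 * M) (lip' _ _ t0 tT s0 sT) (hqB ht hs).
apply: hq_le (F2 tau s _ _ _ ht hs h1).
have dab : `|tau - s| <= b - a by rewrite ler_norml; apply/andP; split; lra.
have -> : K * (`|tau - s| * (K + (2 * M + 2 * M)) + `|tau - s|) = C * `|tau - s| by rewrite /C; ring.
by rewrite ler_wpM2l.
Qed.

End FromMild.

End MildSolutions.

(** * Existence, uniqueness and continuous dependence *)

Section WellPosedness.
Context {R : realType}.
Variable sigma : R.
Hypothesis hsigma : 1 <= sigma.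
Local Notation nl := (nonlinearity sigma).
Local Notation Nh := (Nh sigma).
Local Notation Ff := (Ff Nh).
Implicit Types (f g : R -> R[i]) (a b c : int -> R[i]).

Section Existence.
Variables (T T' M C : R) (u0 : R -> R[i]) (V : R -> int -> R[i]).
Hypotheses (TT : T < T') (h0 : Sobolev 2 u0) (V0 : V 0 = fourier u0) (C0 : 0 <= C).
Hypotheses (bV : bdd2 M T' V) (sV : asol Nh C 0 T' V).

Let u (t : R) : R -> R[i] := synth (Sg t (V t)).

Lemma synth_sol t : 0 <= t -> t <= T' -> L2 (u t) /\ fourier (u t) = Sg t (V t).
Proof.
move=> t0 tT; have h := hq_Sg t (bV t0 tT).
have [L E] := synthP (hq_mono (s := 1) (s' := 2) isT h).
by split; [exact: L | apply/funext => k; exact: E].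
Qed.

(** The closed interval [[0, T]] lies strictly before [T'], where [asol_continuous] applies at every
    point. *)
Lemma synth_CH2 : in_CH2 T u.
Proof.
have inT t : t \in `[0, T] -> 0 <= t /\ t < T'.
  by rewrite in_itv /= => /andP[? tT]; split => //; exact: le_lt_trans TT.
split=> [t /inT[t0 tT] | t /inT[t0 tT]].
  have [L E] := synth_sol t0 (ltW tT).
  by apply/Sobolev2P; split; [exact: L | exists M; rewrite E; apply: hq_Sg; apply: bV => //; exact: ltW].
have [K gF] := goodF_ex (good_Nh hsigma) M.
apply/Hnorm_cvg0 => e e0.
have e2 : 0 < (e / 2) ^+ 2 by rewrite exprn_gt0 // divr_gt0.
have [d d0 Hd] := asol_continuous gF C0 bV sV t0 tT e2.
exists d => // t' /= tt' /inT[t'0 t'T].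
have [L E] := synth_sol t0 (ltW tT); have [L' E'] := synth_sol t'0 (ltW t'T).
apply/Hnorm_ltP => //; exists (e / 2); first by apply/andP; split; lra.
apply/Hnorm2P; first by lra.
rewrite fourier_sub // E E'; apply: Hd => //.
by rewrite distrC.
Qed.

Lemma asol_riemann n (p tag : nat -> R) (t d : R) : 0 <= d -> t <= T' -> p 0%N = 0 -> p n = t ->
  (forall j, (j < n)%N -> [/\ p j <= tag j, tag j <= p j.+1 & p j.+1 - p j < d]) ->
  hq 0 (fun k => \sum_(j < n) (p j.+1 - p j)%:C * Ff (tag j) (V (tag j)) k + (V t k - V 0 k))
    (t ^+ 2 * (C * d)).
Proof.
move=> d0 tT p0 pn Hp.
have pm : forall l j, (l <= j)%N -> (j <= n)%N -> p l <= p j.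
  by apply: part_mono => j jn; have [h1 h2 _] := Hp j jn; exact: le_trans h2.
have sm : \sum_(j < n) (p j.+1 - p j) = t.
  by rewrite -(big_mkord xpredT (fun j => p j.+1 - p j)) telescope_sumr // p0 pn subr0.
have -> : (fun k => \sum_(j < n) (p j.+1 - p j)%:C * Ff (tag j) (V (tag j)) k + (V t k - V 0 k)) =
   fun k => \sum_(j < n) (V (p j.+1) k - V (p j) k + (p j.+1 - p j)%:C * Ff (tag j) (V (tag j)) k).
  apply/funext => k; rewrite big_split /= addrC; congr (_ + _).
  by rewrite -(big_mkord xpredT (fun j => V (p j.+1) k - V (p j) k)) telescope_sumr // p0 pn.
rewrite -sm; apply: (hq_sumM (a := fun j k => V (p j.+1) k - V (p j) k + (p j.+1 - p j)%:C * Ff (tag j) (V (tag j)) k)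
   (x := fun j => p j.+1 - p j)) => [|j jn|j jn]; first exact: mulr_ge0.
  by rewrite subr_ge0 pm.
have [h1 h2 h3] := Hp j jn.
have pj0 : 0 <= p j by rewrite -p0 pm // ltnW.
have pjT : p j.+1 <= T' by apply: le_trans tT; rewrite -pn pm.
apply: hq_le (sV pj0 h1 h2 pjT); rewrite addr0 ler_wpM2l ?sqr_ge0 // ler_wpM2l //.
exact: ltW.
Qed.

Lemma synth_mild : mild_solution sigma T u0 u.
Proof.
move=> t; rewrite in_itv /= => /andP[t0 tT].
have tT' : t <= T' := le_trans tT (ltW TT).
have [L0 [M0 hM0]] := (Sobolev2P u0).1 h0.
have [Ls Es] := schrodingerP t (hq_mono (s := 1) (s' := 2) isT hM0).
have [Lt Et] := synth_sol t0 tT'.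
have Lw : L2 (schrodinger t u0 \- u t) := L2B Ls Lt.
(* The equation prescribes the integral; what has to be shown is that the Riemann sums converge to
   it. *)
exists (schrodinger t u0 \- u t); last first.
  by apply: aeW => x _ /=; rewrite opprB addrC subrK.
split; first exact: Lw.
move=> e e0.
pose q := 2 * pi * (t ^+ 2 * C).
have q0 : 0 <= q by rewrite !mulr_ge0 ?sqr_ge0 // ltW // pi_gt0.
have q1 : 0 < q + 1 by rewrite ltr_wpDl.
have e2 : 0 < e ^+ 2 by rewrite exprn_gt0.
pose d := e ^+ 2 / (q + 1).
have d0 : 0 < d by rewrite divr_gt0.
exists d => // n p tag p0 pn Hp.
have pm : forall l j, (l <= j)%N -> (j <= n)%N -> p l <= p j.
  by apply: part_mono => j jn; have [h1 h2 _] := Hp j jn; exact: le_trans h2.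
have tag0 j : (j < n)%N -> 0 <= tag j /\ tag j <= T'.
  move=> jn; have [h1 h2 _] := Hp j jn; split.
    by apply: le_trans h1; rewrite -p0; apply: pm => //; exact: ltnW.
  by apply: le_trans h2 (le_trans _ tT'); rewrite -pn; exact: pm.
pose F (j : nat) := schrodinger (t - tag j) (nl (u (tag j))).
have HF j : (j < n)%N -> [/\ L2 (F j), fourier (F j) = Sg t (Ff (tag j) (V (tag j))) &
    exists X, hq 1 (fourier (F j)) X].
  move=> jn; have [j0 jT] := tag0 j jn; have [Lj Ej] := synth_sol j0 jT.
  have hj : hq 2 (fourier (u (tag j))) M by rewrite Ej; apply: hq_Sg; exact: bV.
  have [Ln En [X hX]] := nl_hq hsigma Lj hj.
  have [LF EF] := schrodingerP (t - tag j) hX; split; first exact: LF.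
    by rewrite EF En /Ff Ej SgD.
  by exists X; rewrite EF; exact: hq_Sg.
have LS : L2 (fun x => \sum_(j < n) (p j.+1 - p j)%:C * F j x).
  by apply: L2_sum => j; apply: L2Z; have [] := HF j (ltn_ord j).
have ES k : fourier (fun x => \sum_(j < n) (p j.+1 - p j)%:C * F j x) k =
    \sum_(j < n) (p j.+1 - p j)%:C * fourier (F j) k.
  rewrite fourier_sum; last by move=> j; apply: CIZ; apply: L2_CI; have [] := HF j (ltn_ord j).
  by apply: eq_bigr => j _; have [Lj _ _] := HF j (ltn_ord j); rewrite fourierZ //; exact: L2_CI.
set g := fun x => _ - _.
have Lg : L2 g := L2B LS Lw.
have Eg : fourier g = Sg t (fun k => \sum_(j < n) (p j.+1 - p j)%:C * Ff (tag j) (V (tag j)) k + (V t k - V 0 k)).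
  apply/funext => k; rewrite /g fourierB; [|exact: L2_CI LS|exact: L2_CI Lw].
  rewrite ES fourier_sub // Es Et -V0 /Sg mulrDr mulrBr mulr_sumr opprB; congr (_ + _).
  by apply: eq_bigr => j _; have [_ -> _] := HF j (ltn_ord j); rewrite /Sg mulrCA.
(* A qualitative bound, which may depend on the partition: it admits [g] to [parseval_le], while the
   size of the error comes from [hY]. *)
have [X hX] : exists X, hq 1 (fourier g) X.
  have [X hX] : exists X, hq 1 (fun k => \sum_(j < n) (p j.+1 - p j)%:C * fourier (F j) k) X.
    have : forall m, (m <= n)%N -> exists X, hq 1 (fun k => \sum_(j < m) (p j.+1 - p j)%:C * fourier (F j) k) X.
      elim=> [_|m IH mn].
        by exists 0; under eq_fun do rewrite big_ord0; exact: hq_zero.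
      have [X hX] := IH (ltnW mn); have [_ _ [Y hY]] := HF m mn.
      eexists; under eq_fun do rewrite big_ord_recr /=.
      by apply: hqD; [exact: hX | apply: hqZ; exact: hY].
    exact.
  eexists; have -> : fourier g = fun k => \sum_(j < n) (p j.+1 - p j)%:C * fourier (F j) k -
      (Sg t (fourier u0) k - Sg t (V t) k).
    apply/funext => k; rewrite /g fourierB; [|exact: L2_CI LS|exact: L2_CI Lw].
    by rewrite ES fourier_sub // Es Et.
  apply: (hqB hX); apply: hqB; apply: hq_Sg; apply: (hq_mono (s := 1) (s' := 2) isT); first exact: hM0.
  exact: bV.
have hY : hq 0 (fourier g) (t ^+ 2 * (C * d)).
  by rewrite Eg; apply: hq_Sg; apply: asol_riemann => //; exact: ltW.
apply: (L2norm_small e0 Lg hX hY).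
have -> : 2 * pi * (t ^+ 2 * (C * d)) = e ^+ 2 * (q / (q + 1)).
  by rewrite /d mulrCA !mulrA -/q; field; rewrite gt_eqF.
by rewrite gtr_pMr // ltr_pdivrMr // mul1r ltrDl.
Qed.

Lemma synth_solution : CH2_solution sigma T u0 u.
Proof. by split; [exact: synth_CH2 | exact: synth_mild]. Qed.

End Existence.

Lemma solution_asol (T : R) u0 u : 0 < T -> Sobolev 2 u0 -> CH2_solution sigma T u0 u ->
  exists M C V, [/\ 0 <= C, V 0 = fourier u0, bdd2 M T V, asol Nh C 0 T V &
    forall t, t \in `[0, T] -> L2 (u t) /\ fourier (u t) = Sg t (V t)].
Proof.
move=> T0 h0 [hC hm]; have [M hM] := CH2_bounded hC.
have [C C0 hA] := mild_asol hsigma h0 hM hm.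
exists M, C, (fun t => Sg (- t) (fourier (u t))); split.
- exact: C0.
- exact: (mild_init hsigma h0 hM hm (ltW T0)).
- exact: (mild_bdd2 hM).
- exact: hA.
- by move=> t tT; have [L _] := hM t tT; split; [exact: L | rewrite SgNK].
Qed.

Lemma bdd2_le (M M' T T' : R) (V : R -> int -> R[i]) : M <= M' -> T' <= T -> bdd2 M T V -> bdd2 M' T' V.
Proof. by move=> MM TT h t t0 tT; apply: hq_le (h t t0 (le_trans tT TT)). Qed.

Lemma asol_unique (T M1 M2 C1 C2 : R) V W : 0 <= C1 -> 0 <= C2 -> V 0 = W 0 ->
  bdd2 M1 T V -> bdd2 M2 T W -> asol Nh C1 0 T V -> asol Nh C2 0 T W ->
  forall t, 0 <= t -> t <= T -> V t = W t.
Proof.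
move=> C10 C20 E bV bW sV sW t t0 tT.
have T0 : 0 <= T := le_trans t0 tT.
pose M := Num.max M1 M2; pose C := Num.max C1 C2.
have [K gF] := goodF_ex (good_Nh hsigma) M.
have CC : 0 <= C by rewrite le_max C10.
have bV' : bdd2 M T V by apply: bdd2_le bV => //; rewrite le_max lexx.
have bW' : bdd2 M T W by apply: bdd2_le bW => //; rewrite le_max lexx orbT.
have sV' : asol Nh C 0 T V by apply: asol_le sV => //; rewrite le_max lexx.
have sW' : asol Nh C 0 T W by apply: asol_le sW => //; rewrite le_max lexx orbT.
have h0 : hq 0 (fun k => V 0 k - W 0 k) 0 by rewrite E; under eq_fun do rewrite subrr; exact: hq_zero.
have := gronwall gF CC (lexx 0) (lexx 0) bV' bW' sV' sW' (lexx 0) T0 t0 tT h0.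
rewrite addr0 mulr0 addr0 mulr0 => h; apply/funext => k; apply/eqP; rewrite -subr_eq0; apply/eqP.
by apply: sq_le0; have := hq_term k h; rewrite wn0 mul1r.
Qed.

Lemma solution_unique (T : R) u0 u v : 0 < T -> Sobolev 2 u0 -> CH2_solution sigma T u0 u ->
  CH2_solution sigma T u0 v -> forall t, t \in `[0, T] -> torus_eq (v t) (u t).
Proof.
move=> T0 h0 su sv t tT.
have [M1 [C1 [V [C10 V0 bV sV uV]]]] := solution_asol T0 h0 su.
have [M2 [C2 [W [C20 W0 bW sW vW]]]] := solution_asol T0 h0 sv.
have [Lu Eu] := uV t tT; have [Lv Ev] := vW t tT.
move: tT; rewrite in_itv /= => /andP[t0 tT].
have E : V t = W t by apply: (asol_unique C10 C20 _ bV bW sV sW t0 tT); rewrite V0 W0.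
by apply: fourier_inj; [exact: Lv | exact: Lu | move=> k; rewrite Ev Eu E].
Qed.

End WellPosedness.

Theorem theorem1p2 (R : realType) (sigma : R) (hsigma : 1 <= sigma)
    (u0 : R -> R[i]) (hu0 : Sobolev 2 u0) :
  exists T : R,
    [/\ 0 < T,
        has_unique_CH2_solution sigma T u0 &
        exists r : R,
          [/\ 0 < r,
              forall v0, H2ball u0 r v0 -> has_unique_CH2_solution sigma T v0 &
              forall s : R, 0 <= s -> s < 2 ->
                continuous_dependence sigma T s (H2ball u0 r)]].
Proof.
have [L0 [M0 hM0]] := (Sobolev2P u0).1 hu0.
have M00 := hq_ge0 hM0.
(* Bounds the squared h^2 norm of all data at distance less than 1 from [u0]. The lifetime is thus
   common to the ball. *)
pose r0 : R := 2 * 1 + 2 * M0.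
have r00 : 0 <= r0 by rewrite /r0; lra.
have [T' [M [C [T'0 C0 H]]]] := evolution_exists (good_Nh hsigma) r00.
(* Halving keeps the interval away from [T'], where continuity in h^2 is not established. *)
pose T := T' / 2.
have T0 : 0 < T by rewrite divr_gt0.
have TT : T < T' by rewrite /T; lra.
have unif v0 : Sobolev 2 v0 -> hq 2 (fourier v0) r0 -> has_unique_CH2_solution sigma T v0.
  move=> hv0 hr; have [V [V0 bV sV]] := H _ hr.
  have S := synth_solution hsigma TT hv0 V0 C0 bV sV.
  exists (fun t => synth (Sg t (V t))); first exact: S.
  by move=> v hv; apply: (solution_unique hsigma T0 hv0 S hv).
have ball v0 : H2ball u0 1 v0 -> Sobolev 2 v0 /\ hq 2 (fourier v0) r0.
  move=> [hv0 hd]; split; first exact: hv0.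
  have [Lv _] := (Sobolev2P v0).1 hv0.
  have := Hnorm2_lt ltr01 hd; rewrite fourier_sub // expr1n => h.
  by have := hqD h hM0; under eq_fun do rewrite subrK.
(* An arbitrary solution comes with bounds of its own. By uniqueness it is the constructed one, so
   [M] and [C] serve the whole ball and [delta] can be chosen before [v0]. *)
have coef v0 u : H2ball u0 1 v0 -> CH2_solution sigma T v0 u ->
    exists V, [/\ V 0 = fourier v0, bdd2 M T V, asol (Nh sigma) C 0 T V &
      forall t, t \in `[0, T] -> L2 (u t) /\ fourier (u t) = Sg t (V t)].
  move=> /ball[hv0 hr] su; have [V [V0 bV sV]] := H _ hr.
  have bV' : bdd2 M T V by apply: bdd2_le bV => //; exact: ltW.
  have sV' : asol (Nh sigma) C 0 T V by apply: asol_le sV => //; exact: ltW.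
  have [M1 [C1 [W [C10 W0 bW sW uW]]]] := solution_asol hsigma T0 hv0 su.
  exists V; split; [exact: V0 | exact: bV' | exact: sV' |].
  move=> t tT; have [Lt Et] := uW t tT; split; first exact: Lt.
  rewrite Et; congr Sg; move: tT; rewrite in_itv /= => /andP[t0 tT].
  by apply: (asol_unique hsigma C10 C0 _ bW bV' sW sV' t0 tT); rewrite V0 W0.
exists T; split; first exact: T0.
  apply: unif; first exact: hu0.
  by apply: hq_le hM0; rewrite /r0; lra.
exists 1; split; first exact: ltr01.
  by move=> v0 /ball[hv0 hr]; exact: unif.
move=> s s0 s2 w0 Bw e e0.
have [K gF] := goodF_ex (good_Nh hsigma) M.
have [_ [M1 hM1]] := (Sobolev2P w0).1 (ball _ Bw).1.
have MM : 0 <= M.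
  have [V [_ bV _]] := H _ (ball _ Bw).2.
  exact: hq_ge0 (bV 0 (lexx 0) (ltW T'0)).
have N0 : 0 <= 2 * M + 2 * M by lra.
have [d d0 Hd] := Hnorm_interp N0 s2 e0.
(* Gronwall keeps a squared l^2 distance [X] of the data below [d] on [[0, T]], and [d] suffices for
   the H^s norm. For [s >= 0] the H^s distance of the data bounds their l^2 distance. *)
pose X := d / expR ((2 * K + 1) * T).
have X0 : 0 < X by rewrite divr_gt0 // expR_gt0.
exists (Num.sqrt X); first by rewrite sqrtr_gt0.
move=> v0 Bv hvw u v su sv t tT.
have [V [V0 bV sV uV]] := coef _ _ Bw su.
have [W [W0 bW sW vW]] := coef _ _ Bv sv.
have [Lu Eu] := uV t tT; have [Lv Ev] := vW t tT.
move: tT; rewrite in_itv /= => /andP[t0 tT].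
have [Lw0 _] := (Sobolev2P w0).1 (ball _ Bw).1.
have [Lv0 _] := (Sobolev2P v0).1 (ball _ Bv).1.
have sX : 0 < Num.sqrt X by rewrite sqrtr_gt0.
have hX := Hnorm_s_hq0 s0 sX hvw; rewrite sqr_sqrtr ?(ltW X0) // fourier_sub // -V0 -W0 in hX.
have hG := gronwall gF C0 (lexx 0) (lexx 0) bW bV sW sV (lexx 0) (ltW T0) t0 tT hX.
have hG' : hq 0 (fun k => W t k - V t k) d.
  apply: hq_le hG; rewrite addr0 mulr0 addr0 subr0 ger0_norm //.
  have -> : d = expR ((2 * K + 1) * T) * X by rewrite /X mulrC divfK // gt_eqF // expR_gt0.
  rewrite ler_wpM2r ?(ltW X0) // ler_expR ler_wpM2l //.
  by have [K1 _ _ _] := gF; lra.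
apply: Hd; rewrite fourier_sub // Ev Eu -SgB; apply: hq_Sg; last exact: hG'.
by apply: hqB; [exact: bW | exact: bV].
Qed.
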